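(* Let $G\in C^3(\mathbb{R})$ and $g(c):=G(c)-G'(c)c$, and assume $g>0$. Let $T\in(0,\infty)$, let $\Gamma$ be a $C^1$-$C^2$-evolving immersed closed hypersurface with reference surface $M\subset\mathbb{R}^{d+1}$ on $[0,T]$, and let $c\in C^1([0,T],C^0(M))\cap C^0([0,T],C^2(M))$ be such that $(\Gamma,c)$ solves $$V=g(c)H,\qquad \partial^\square c=\Delta_\Gamma\big(G'(c)\big)+cHV .$$ Then the surface area $t\mapsto\int_{\Gamma(t)}1\,\mathrm{d}\mathcal{H}^d$ of $\Gamma$ is strictly decreasing on $[0,T]$.
   Context: Let $d\ge 1$. A $C^2$-embedded closed hypersurface $M\subset\mathbb{R}^{d+1}$ is a connected, compact, $d$-dimensional $C^2$-embedded submanifold without boundary admitting a continuous unit normal. A $C^1$-$C^2$-evolving immersed closed hypersurface $\Gamma$ with reference surface $M$ and global parameterization $\theta$ is given by $\theta\in C^1([0,T],C^0(M,\mathbb{R}^{d+1}))\cap C^0([0,T],C^2(M,\mathbb{R}^{d+1}))$ such that $\theta_t:=\theta(t,\cdot)$ is an immersion for every $t\in[0,T]$; one writes $\Gamma(t):=\theta_t(M)$. Locally $\theta_t$ is an embedding, and all functions on $\Gamma(t)$ are understood as functions of $(t,p)\in[0,T]\times M$ (pullback to $M$). The normal $\nu:[0,T]\times M\to\mathbb{R}^{d+1}$ is a continuous field with $\nu(t,\cdot)$ a unit normal to $\Gamma(t)$. The mean curvature is $H:=-\mathrm{div}_\Gamma\nu$. The total velocity is $V^{\mathrm{tot}}:=\partial_t\theta$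 and the normal velocity is $V:=V^{\mathrm{tot}}\cdot\nu$. The surface gradient $\nabla_\Gamma$, surface divergence $\mathrm{div}_\Gamma$ and Laplace-Beltrami operator $\Delta_\Gamma$ at time $t$ are those of the embedded patches of $\Gamma(t)$, pulled back to $M$ (with $\nabla_\Gamma f$ viewed as an $\mathbb{R}^{d+1}$-valued tangential field). The normal time derivative is $\partial^\square f:=\partial_t f-V^{\mathrm{tot}}\cdot\nabla_\Gamma f$. Integrals $\int_{\Gamma(t)}f\,\mathrm{d}\mathcal{H}^d$ are integrals over $M$ with respect to the area measure induced by the immersion $\theta_t$ (so counted with multiplicity). *)

(* Defs.v *)
From HB Require Import structures.
From mathcomp Require Import all_boot all_order all_algebra.
From mathcomp Require Import all_classical all_reals all_analysis.
Set Implicit Arguments.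
Unset Strict Implicit.
Unset Printing Implicit Defensive.
Import Order.TTheory GRing.Theory Num.Theory.
Import numFieldNormedType.Exports.
Local Open Scope classical_set_scope.
Local Open Scope ring_scope.

(* The norm of 'rV[R]_n in the library is the sup norm, so lengths and angles
   are expressed through this Euclidean inner product. *)
Definition dot (R : realType) n (u v : 'rV[R]_n) : R :=
  \sum_(k < n) u 0 k * v 0 k.

Definition partial (R : realType) d (V : normedModType R) (i : 'I_d)
    (f : 'rV[R]_d -> V) (u : 'rV[R]_d) : V :=
  'D_(delta_mx 0 i) f u.

Definition C1_on (R : realType) d (V : normedModType R)
    (U : set 'rV[R]_d) (f : 'rV[R]_d -> V) : Prop :=
  forall u, U u ->
    differentiable f u /\ forall i : 'I_d, {for u, continuous (partial i f)}.

Definition C2_on (R : realType) d (V : normedModType R)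
    (U : set 'rV[R]_d) (f : 'rV[R]_d -> V) : Prop :=
  C1_on U f /\ forall i : 'I_d, C1_on U (partial i f).

Definition C3_fun (R : realType) (G : R -> R) : Prop :=
  (forall n, (n < 3)%N -> forall x, derivable (derive1n n G) x 1) /\
  continuous (derive1n 3 G).

(** Parametrized patches X : U -> R^(d+1), U open in R^d.  A function f (a field
    F) on the patch is given in the parameter, i.e. as a function on U. *)

Definition tangents (R : realType) d (X : 'rV[R]_d -> 'rV[R]_d.+1)
    (u : 'rV[R]_d) : 'M[R]_(d, d.+1) :=
  \matrix_(i < d) partial i X u.

(* first fundamental form g_ij = d_i X . d_j X *)
Definition gram (R : realType) d (X : 'rV[R]_d -> 'rV[R]_d.+1)
    (u : 'rV[R]_d) : 'M[R]_d :=
  \matrix_(i < d, j < d) dot (partial i X u) (partial j X u).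

Definition area_density (R : realType) d (X : 'rV[R]_d -> 'rV[R]_d.+1)
    (u : 'rV[R]_d) : R :=
  Num.sqrt (\det (gram X u)).

(* g^ij (d_i f) (d_j X) *)
Definition surf_grad (R : realType) d (X : 'rV[R]_d -> 'rV[R]_d.+1)
    (f : 'rV[R]_d -> R) (u : 'rV[R]_d) : 'rV[R]_d.+1 :=
  \sum_(i < d) \sum_(j < d)
    (invmx (gram X u) i j * partial i f u) *: partial j X u.

(* g^ij (d_i F . d_j X), for F not necessarily tangential *)
Definition surf_div (R : realType) d (X : 'rV[R]_d -> 'rV[R]_d.+1)
    (F : 'rV[R]_d -> 'rV[R]_d.+1) (u : 'rV[R]_d) : R :=
  \sum_(i < d) \sum_(j < d)
    invmx (gram X u) i j * dot (partial i F u) (partial j X u).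

Definition surf_laplace (R : realType) d (X : 'rV[R]_d -> 'rV[R]_d.+1)
    (f : 'rV[R]_d -> R) : 'rV[R]_d -> R :=
  surf_div X (surf_grad X f).

(** A local parametrization is only meaningful on
    U; its values elsewhere are arbitrary. *)

Definition local_param (R : realType) d (M : set 'rV[R]_d.+1)
    (U : set 'rV[R]_d) (phi : 'rV[R]_d -> 'rV[R]_d.+1) : Prop :=
  [/\ open U,
      C2_on U phi,
      forall u, U u -> row_free (tangents phi u),
      set_inj U phi
      (* phi is a homeomorphism onto a relatively open subset of M *)
    & forall O, open O -> O `<=` U ->
        exists2 W : set 'rV[R]_d.+1, open W & phi @` O = M `&` W].

(* n (defined on M) is a field of unit normals of the immersion X of M *)
Definition unit_normal (R : realType) d (M : set 'rV[R]_d.+1)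
    (X n : 'rV[R]_d.+1 -> 'rV[R]_d.+1) : Prop :=
  forall U phi, local_param M U phi -> forall u, U u ->
    dot (n (phi u)) (n (phi u)) = 1 /\
    forall i : 'I_d, dot (partial i (X \o phi) u) (n (phi u)) = 0.

Definition closed_hypersurface (R : realType) d (M : set 'rV[R]_d.+1) : Prop :=
  [/\ M !=set0, connected M, compact M,
      forall p, M p -> exists U phi, local_param M U phi /\ (phi @` U) p
    & exists n : 'rV[R]_d.+1 -> 'rV[R]_d.+1,
        {within M, continuous n} /\ unit_normal M id n].

Definition C2_mfd (R : realType) d (V : normedModType R)
    (M : set 'rV[R]_d.+1) (f : 'rV[R]_d.+1 -> V) : Prop :=
  forall U phi, local_param M U phi -> C2_on U (f \o phi).

(** Of a time-dependent function on M only the values at t in [0, T], p in M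
    are meaningful. *)

(* F s as s -> t with s in [0, T], s != t: one-sided at t = 0 and t = T *)
Definition dtime (R : realType) d (V : normedModType R) (T : R)
    (F : R -> 'rV[R]_d.+1 -> V) (t : R) (p : 'rV[R]_d.+1) : V :=
  lim ((s - t)^-1 *: (F s p - F t p) @[s --> within `[0, T] t^']).

(* F in C^0([0, T], C^0(M, V)) *)
Definition C0_C0 (R : realType) d (V : normedModType R) (T : R)
    (M : set 'rV[R]_d.+1) (F : R -> 'rV[R]_d.+1 -> V) : Prop :=
  forall t : R, t \in `[0, T] ->
    {within M, continuous (F t)} /\
    {uniform M, F s @[s --> within `[0, T] (nbhs t)] --> F t}.

(* F in C^1([0, T], C^0(M, V)) *)
Definition C1_C0 (R : realType) d (V : normedModType R) (T : R)
    (M : set 'rV[R]_d.+1) (F : R -> 'rV[R]_d.+1 -> V) : Prop :=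
  [/\ C0_C0 T M F,
      forall t : R, t \in `[0, T] ->
        {uniform M, (fun p => (s - t)^-1 *: (F s p - F t p))
                      @[s --> within `[0, T] t^'] --> dtime T F t}
    & C0_C0 T M (dtime T F)].

(* F in C^0([0, T], C^2(M, V)); the topology of C^2(M, V) is uniform convergence
   of the derivatives of order <= 2 on compact subsets of local parameter
   domains. *)
Definition C0_C2 (R : realType) d (V : normedModType R) (T : R)
    (M : set 'rV[R]_d.+1) (F : R -> 'rV[R]_d.+1 -> V) : Prop :=
  forall t : R, t \in `[0, T] ->
    C2_mfd M (F t) /\
    forall U phi K, local_param M U phi -> compact K -> K `<=` U ->
      [/\ {uniform K, (F s \o phi) @[s --> within `[0, T] (nbhs t)]
                        --> F t \o phi},
          forall i : 'I_d,
            {uniform K, partial i (F s \o phi)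
                          @[s --> within `[0, T] (nbhs t)]
                        --> partial i (F t \o phi)}
        & forall i j : 'I_d,
            {uniform K, partial i (partial j (F s \o phi))
                          @[s --> within `[0, T] (nbhs t)]
                        --> partial i (partial j (F t \o phi))}].

Definition evolving_immersed (R : realType) d (T : R) (M : set 'rV[R]_d.+1)
    (theta : R -> 'rV[R]_d.+1 -> 'rV[R]_d.+1) : Prop :=
  [/\ closed_hypersurface M, C1_C0 T M theta, C0_C2 T M theta
    & forall t : R, t \in `[0, T] -> forall U phi, local_param M U phi ->
        forall u, U u -> row_free (tangents (theta t \o phi) u)].

Definition normal_field (R : realType) d (T : R) (M : set 'rV[R]_d.+1)
    (theta nu : R -> 'rV[R]_d.+1 -> 'rV[R]_d.+1) : Prop :=
  {within `[0, T] `*` M,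
    continuous (fun tp : R * 'rV[R]_d.+1 => nu tp.1 tp.2)} /\
  forall t : R, t \in `[0, T] -> unit_normal M (theta t) (nu t).

(* The geometric quantities below are evaluated at the time t and the point
   phi u of M, phi being a local parametrization of M, by means of the patch
   theta_t \o phi of Gamma(t). *)

Definition mean_curvature (R : realType) d
    (theta nu : R -> 'rV[R]_d.+1 -> 'rV[R]_d.+1)
    (phi : 'rV[R]_d -> 'rV[R]_d.+1) (t : R) (u : 'rV[R]_d) : R :=
  - surf_div (theta t \o phi) (nu t \o phi) u.

Definition total_velocity (R : realType) d (T : R)
    (theta : R -> 'rV[R]_d.+1 -> 'rV[R]_d.+1) (t : R) (p : 'rV[R]_d.+1) :=
  dtime T theta t p.

Definition normal_velocity (R : realType) d (T : R)
    (theta nu : R -> 'rV[R]_d.+1 -> 'rV[R]_d.+1) (t : R) (p : 'rV[R]_d.+1) : R :=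
  dot (total_velocity T theta t p) (nu t p).

Definition normal_dtime (R : realType) d (T : R)
    (theta : R -> 'rV[R]_d.+1 -> 'rV[R]_d.+1) (f : R -> 'rV[R]_d.+1 -> R)
    (phi : 'rV[R]_d -> 'rV[R]_d.+1) (t : R) (u : 'rV[R]_d) : R :=
  dtime T f t (phi u) -
  dot (total_velocity T theta t (phi u))
      (surf_grad (theta t \o phi) (f t \o phi) u).

Definition gfun (R : realType) (G : R -> R) (c : R) : R := G c - derive1 G c * c.

Definition solves (R : realType) d (T : R) (M : set 'rV[R]_d.+1)
    (theta nu : R -> 'rV[R]_d.+1 -> 'rV[R]_d.+1) (c : R -> 'rV[R]_d.+1 -> R)
    (G : R -> R) : Prop :=
  forall U phi, local_param M U phi ->
  forall (t : R) u, t \in `[0, T] -> U u ->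
    let p := phi u in
    let V := normal_velocity T theta nu t p in
    let H := mean_curvature theta nu phi t u in
    V = gfun G (c t p) * H /\
    normal_dtime T theta c phi t u =
      surf_laplace (theta t \o phi) (fun v => derive1 G (c t (phi v))) u
      + c t p * H * V.

(* Integral over R^d with respect to the d-dimensional Lebesgue measure, as an
   iterated integral; it is only applied to nonnegative Borel functions, for
   which the two agree by Tonelli's theorem. *)
Fixpoint integral_rV (R : realType) (d : nat) :
    ('rV[R]_d -> \bar R) -> \bar R :=
  match d return ('rV[R]_d -> \bar R) -> \bar R with
  | 0 => fun f => f 0
  | d'.+1 => fun f =>
      (\int[@lebesgue_measure R]_x
         integral_rV (fun v : 'rV[R]_d' =>
           f (row_mx (x%:M : 'M[R]_1) v : 'rV[R]_(1 + d'))))%E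
  end.

Definition borel_rV (R : realType) n := g_sigma_algebraType (@open 'rV[R]_n).

(* mu is the area measure on M induced by the immersion X: in every local
   parametrization its density is sqrt (det g_ij).  This determines mu on the
   Borel subsets of M. *)
Definition area_measure (R : realType) d (M : set 'rV[R]_d.+1)
    (X : 'rV[R]_d.+1 -> 'rV[R]_d.+1)
    (mu : {measure set (borel_rV R d.+1) -> \bar R}) : Prop :=
  forall U phi, local_param M U phi ->
  forall A : set (borel_rV R d.+1), measurable A -> A `<=` phi @` U ->
    mu A = integral_rV (fun u : 'rV[R]_d =>
      (\1_(U `&` phi @^-1` A) u * area_density (X \o phi) u)%:E).

(* Main.v *)
(* If n is a unit normal of a patch X, then det (n, d_1 Y, ..., d_d Y) is at most
   the area density of Y for every immersion Y (up to orientation), with equality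
   for Y = X.  For X = theta_t and Y = theta_s with s < t, the difference of the
   determinants telescopes, and integrating by parts against a partition of unity
   chi_k leaves no derivative on theta_t - theta_s, so that one may divide by t - s
   and let s increase to t: the lower limit of (A(s) - A(t)) / (t - s) is at least
     sum_k int (grad chi_k . V^tot + chi_k V H) = int V H = int g(c) H^2,
   A being the area.  This avoids mixed derivatives of theta, which need not exist.
   Applied to the dilation field X itself, the same integration by parts gives
   d A = - int (X . nu) H, so that H cannot vanish almost everywhere and the lower
   limit is positive.  Hence every time t > 0 is preceded by arbitrarily close times
   of larger area; as A is continuous, its maximum over [s, t] is attained at s
   only. *)

Require Import Defs.
From HB Require Import structures.
From mathcomp Require Import all_boot all_order all_algebra.
From mathcomp Require Import all_classical all_reals all_analysis.
From mathcomp Require Import measurable_realfun ring lra.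
Set Implicit Arguments.
Unset Strict Implicit.
Unset Printing Implicit Defensive.
Import Order.TTheory GRing.Theory Num.Theory.
Import numFieldNormedType.Exports.
Local Open Scope classical_set_scope.
Local Open Scope ring_scope.

(** * Lebesgue measure on row vectors *)

(** The determinant is bounded by the area density from one side only, which is why times before [t]
    are compared with [t] and a lower limit is all that comes out. Freezing the normal at time [t]
    makes the integrand multilinear in the tangents; the price of integrating by parts is one
    derivative of that normal and second space derivatives of [theta s] and [theta t]. Continuity in
    time with values in C^2 controls these, differentiability in time with values in C^0 controls
    the difference quotient, so the two halves of the regularity class act separately. In the limit
    the second derivatives cancel, being symmetric in two slots in which a determinant is
    alternating, and the derivative of the normal leaves the mean curvature. The gradients of the
    weights live on different parameter domains; their sum is formed on [M], under the measure
    [mu t], once the surface gradient is known not to depend on the chart. All integrands are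
    continuous on the compact sets that carry the weights, and limits run along sequences of times,
    as dominated convergence requires. *)

Lemma borel_open (R : realType) n (A : set 'rV[R]_n) :
  open A -> measurable (A : set (borel_rV R n)).
Proof. by move=> oA; apply: sub_sigma_algebra. Qed.

Lemma borel_closed (R : realType) n (A : set 'rV[R]_n) :
  closed A -> measurable (A : set (borel_rV R n)).
Proof.
by move=> cA; rewrite -[A]setCK; apply: measurableC; apply: borel_open; exact: closed_openC.
Qed.

Lemma borel_compact (R : realType) n (A : set 'rV[R]_n) :
  compact A -> measurable (A : set (borel_rV R n)).
Proof.
move=> cA; apply: borel_closed; apply: compact_closed => //.
Qed.

Lemma within_continuous_measurable (R : realType) n (D : set 'rV[R]_n)
    (f : 'rV[R]_n -> R) :
  measurable (D : set (borel_rV R n)) -> {within D, continuous f} ->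
  measurable_fun (D : set (borel_rV R n)) (f : borel_rV R n -> R).
Proof.
move=> mD /continuousP cf.
apply: (measurability _ (RGenOpens.measurableE R)).
move=> _ [_ [a [b ->] <-]].
have /open_subspaceP [V oV] : open (f @^-1` `]a, b[%classic : set (subspace D)).
  by apply: cf; exact: interval_open.
by rewrite [RHS]setIC => <-; apply: measurableI => //; exact: borel_open.
Qed.

Lemma within_continuous_measurable_rV (R : realType) n m (D : set 'rV[R]_n)
    (f : 'rV[R]_n -> 'rV[R]_m) :
  measurable (D : set (borel_rV R n)) -> {within D, continuous f} ->
  measurable_fun (D : set (borel_rV R n)) (f : borel_rV R n -> borel_rV R m).
Proof.
move=> mD /continuousP cf.
apply: (@measurability _ _ (borel_rV R n) (borel_rV R m) _ _ open) => //.
move=> _ [B oB <-].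
have /open_subspaceP [V oV] := cf _ oB.
by rewrite [RHS]setIC => <-; apply: measurableI => //; exact: borel_open.
Qed.

Lemma mx_norm_le (R : realType) m n (x : 'M[R]_(m, n)) (e : R) : 0 <= e ->
  (forall i j, `|x i j| <= e) -> `|x| <= e.
Proof.
move=> e0 h; rewrite [leLHS]/Num.Def.normr/= mx_normrE.
by apply: bigmax_le => // -[i j] _; exact: h.
Qed.

Lemma mx_norm_lt (R : realType) m n (x : 'M[R]_(m, n)) (e : R) : 0 < e ->
  (forall i j, `|x i j| < e) -> `|x| < e.
Proof.
move=> e0 h; rewrite [ltLHS]/Num.Def.normr/= mx_normrE.
by apply: bigmax_lt => // -[i j] _; exact: h.
Qed.

Lemma ler_mx_entry (R : realType) m n (x : 'M[R]_(m, n)) i j : `|x i j| <= `|x|.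
Proof.
rewrite [leRHS]/Num.Def.normr/= mx_normrE.
exact: (le_bigmax _ (fun ij => `|x ij.1 ij.2|) (i, j)).
Qed.

(** The boxes are indexed by a countable type, so every open set is a countable union of them.
    Measurability into [borel_rV] can then be tested on coordinates. *)
Lemma open_rational_boxes (R : realType) n (O : set 'rV[R]_n) : open O ->
  exists Q : set ('rV[rat]_n * rat),
    O = \bigcup_(q in Q)
        [set v : 'rV[R]_n | forall i, `|v 0 i - ratr (q.1 0 i)| < ratr q.2].
Proof.
move=> oO; exists [set q : 'rV[rat]_n * rat | [set v : 'rV[R]_n |
    forall i, `|v 0 i - ratr (q.1 0 i)| < ratr q.2] `<=` O].
apply/seteqP; split=> [v Ov|v [q qO qv]]; last exact: qO.
have /nbhs_ballP[e /= e0 eO] : nbhs v O by exact: open_nbhs_nbhs.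
(* A rational centre within [r] of [v] puts [v] in the box of radius [r], and every other point of
   that box within [2 * r < e] of [v]. *)
have [r /andP[r0 re]] : exists r : rat, (0 < ratr r :> R) && (ratr r < e / 2 :> R).
  have [r] := @rat_in_itvoo R 0 (e / 2) (divr_gt0 e0 (ltr0n _ 2)).
  by rewrite in_itv/= => h; exists r.
have hq i : exists q : rat, `|v 0 i - ratr q| < ratr r.
  have [q] := @rat_in_itvoo R (v 0 i - ratr r) (v 0 i + ratr r) ltac:(lra).
  rewrite in_itv/= => /andP[h1 h2]; exists q; rewrite ltr_norml; lra.
pose q := \row_i sval (cid (hq i)).
have qE i : `|v 0 i - ratr (q 0 i)| < ratr r.
  by rewrite mxE; case: (cid (hq i)).
exists (q, r) => //= w ws; apply: eO.
rewrite -ball_normE/= ; apply: mx_norm_lt => // i j; rewrite !mxE (ord1 i).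
have := ws j; have := qE j; rewrite !ltr_norml; lra.
Qed.

Lemma measurable_fun_rV d (T : measurableType d) (R : realType) n
    (f : T -> 'rV[R]_n) :
  (forall i, measurable_fun [set: T] (fun x => f x 0 i)) ->
  measurable_fun [set: T] (f : T -> borel_rV R n).
Proof.
move=> mf.
apply: (@measurability _ _ T (borel_rV R n) _ _ open) => //.
move=> _ [B oB <-]; rewrite setTI ; have [Q ->] := open_rational_boxes oB.
rewrite preimage_bigcup bigcup_mkcond.
apply: countable_bigcupT_measurable => [|q]; first exact: countableP.
case: ifP => // _; rewrite [X in measurable X](_ : _ = \bigcap_(i : 'I_n)
  (fun x => f x 0 i) @^-1` (ball (ratr (q.1 0 i) : R) (ratr q.2))); last first.
  by apply/seteqP; split => [x h i _|x h i]; have := h i; rewrite /= /ball/= distrC => H; exact: H.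
apply: fin_bigcap_measurable => // i _; rewrite -[X in measurable X]setTI.
by apply: mf => //; exact: measurable_ball.
Qed.

(** The concatenation of [integral_rV] as a map on pairs, along which a product measure can be
    pushed forward. *)
Definition cons_rV (R : realType) d (z : R * 'rV[R]_d) : 'rV[R]_d.+1 :=
  row_mx (z.1%:M : 'M[R]_1) z.2 : 'rV[R]_(1 + d).

Lemma cons_rV0 (R : realType) d (z : R * 'rV[R]_d) : cons_rV z 0 ord0 = z.1.
Proof.
rewrite /cons_rV /row_mx mxE; case: splitP => [j _|j /eqP]; last by rewrite eqn_leq.
by rewrite (ord1 j) mxE eqxx mulr1n.
Qed.

Lemma cons_rVS (R : realType) d (z : R * 'rV[R]_d) j :
  cons_rV z 0 (lift ord0 j) = z.2 0 j.
Proof.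
rewrite /cons_rV /row_mx mxE; case: splitP => [k|k].
  by rewrite (ord1 k) lift0.
by rewrite lift0 => -[jk]; congr (_ 0 _); apply: val_inj.
Qed.

Lemma measurable_cons_rV (R : realType) d :
  measurable_fun setT
    (@cons_rV R d : measurableTypeR R * borel_rV R d -> borel_rV R d.+1).
Proof.
apply: measurable_fun_rV => i; case: (unliftP ord0 i) => [j|] ->.
  under eq_fun do rewrite cons_rVS.
  apply: (@measurableT_comp _ _ _ _ _ _ (fun v : borel_rV R d => v 0 j)).
    apply: within_continuous_measurable => //.
    by apply: continuous_subspaceT => v; exact: coord_continuous.
  exact: measurable_snd.
under eq_fun do rewrite cons_rV0.
exact: measurable_fst.
Qed.

Definition closed_box (R : realType) d (u : 'rV[R]_d) (r : R) : set 'rV[R]_d :=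
  [set v | forall i, `|v 0 i - u 0 i| <= r].

Lemma closed_box_compact (R : realType) d (u : 'rV[R]_d) r :
  compact (closed_box u r).
Proof.
rewrite (_ : closed_box u r =
    [set v | forall i, `[u 0 i - r, u 0 i + r]%classic (v 0 i)]); last first.
  by apply/seteqP; split=> v h i; have := h i; rewrite /= in_itv/= ler_distl.
by apply: (@rV_compact _ _ (fun i => `[u 0 i - r, u 0 i + r]%classic)) => i; exact: segment_compact.
Qed.

Lemma measurable_closed_box (R : realType) d (u : 'rV[R]_d) r :
  measurable (closed_box u r : set (borel_rV R d)).
Proof. by apply: borel_compact; exact: closed_box_compact. Qed.

(* The last clause is the divergence theorem for functions supported in a box. *)
Definition is_lebesgue_rV (R : realType) d
    (m : {sigma_finite_measure set (borel_rV R d) -> \bar R}) : Prop :=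
  [/\ forall f : 'rV[R]_d -> \bar R,
       measurable_fun [set: borel_rV R d] (f : borel_rV R d -> \bar R) ->
       (forall x, 0 <= f x)%E -> integral_rV f = (\int[m]_x f x)%E,
     forall u (r : R), 0 <= r -> m (closed_box u r) = ((r *+ 2) ^+ d)%:E
   & forall (i : 'I_d) (f : 'rV[R]_d -> R) N,
       (forall u, derivable f u (delta_mx 0 i)) -> continuous (partial i f) ->
       (forall u, ~ closed_box 0 N u -> f u = 0) ->
       (\int[m]_x (partial i f x)%:E)%E = 0%E].

(* An alias, to which the instance below attaches a proof of sigma-finiteness. *)
Definition sigma_finite_of d (T : measurableType d) (R : realType)
    (m : {measure set T -> \bar R}) of sigma_finite setT m : set T -> \bar R := m.

HB.instance Definition _ d (T : measurableType d) (R : realType)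
  (m : {measure set T -> \bar R}) (sf : sigma_finite setT m) :=
  Measure.copy (sigma_finite_of sf) m.

HB.instance Definition _ d (T : measurableType d) (R : realType)
  (m : {measure set T -> \bar R}) (sf : sigma_finite setT m) :=
  Measure_isSigmaFinite.Build d T R (sigma_finite_of sf) sf.

(** The measure in dimension [d.+1] is the image under [cons_rV] of the product with one-dimensional
    Lebesgue measure. Two transfer formulas are kept: the one for nonnegative functions feeds
    Tonelli, hence the link with [integral_rV]; the one for integrable functions feeds Fubini, hence
    the divergence clause. *)
Lemma pushforward_cons_ex (R : realType) d
    (m : {sigma_finite_measure set (borel_rV R d) -> \bar R}) :
  (forall u (r : R), 0 <= r -> m (closed_box u r) = ((r *+ 2) ^+ d)%:E) ->
  exists m' : {sigma_finite_measure set (borel_rV R d.+1) -> \bar R},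
   [/\ forall u (r : R), 0 <= r -> m' (closed_box u r) = ((r *+ 2) ^+ d.+1)%:E,
     forall f : 'rV[R]_d.+1 -> \bar R,
       measurable_fun [set: borel_rV R d.+1] (f : borel_rV R d.+1 -> \bar R) ->
       (forall x, 0 <= f x)%E -> 
       (\int[m']_x f x = \int[(lebesgue_measure \x m)%E]_z f (cons_rV z))%E &
     forall f : 'rV[R]_d.+1 -> \bar R,
       m'.-integrable [set: borel_rV R d.+1] (f : borel_rV R d.+1 -> \bar R) ->
       (lebesgue_measure \x m)%E.-integrable 
          [set: measurableTypeR R * borel_rV R d] (fun z => f (cons_rV z)) /\
       (\int[m']_x f x = \int[(lebesgue_measure \x m)%E]_z f (cons_rV z))%E].
Proof.
move=> mbox.
have mphi := @measurable_cons_rV R d.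
pose M0 : {measure set (borel_rV R d.+1) -> \bar R} := pushforward (lebesgue_measure \x m)%E
  (@cons_rV R d : measurableTypeR R * borel_rV R d -> borel_rV R d.+1).
have M0box u r : 0 <= r -> M0 mphi (closed_box u r) = ((r *+ 2) ^+ d.+1)%:E.
  move=> r0; rewrite /M0/= /pushforward.
  rewrite (_ : _ @^-1` _ = `[u 0 ord0 - r, u 0 ord0 + r]%classic `*`
      closed_box (\row_j u 0 (lift ord0 j)) r).
    rewrite product_measure1E//.
      rewrite mbox//.
      have h1 : lebesgue_measure `[u 0 ord0 - r, u 0 ord0 + r]%classic = (r *+ 2)%:E.
        rewrite lebesgue_measure_itv/= lte_fin; case: ltP => h.
          by rewrite EFinN -EFinB; congr (_%:E); ring.
        by congr (_%:E); lra.
      by rewrite exprS EFinM -h1.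
    exact: measurable_closed_box.
  apply/seteqP; split=> [z h|z [h0 h] i].
    split=> [|j]; first by have := h ord0; rewrite cons_rV0 /= in_itv/= ler_distl.
    by have := h (lift ord0 j); rewrite cons_rVS mxE.
  case: (unliftP ord0 i) => [j|] ->.
    by have := h j; rewrite cons_rVS mxE.
  by move: h0; rewrite cons_rV0 /= in_itv/= ler_distl.
have sf : sigma_finite setT (M0 mphi).
  exists (fun n => closed_box 0 n%:R).
    apply/esym/seteqP; split=> // v _; exists (Num.truncn `|v|).+1 => // i.
    rewrite mxE subr0 (le_trans (ler_mx_entry _ _ _))// ltW//.
    exact: truncnS_gt.
  move=> n; split; last by rewrite M0box ?ltry.
  exact: measurable_closed_box.
exists (sigma_finite_of sf).
pose m' := sigma_finite_of sf.
have m'E A : m' A = M0 mphi A by [].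
rewrite -/m'; split.
- exact: M0box.
- move=> f mf f0.
  transitivity (\int[M0 mphi]_x f x)%E.
    by apply: eq_measure_integral => A _ _; exact: m'E.
  by rewrite /M0 ge0_integral_pushforward.
move=> f /[dup] intf /integrableP[mf foo].
have mf' : measurable_fun [set: measurableTypeR R * borel_rV R d] (fun z => f (cons_rV z)).
  exact: (measurableT_comp mf mphi).
have intg : (lebesgue_measure \x m)%E.-integrable
          [set: measurableTypeR R * borel_rV R d] (fun z => f (cons_rV z)).
  apply/integrableP; split => //; move: foo.
  suff -> : (\int[m']_x `|f x| = \int[(lebesgue_measure \x m)%E]_z `|f (cons_rV z)|)%E by [].
  transitivity (\int[M0 mphi]_x `|f x|)%E.
    by apply: eq_measure_integral => A _ _; exact: m'E.
  rewrite /M0 ge0_integral_pushforward//.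
  exact: measurableT_comp.
split => //.
transitivity (\int[M0 mphi]_x f x)%E.
  by apply: eq_measure_integral => A _ _; exact: m'E.
by rewrite /M0 integral_pushforward.
Qed.

Lemma compact_lebesgue_fin (R : realType) d
    (m : {sigma_finite_measure set (borel_rV R d) -> \bar R}) (K : set 'rV[R]_d) :
  (forall u (r : R), 0 <= r -> m (closed_box u r) = ((r *+ 2) ^+ d)%:E) ->
  compact K -> (m K < +oo)%E.
Proof.
move=> mbox cK; have [N [_ NK]] := compact_bounded cK.
apply: (@le_lt_trans _ _ (m (closed_box 0 (`|N| + 1)))); last first.
  by rewrite mbox ?ltry// addr_ge0.
apply: le_measure; rewrite ?inE; [exact: borel_compact|exact: measurable_closed_box|].
move=> v Kv i; rewrite mxE subr0 (le_trans (ler_mx_entry _ _ _))//.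
by apply: NK => //; rewrite ltr_pwDr// ler_norm.
Qed.

Lemma within_continuous_integrable (R : realType) d
    (m : {sigma_finite_measure set (borel_rV R d) -> \bar R}) (K : set 'rV[R]_d)
    (f : 'rV[R]_d -> R) :
  (forall u (r : R), 0 <= r -> m (closed_box u r) = ((r *+ 2) ^+ d)%:E) ->
  compact K -> {within K, continuous f} -> m.-integrable K (EFin \o f).
Proof.
move=> mbox cK cf; apply: measurable_bounded_integrable.
- exact: borel_compact.
- exact: compact_lebesgue_fin.
- by apply: within_continuous_measurable => //; exact: borel_compact.
- have /compact_bounded[M [_ mrt]] := continuous_compact cf cK.
  by exists M; split; rewrite ?num_real // => ? ? ? ?; exact: mrt.
Qed.

Lemma cvg_rV (R : realType) n T (F : set_system T) {FF : Filter F}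
    (f : T -> 'rV[R]_n) (l : 'rV[R]_n) :
  (forall j, (fun x => f x 0 j) @ F --> l 0 j) -> f @ F --> l.
Proof.
move=> h; apply/cvgrPdist_lt => e e0.
have : \forall x \near F, forall j, `|l 0 j - f x 0 j| < e.
  by apply: filter_forall => j; have /cvgrPdist_lt := h j; apply.
apply: filterS => x hx; apply: mx_norm_lt => // i j.
by rewrite !mxE (ord1 i).
Qed.

Lemma continuous_cons_rVr (R : realType) d (x : R) :
  continuous (fun v : 'rV[R]_d => cons_rV (x, v)).
Proof.
move=> v; apply: (@cvg_rV _ _ _ (nbhs v)) => i; case: (unliftP ord0 i) => [j|] ->.
  by under eq_fun do rewrite cons_rVS; rewrite cons_rVS; exact: coord_continuous.
by under eq_fun do rewrite cons_rV0; rewrite cons_rV0; exact: cvg_cst.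
Qed.

Lemma continuous_cons_rVl (R : realType) d (v : 'rV[R]_d) :
  continuous (fun x : R => cons_rV (x, v)).
Proof.
move=> x; apply: cvg_rV => i; case: (unliftP ord0 i) => [j|] ->.
  by under eq_fun do rewrite cons_rVS; rewrite cons_rVS; exact: cvg_cst.
by under eq_fun do rewrite cons_rV0; rewrite cons_rV0; exact: cvg_id.
Qed.

Lemma integral_derive_eq0 (R : realType) (h h' : R -> R) (N : R) :
  (forall x : R, is_derive x (1 : R) h (h' x)) -> continuous h' ->
  (forall x, N < `|x| -> h x = 0) -> (\int[lebesgue_measure]_x (h' x)%:E = 0)%E.
Proof.
(* [N] may be negative: [|N| + 1] exceeds it and is positive, so the interval is nondegenerate and
   [h] vanishes at both ends. *)
move=> dh ch h0; pose a : R := `|N| + 1.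
have Na : N < a by rewrite ltr_pwDr// ler_norm.
have a0 : 0 < a by rewrite ltr_wpDl.
have h'0 x : a <= `|x| -> h' x = 0.
  move=> ax; have [_ <-] := dh x.
  rewrite -(derive_cst (0 : R) x (1 : R)); apply: near_eq_derive.
  have : Num.norm y @[y --> x] --> `|x| by exact: norm_continuous.
  move=> /cvgr_gt/(_ N (lt_le_trans Na ax)); apply: filterS => y Ny.
  by rewrite h0.
have -> : (\int[lebesgue_measure]_x (h' x)%:E =
           \int[lebesgue_measure]_(x in `[(- a)%R, a]) (h' x)%:E)%E.
  rewrite [RHS]integral_mkcond; apply: eq_integral => x _.
  rewrite patchE; case: ifPn => //; rewrite notin_setE/= in_itv/= -ler_norml => /negP.
  by rewrite -ltNge => /ltW/h'0 ->.
rewrite (@continuous_FTC2 _ h' h).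
- by rewrite !h0 ?subee// ?normrN gtr0_norm.
- by rewrite gtrN.
- exact: continuous_subspaceT.
- have ch0 x : {for x, continuous h}.
    by apply: differentiable_continuous; apply/derivable1_diffP; case: (dh x).
  split=> [x _||]; first by case: (dh x).
    by apply: cvg_at_right_filter; exact: ch0.
  by apply: cvg_at_left_filter; exact: ch0.
- by move=> x _; rewrite derive1E; case: (dh x).
Qed.

Lemma cons_rV_shiftr (R : realType) d (x h : R) (v : 'rV[R]_d) j :
  h *: delta_mx 0 (lift ord0 j) + cons_rV (x, v) = cons_rV (x, h *: delta_mx 0 j + v).
Proof.
apply/rowP => i; rewrite [LHS]mxE [X in X + _]mxE [X in _ * X + _]mxE.
case: (unliftP ord0 i) => [k|] ->.
  by rewrite !cons_rVS !mxE (inj_eq lift_inj).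
by rewrite !cons_rV0/= mulr0 add0r.
Qed.

Lemma partial_cons_rVS (R : realType) d (f : 'rV[R]_d.+1 -> R) (x : R) (j : 'I_d)
    (v : 'rV[R]_d) : partial (lift ord0 j) f (cons_rV (x, v)) =
  partial j (fun w : 'rV[R]_d => f (cons_rV (x, w))) v.
Proof.
by rewrite /partial /derive; under eq_fun do rewrite /= cons_rV_shiftr.
Qed.

Lemma cons_rV_shiftl (R : realType) d (x h : R) (v : 'rV[R]_d) :
  h *: delta_mx 0 ord0 + cons_rV (x, v) = cons_rV (h + x, v).
Proof.
apply/rowP => i; rewrite [LHS]mxE [X in X + _]mxE [X in _ * X + _]mxE.
case: (unliftP ord0 i) => [k|] ->.
  by rewrite !cons_rVS /= mulr0 add0r.
by rewrite !cons_rV0 eqxx/= mulr1.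
Qed.

Lemma partial_outside (R : realType) d (i : 'I_d) (f : 'rV[R]_d -> R) (K : set 'rV[R]_d) :
  closed K -> (forall u, ~ K u -> f u = 0) -> forall u, ~ K u -> partial i f u = 0.
Proof.
move=> cK f0 u Ku; rewrite /partial -(derive_cst (0 : R) u (delta_mx 0 i)).
apply: near_eq_derive.
have : nbhs u (~` K) by apply: open_nbhs_nbhs; split => //; exact: closed_openC.
by apply: filterS => v /f0.
Qed.

(** Induction on the dimension, from the unit mass at the only point of dimension 0. The divergence
    clause rests on Fubini with the order chosen by the direction of the derivative: for a later
    coordinate the inner integral runs over the tail and is zero by induction, for the first one it
    runs over the line and is zero by the fundamental theorem of calculus. *)
Lemma lebesgue_rV_ex (R : realType) d :
  exists m : {sigma_finite_measure set (borel_rV R d) -> \bar R}, is_lebesgue_rV m.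
Proof.
elim: d => [|d [m [mE mbox mibp]]].
  exists (\d_ (0 : borel_rV R 0)); split => [f mf f0|u r r0|[]//].
    by rewrite integral_dirac//= diracT mul1e.
  by rewrite expr0 [LHS]diracE mem_set// => -[].
have [m' [m'box m'ge0 m'int]] := pushforward_cons_ex mbox.
exists m'; split => //.
  move=> f mf f0; rewrite m'ge0//.
  rewrite fubini_tonelli1//=; last first.
    exact: (measurableT_comp mf (@measurable_cons_rV R d)).
  apply: eq_integral => x _; apply: mE => // .
  exact: (measurableT_comp mf (measurableT_comp (@measurable_cons_rV R d)
    (@pair1_measurable _ _ (measurableTypeR R) (borel_rV R d) x))).
move=> i f N df cf f0.
have cK : compact (closed_box (0 : 'rV[R]_d.+1) N) by exact: closed_box_compact.
have pf0 := partial_outside i (compact_closed (@norm_hausdorff _ _) cK) f0.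
have intf : m'.-integrable setT (EFin \o partial i f).
  have : m'.-integrable (setT `&` closed_box 0 N) (EFin \o partial i f).
    rewrite setTI; apply: within_continuous_integrable => //.
    exact: continuous_subspaceT.
  move=> /(integrable_restrict _ (measurable_closed_box _ _) measurableT).
  apply: eq_integrable => // x _; rewrite patchE; case: ifPn => //=.
  by rewrite notin_setE => /pf0 ->.
have [intg ->] := m'int _ intf.
case: (unliftP ord0 i) => [j|] iE; rewrite iE in df cf intg *.
  rewrite -integral12_prod_meas1//; rewrite -[RHS](integral0 lebesgue_measure setT).
  apply: eq_integral => x _; rewrite /fubini_F /=.
  have e := partial_cons_rVS f x j.
  under eq_integral do rewrite e.
  apply: (mibp j _ N).
  - move=> v; move: (df (cons_rV (x, v))); rewrite /derivable.
    by under eq_fun do rewrite /= cons_rV_shiftr.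
  - move=> v; rewrite -(funext e).
    apply: (@continuous_comp _ _ _ (fun v => cons_rV (x, v))).
      exact: continuous_cons_rVr.
    exact: cf.
  - move=> v vN; apply: f0 => h; apply: vN => k.
    by have := h (lift ord0 k); rewrite cons_rVS !mxE.
rewrite -integral21_prod_meas1//; rewrite -[RHS](integral0 m setT).
apply: eq_integral => v _; rewrite /fubini_G /=.
apply: (@integral_derive_eq0 _ (fun x => f (cons_rV (x, v))) _ N).
- move=> x; have := df (cons_rV (x, v)); rewrite /derivable.
  under eq_fun do rewrite /= cons_rV_shiftl.
  move=> d1; apply: DeriveDef.
    by rewrite /derivable; under eq_fun do rewrite /= [_ *: 1]mulr1.
  rewrite /partial /derive; under [in RHS]eq_fun do rewrite /= cons_rV_shiftl.
  by under [in LHS]eq_fun do rewrite /= [_ *: 1]mulr1.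
- move=> x; apply: (@continuous_comp _ _ _ (fun x => cons_rV (x, v))).
    exact: continuous_cons_rVl.
  exact: cf.
- move=> x xN; apply: f0 => /(_ ord0); rewrite cons_rV0 mxE subr0.
  by rewrite leNgt xN.
Qed.

(** * Determinants and frames *)

(** The determinant as an alternating form in its rows. The rows are a function, so that [upd] can
    replace one of them. *)
Definition detr (R : comPzRingType) n (F : 'I_n -> 'rV[R]_n) : R :=
  \det (\matrix_(i < n) F i).

Definition upd (I : eqType) (T : Type) (F : I -> T) (i : I) (v : T) : I -> T :=
  fun j => if j == i then v else F j.

Definition frame (T : Type) d (n : T) (b : 'I_d -> T) : 'I_d.+1 -> T :=
  fun r => if unlift ord0 r is Some i then b i else n.

Lemma frame0 (T : Type) d (n : T) (b : 'I_d -> T) : frame n b ord0 = n.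
Proof. by rewrite /frame unlift_none. Qed.

Lemma frameS (T : Type) d (n : T) (b : 'I_d -> T) i :
  frame n b (lift ord0 i) = b i.
Proof. by rewrite /frame liftK. Qed.

Lemma eq_detr (R : comPzRingType) n (F G : 'I_n -> 'rV[R]_n) :
  F =1 G -> detr F = detr G.
Proof. by move=> FG; rewrite (funext FG). Qed.

Lemma upd_frame0 (T : Type) d (n v : T) (b : 'I_d -> T) :
  upd (frame n b) ord0 v =1 frame v b.
Proof.
move=> r; rewrite /upd; case: (unliftP ord0 r) => [i|] ->.
  by rewrite !frameS.
by rewrite eqxx frame0.
Qed.

Lemma detr_updD (R : comPzRingType) n (F : 'I_n -> 'rV[R]_n) i (a b : R) v w :
  detr (upd F i (a *: v + b *: w)) = a * detr (upd F i v) + b * detr (upd F i w).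
Proof.
have other (x y : 'rV[R]_n) : row' i (\matrix_k upd F i x k) = row' i (\matrix_k upd F i y k).
  by apply/matrixP => k l; rewrite !mxE /upd eq_sym (negbTE (neq_lift _ _)).
apply: (@determinant_multilinear _ _ _ _ _ i) => //.
by rewrite !rowK /upd eqxx.
Qed.

Lemma detr_upd_sum (R : comPzRingType) n (F : 'I_n -> 'rV[R]_n) i (I : Type)
    (s : seq I) (P : pred I) (a : I -> R) (v : I -> 'rV[R]_n) :
  detr (upd F i (\sum_(k <- s | P k) a k *: v k)) =
  \sum_(k <- s | P k) a k * detr (upd F i (v k)).
Proof.
elim/big_ind2 : _ => [|x x' y y' <- <-|k _].
- by rewrite -[0 in LHS](add0r 0) -(scale0r (0 : 'rV[R]_n)) detr_updD !mul0r addr0.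
- by have := detr_updD F i 1 1 x' y'; rewrite !scale1r !mul1r.
- by have := detr_updD F i (a k) 0 (v k) 0; rewrite scale0r addr0 mul0r addr0.
Qed.

Lemma detr_alt (R : comPzRingType) n (F : 'I_n -> 'rV[R]_n) i j :
  i != j -> F i = F j -> detr F = 0.
Proof.
by move=> ij Fij; apply: (determinant_alternate ij) => k; rewrite !mxE Fij.
Qed.

Lemma updC (I : eqType) (T : Type) (F : I -> T) i j v w : i != j ->
  upd (upd F i v) j w =1 upd (upd F j w) i v.
Proof.
move=> ij k; rewrite /upd; case: (eqVneq k j) => [->|//].
by rewrite eq_sym (negbTE ij).
Qed.

Lemma detr_swap (R : comPzRingType) n (F : 'I_n -> 'rV[R]_n) i j v w : i != j ->
  detr (upd (upd F i v) j w) = - detr (upd (upd F i w) j v).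
Proof.
move=> ij; have d0 x : detr (upd (upd F i x) j x) = 0.
  by apply: (detr_alt ij); rewrite /upd eqxx (negbTE ij) eqxx.
have addl x y z : detr (upd (upd F i (x + y)) j z) =
    detr (upd (upd F i x) j z) + detr (upd (upd F i y) j z).
  rewrite !(eq_detr (updC _ _ _ ij)).
  by have := detr_updD (upd F j z) i 1 1 x y; rewrite !scale1r !mul1r.
have addr x y z : detr (upd (upd F i z) j (x + y)) =
    detr (upd (upd F i z) j x) + detr (upd (upd F i z) j y).
  by have := detr_updD (upd F i z) j 1 1 x y; rewrite !scale1r !mul1r.
have := d0 (v + w); rewrite addl !addr !d0 add0r addr0 => /eqP.
by rewrite addr_eq0 => /eqP.
Qed.

(** Rows pass from [x] to [y] one at a time. When row [i] changes, the rows before it are already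
    [y] and those after it still [x]; linearity in row [i] leaves [y i - x i] there. *)
Lemma detr_telescope (R : comPzRingType) d (n : 'rV[R]_d.+1)
    (x y : 'I_d -> 'rV[R]_d.+1) :
  detr (frame n y) - detr (frame n x) =
  \sum_(i < d) detr (upd (frame n (fun j : 'I_d => if (j < i)%N then y j else x j))
                 (lift ord0 i) (y i - x i)).
Proof.
pose mix (k : nat) := frame n (fun j : 'I_d => if (j < k)%N then y j else x j).
have -> : detr (frame n y) = detr (mix d).
  by apply: eq_detr => r; rewrite /mix /frame; case: unlift => // j; rewrite ltn_ord.
rewrite -[detr (frame n x)]/(detr (mix 0)).
rewrite -(telescope_sumr (fun k => detr (mix k))) // big_mkord.
apply: eq_bigr => i _.
have := detr_updD (mix i) (lift ord0 i) 1 (-1) (y i) (x i).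
rewrite !scale1r scaleN1r mul1r mulN1r => ->; congr (_ - _); apply: eq_detr => r;
  rewrite /upd; case: (unliftP ord0 r) => [j|] ->;
  rewrite /mix ?frame0 ?frameS ?(inj_eq lift_inj)//.
  case: (eqVneq j i) => [->|ji]; first by rewrite ltnS leqnn.
  by rewrite ltnS leq_eqVlt (inj_eq val_inj) (negbTE ji).
by case: (eqVneq j i) => [->|//]; rewrite ltnn.
Qed.

(** * Inner products, Gram matrices and frames adapted to a unit normal *)

Lemma dotE (R : realType) n (u v : 'rV[R]_n) : dot u v = (u *m v^T) 0 0.
Proof. by rewrite mxE; apply: eq_bigr => k _; rewrite mxE. Qed.

Lemma dotC (R : realType) n (u v : 'rV[R]_n) : dot u v = dot v u.
Proof. by apply: eq_bigr => k _; rewrite mulrC. Qed.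

Lemma dotDl (R : realType) n (u v w : 'rV[R]_n) : dot (u + v) w = dot u w + dot v w.
Proof. by rewrite !dotE mulmxDl mxE. Qed.

Lemma dotZl (R : realType) n a (u w : 'rV[R]_n) : dot (a *: u) w = a * dot u w.
Proof. by rewrite !dotE -scalemxAl mxE. Qed.

Lemma dotDr (R : realType) n (u v w : 'rV[R]_n) : dot w (u + v) = dot w u + dot w v.
Proof. by rewrite !(dotC w) dotDl. Qed.

Lemma dotZr (R : realType) n a (u w : 'rV[R]_n) : dot w (a *: u) = a * dot w u.
Proof. by rewrite !(dotC w) dotZl. Qed.

Lemma dot_suml (R : realType) n (I : Type) (s : seq I) (P : pred I)
    (v : I -> 'rV[R]_n) w :
  dot (\sum_(k <- s | P k) v k) w = \sum_(k <- s | P k) dot (v k) w.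
Proof. by rewrite dotE mulmx_suml summxE; apply: eq_bigr => k _; rewrite dotE. Qed.

Lemma dot_ge0 (R : realType) n (u : 'rV[R]_n) : 0 <= dot u u.
Proof. by apply: sumr_ge0 => k _; rewrite -expr2 sqr_ge0. Qed.

Lemma dot_eq0 (R : realType) n (u : 'rV[R]_n) : dot u u = 0 -> u = 0.
Proof.
move=> /eqP; rewrite psumr_eq0; last by move=> k _; rewrite -expr2 sqr_ge0.
move=> /allP h; apply/rowP => k; rewrite mxE; apply/eqP.
by have := h k (mem_index_enum _); rewrite -expr2 sqrf_eq0.
Qed.

Lemma dot_unit_le1 (R : realType) n (u v : 'rV[R]_n) :
  dot u u = 1 -> dot v v = 1 -> `|dot u v| <= 1.
Proof.
move=> u1 v1; rewrite ler_norml.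
have := dot_ge0 (u + v); have := dot_ge0 (u + (-1) *: v).
by rewrite !(dotDl, dotDr, dotZl, dotZr) u1 v1 (dotC v u); lra.
Qed.

Definition gramm (R : realType) d n (b : 'I_d -> 'rV[R]_n) : 'M[R]_d :=
  \matrix_(i < d, j < d) dot (b i) (b j).

Lemma gramm_mulmx (R : realType) d n (b : 'I_d -> 'rV[R]_n) :
  gramm b = (\matrix_i b i) *m (\matrix_i b i)^T.
Proof.
by apply/matrixP => i j; rewrite !mxE; apply: eq_bigr => k _; rewrite !mxE.
Qed.

Lemma tr_gramm (R : realType) d n (b : 'I_d -> 'rV[R]_n) : (gramm b)^T = gramm b.
Proof. by apply/matrixP => i j; rewrite !mxE dotC. Qed.

Lemma gramm_unit (R : realType) d n (b : 'I_d -> 'rV[R]_n) :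
  row_free (\matrix_i b i) -> gramm b \in unitmx.
Proof.
move=> fb; rewrite -row_free_unit; apply: inj_row_free => v vg.
have : dot (v *m (\matrix_i b i)) (v *m (\matrix_i b i)) = 0.
  by rewrite dotE trmx_mul mulmxA -(mulmxA v) -gramm_mulmx vg mul0mx mxE.
by move=> /dot_eq0 vb; apply: (row_free_inj fb); rewrite vb mul0mx.
Qed.

Section orthonormal_frame.
Context {R : realType} {d : nat}.
Variables (n : 'rV[R]_d.+1) (b : 'I_d -> 'rV[R]_d.+1).
Hypotheses (n1 : dot n n = 1) (bn : forall i, dot (b i) n = 0).

(** The square of the determinant is the Gram determinant of the whole frame, whose first row is
    [(1, 0, ..., 0)]; expanding along it leaves the Gram determinant of [b]. *)
Lemma detr_frame_sqr : detr (frame n b) ^+ 2 = \det (gramm b).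
Proof.
rewrite expr2 /detr -[X in _ * X = _]det_tr -det_mulmx (expand_det_row _ ord0).
rewrite big_ord_recl big1 ?addr0 => [|j _].
  rewrite /cofactor addn0 expr0 mul1r.
  rewrite [X in X * _](_ : _ = 1) ?mul1r; last first.
    by rewrite -[RHS]n1 mxE; apply: eq_bigr => k _; rewrite !mxE frame0.
  congr (\det _); apply/matrixP => i j; rewrite !mxE.
  by apply: eq_bigr => k _; rewrite !mxE !frameS.
rewrite [X in X * _](_ : _ = 0) ?mul0r// -[RHS](bn j) dotC mxE.
by apply: eq_bigr => k _; rewrite !mxE frame0 frameS.
Qed.

Hypothesis fb : row_free (\matrix_i b i).

Lemma detr_frame_neq0 : detr (frame n b) != 0.
Proof.
by rewrite -sqrf_eq0 detr_frame_sqr -unitfE -unitmxE gramm_unit.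
Qed.

Lemma orthogonal_frame_eq0 v : dot v n = 0 -> (forall i, dot v (b i) = 0) -> v = 0.
Proof.
move=> vn vb; have := detr_frame_neq0; rewrite -unitfE -unitmxE => uQ.
have : (\matrix_r frame n b r) *m v^T = 0.
  apply/matrixP => r k; rewrite [RHS]mxE (ord1 k).
  case: (unliftP ord0 r) => [i|] ->.
    by rewrite -(vb i) dotC dotE !mxE; apply: eq_bigr => l _; rewrite !mxE frameS.
  by rewrite -vn dotC dotE !mxE; apply: eq_bigr => l _; rewrite !mxE frame0.
move=> /(congr1 (mulmx (invmx (\matrix_r frame n b r)))).
by rewrite mulKmx// mulmx0 => /(congr1 trmx); rewrite trmxK trmx0.
Qed.

(** The coordinate along [b i] of the tangential part of [v]: the inverse Gram matrix turns inner
    products into coordinates. *)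
Definition coef v i := \sum_k dot v (b k) * invmx (gramm b) k i.

Lemma frame_decomp v : v = dot v n *: n + \sum_i coef v i *: b i.
Proof.
apply/eqP; rewrite -subr_eq0; apply/eqP; apply: orthogonal_frame_eq0.
  rewrite -scaleN1r !(dotDl, dotZl) n1 dot_suml big1 => [|i _]; last by rewrite dotZl bn mulr0.
  by rewrite mulr1 addr0 mulN1r subrr.
move=> j; rewrite -scaleN1r !(dotDl, dotZl) (dotC n) bn mulr0 add0r dot_suml.
rewrite mulN1r; apply/eqP; rewrite subr_eq0; apply/eqP.
have -> : dot v (b j) = ((\row_k dot v (b k)) *m (invmx (gramm b) *m gramm b)) 0 j.
  by rewrite mulVmx ?gramm_unit// mulmx1 mxE.
rewrite mulmxA mxE; apply: eq_bigr => i _; rewrite dotZl !mxE; congr (_ * _).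
by apply: eq_bigr => k _; rewrite !mxE.
Qed.

(** The tangential part of [v] is a combination of the other rows and is killed by alternation. *)
Lemma detr_frame_normal v : detr (frame v b) = dot v n * detr (frame n b).
Proof.
rewrite -(eq_detr (upd_frame0 n v b)) [in upd _ _ _](frame_decomp v).
have := detr_updD (frame n b) ord0 (dot v n) 1 n (\sum_i coef v i *: b i).
rewrite scale1r mul1r => ->; rewrite (eq_detr (upd_frame0 _ _ _)) detr_upd_sum big1 ?addr0// => i _.
rewrite (@detr_alt _ _ _ ord0 (lift ord0 i)) ?mulr0//.
by rewrite /upd eqxx eq_sym (negbTE (neq_lift _ _)) frameS.
Qed.

Lemma detr_upd_tangent v i :
  detr (upd (frame n b) (lift ord0 i) v) = coef v i * detr (frame n b).
Proof.
rewrite [in upd _ _ _](frame_decomp v).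
have := detr_updD (frame n b) (lift ord0 i) (dot v n) 1 n (\sum_i coef v i *: b i).
rewrite scale1r mul1r => ->.
rewrite (@detr_alt _ _ (upd _ _ n) ord0 (lift ord0 i)) ?mulr0 ?add0r//; last first.
  by rewrite /upd eqxx (negbTE (neq_lift _ _)) frame0.
rewrite detr_upd_sum (bigD1 i)//= [X in _ + X]big1 ?addr0 => [|j ji].
  congr (_ * _); apply: eq_detr => r; rewrite /upd; case: eqVneq => [->|//].
  by rewrite frameS.
rewrite (@detr_alt _ _ _ (lift ord0 j) (lift ord0 i)) ?mulr0// ?(inj_eq lift_inj)//.
by rewrite /upd eqxx (inj_eq lift_inj) (negbTE ji) frameS.
Qed.

(** Of the tangential vector [w] in row 0 only the component along [b i] survives, since every other
    [b j] still occupies its own row. The sign comes from exchanging row 0 with row [i], which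
    brings [v] to the top and [b i] back to its place. *)
Lemma detr_upd_normal_tangent v w i : dot w n = 0 ->
  detr (upd (upd (frame n b) (lift ord0 i) v) ord0 w) =
  - (coef w i * dot v n * detr (frame n b)).
Proof.
move=> wn; rewrite [in X in upd _ _ X](frame_decomp w) wn scale0r add0r detr_upd_sum.
rewrite (bigD1 i)//= [X in _ + X]big1 ?addr0 => [|j ji].
  rewrite detr_swap; last by rewrite eq_sym neq_lift.
  rewrite -mulrA -detr_frame_normal mulrN; congr (- (_ * _)).
  apply: eq_detr => r; rewrite /upd; case: (unliftP ord0 r) => [k|] ->.
    rewrite !frameS (inj_eq lift_inj) eq_sym (negbTE (neq_lift _ _)).
    by case: (eqVneq k i) => [->|].
  by rewrite eqxx frame0.
rewrite (@detr_alt _ _ _ ord0 (lift ord0 j)) ?mulr0//.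
by rewrite /upd eqxx (inj_eq lift_inj) (negbTE ji) frameS.
Qed.

(** Here the second derivatives disappear. Putting [v] in slot [i] and [x i k] in slot [k] is, by
    alternation and the symmetry of [x], the opposite of putting [v] in slot [k] and [x k i] in slot
    [i], so these terms cancel in pairs. What remains is row 0, the derivative of the normal, whose
    tangential coordinates add up to a trace. *)
Lemma sum_detr_upd2 (v : 'rV[R]_d.+1) (w : 'I_d -> 'rV[R]_d.+1)
    (x : 'I_d -> 'I_d -> 'rV[R]_d.+1) :
  (forall i, dot (w i) n = 0) -> (forall i k, x i k = x k i) ->
  \sum_i \sum_(r | r != lift ord0 i)
     detr (upd (upd (frame n b) (lift ord0 i) v) r (frame (w i) (x i) r)) =
  - (dot v n * detr (frame n b) * \sum_i coef (w i) i).
Proof.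
move=> wn xC.
(* The diagonal is set to zero, so that the sum runs over a full square and exchanging the indices
   makes it its own opposite. *)
pose S i k := if k != i
  then detr (upd (upd (frame n b) (lift ord0 i) v) (lift ord0 k) (x i k)) else 0.
have S0 : \sum_i \sum_k S i k = 0.
  have : \sum_i \sum_k S i k = - \sum_i \sum_k S i k.
    rewrite [LHS]exchange_big /= -sumrN; apply: eq_bigr => i _; rewrite -sumrN.
    apply: eq_bigr => k _; rewrite /S eq_sym; case: eqVneq => [|ki].
      by rewrite oppr0.
    have ik : lift ord0 i != lift ord0 k by rewrite (inj_eq lift_inj) eq_sym.
    by rewrite /= xC [in RHS](detr_swap _ _ _ ik) opprK (eq_detr (updC _ _ _ ik)).
  by move=> h; lra.
set D := dot v n * _.
rewrite -[RHS]addr0 -[X in _ = _ + X]S0 mulr_sumr -[X in _ = X + _]sumrN -big_split/=.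
apply: eq_bigr => i _.
rewrite big_mkcond big_ord_recl/= frame0 detr_upd_normal_tangent//; congr (_ + _).
  by rewrite /D; congr (- _); ring.
apply: eq_bigr => k _; rewrite /S frameS.
by rewrite (inj_eq lift_inj).
Qed.

(** The trace of the coordinates takes the shape of [surf_div]; the order of the two indices is
    immaterial because the inverse Gram matrix is symmetric. *)
Lemma sum_coef (F : 'I_d -> 'rV[R]_d.+1) :
  \sum_i coef (F i) i =
  \sum_i \sum_j invmx (gramm b) i j * dot (F i) (b j).
Proof.
apply: eq_bigr => i _; apply: eq_bigr => j _; rewrite mulrC; congr (_ * _).
by rewrite -[in LHS](tr_gramm b) -trmx_inv mxE.
Qed.

Lemma sum_coef_grad (y : 'I_d -> R) v :
  \sum_i y i * coef v i =
  dot (\sum_i \sum_j (invmx (gramm b) i j * y i) *: b j) v.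
Proof.
rewrite dot_suml; apply: eq_bigr => i _; rewrite dot_suml mulr_sumr.
apply: eq_bigr => j _; rewrite dotZl (dotC (b j)).
by rewrite -[in LHS](tr_gramm b) -trmx_inv mxE; ring.
Qed.

End orthonormal_frame.

(** * Continuously differentiable functions *)

Lemma near_continuous (T U : topologicalType) (f g : T -> U) (x : T) :
  {near x, f =1 g} -> {for x, continuous g} -> {for x, continuous f}.
Proof.
move=> fg cg; rewrite /prop_for /continuous_at (nbhs_singleton fg).
by apply: cvg_trans cg; apply: near_eq_cvg; apply: filterS fg => y ->.
Qed.

Lemma open_near (T : topologicalType) (U : set T) (P : T -> Prop) u :
  open U -> U u -> (forall v, U v -> P v) -> \forall v \near u, P v.
Proof. by move=> oU Uu UP; apply: filterS UP _; exact: open_nbhs_nbhs. Qed.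

Section C1.
Context {R : realType} {d : nat}.
Variables (U : set 'rV[R]_d).
Hypothesis oU : open U.
Implicit Types f g : 'rV[R]_d -> R.

Lemma C1_on_continuous f u : C1_on U f -> U u -> {for u, continuous f}.
Proof. by move=> Cf /Cf[+ _]; exact: differentiable_continuous. Qed.

Lemma C1_on_derivable f u v : C1_on U f -> U u -> derivable f u v.
Proof. by move=> Cf /Cf[+ _]; exact: diff_derivable. Qed.

Lemma C1_on_partial f i u : C1_on U f -> U u -> {for u, continuous (partial i f)}.
Proof. by move=> Cf /Cf[_]; apply. Qed.

Lemma C1_on_cst (a : R) : C1_on U (cst a).
Proof.
move=> u _; split=> // i; apply: (@near_continuous _ _ _ (cst 0)); last exact: cst_continuous.
by apply: (@nearW _ (nbhs u)) => v; rewrite /partial derive_cst.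
Qed.

Lemma C1_onM f g : C1_on U f -> C1_on U g -> C1_on U (fun u => f u * g u).
Proof.
move=> Cf Cg u Uu; split=> [|i].
  by apply: (@differentiableM _ _ f g); [case: (Cf u Uu)|case: (Cg u Uu)].
apply: (@near_continuous _ _ _ (fun v => f v * partial i g v + g v * partial i f v)).
  apply: (open_near oU Uu) => v Uv.
  by rewrite /partial (@deriveM _ _ f g)//; exact: C1_on_derivable.
apply: (@continuousD _ R^o); apply: continuousM.
- exact: C1_on_continuous.
- exact: C1_on_partial.
- exact: C1_on_continuous.
- exact: C1_on_partial.
Qed.

Lemma C1_onD f g : C1_on U f -> C1_on U g -> C1_on U (fun u => f u + g u).
Proof.
move=> Cf Cg u Uu; split=> [|i].
  by apply: (@differentiableD _ _ _ f g); [case: (Cf u Uu)|case: (Cg u Uu)].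
apply: (@near_continuous _ _ _ (fun v => partial i f v + partial i g v)).
  apply: (open_near oU Uu) => v Uv.
  by rewrite /partial (@deriveD _ _ _ f g)//; exact: C1_on_derivable.
by apply: (@continuousD _ R^o); exact: C1_on_partial.
Qed.

Lemma C1_on_sum (I : Type) (s : seq I) (P : pred I) (F : I -> 'rV[R]_d -> R) :
  (forall i, C1_on U (F i)) -> C1_on U (fun u => \sum_(i <- s | P i) F i u).
Proof.
move=> CF; elim: s => [|i s IH].
  by under eq_fun do rewrite big_nil; exact: C1_on_cst.
under eq_fun do rewrite big_cons.
case: (P i); last exact: IH.
exact: (C1_onD (CF i) IH).
Qed.

Lemma C1_on_prod (I : Type) (s : seq I) (P : pred I) (F : I -> 'rV[R]_d -> R) :
  (forall i, C1_on U (F i)) -> C1_on U (fun u => \prod_(i <- s | P i) F i u).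
Proof.
move=> CF; elim: s => [|i s IH].
  by under eq_fun do rewrite big_nil; exact: C1_on_cst.
under eq_fun do rewrite big_cons.
case: (P i); last exact: IH.
exact: (C1_onM (CF i) IH).
Qed.

Lemma partial_comp (h : R -> R) f i u : differentiable f u -> derivable h (f u) 1 ->
  partial i (h \o f) u = derive1 h (f u) * partial i f u.
Proof.
move=> df dh; have dh' : differentiable h (f u) by exact/derivable1_diffP.
rewrite /partial deriveE; last exact: differentiable_comp.
rewrite diff_comp// [LHS]/= deriv1E// deriveE//.
by rewrite mulrC.
Qed.

Lemma C1_on_comp (h : R -> R) f : C1_on U f ->
  (forall u, U u -> derivable h (f u) 1 /\ {for f u, continuous (derive1 h)}) ->
  C1_on U (h \o f).
Proof.
move=> Cf Ch u Uu; split=> [|i].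
  apply: differentiable_comp; first by case: (Cf u Uu).
  by have [dh _] := Ch u Uu; exact/derivable1_diffP.
apply: (@near_continuous _ _ _ (fun v => derive1 h (f v) * partial i f v)).
  apply: (open_near oU Uu) => v Uv.
  have [df _] := Cf v Uv; have [dh _] := Ch v Uv.
  exact: partial_comp.
apply: continuousM; last exact: C1_on_partial.
apply: continuous_comp; first exact: C1_on_continuous.
by have [_ ch] := Ch u Uu.
Qed.

Lemma C1_on_inv f : C1_on U f -> (forall u, U u -> f u != 0) -> C1_on U (fun u => (f u)^-1).
Proof.
move=> Cf f0; apply: (@C1_on_comp (fun x => x^-1) f) => // u /f0 fu0.
have d0 (x : R) : x != 0 -> derive1 (fun x : R => x^-1) x = - x ^- 2.
  by move=> x0; rewrite derive1E (@deriveV _ _ (@id R))// derive_id [LHS]mulr1.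
split; first by apply: (@derivableV _ _ (@id R)).
apply: (@near_continuous R R _ (fun x : R => - x ^- 2)).
  have : \forall x \near f u, x != 0 by exact: (@open_neq _ 0).
  by apply: filterS => x /d0.
apply: continuousN; apply: continuousV; first by rewrite expf_neq0.
exact: exprn_continuous.
Qed.

Lemma C1_on_sqrt f : C1_on U f -> (forall u, U u -> 0 < f u) ->
  C1_on U (fun u => Num.sqrt (f u)).
Proof.
move=> Cf f0; apply: (@C1_on_comp Num.sqrt f) => // u /f0 fu0.
have [d0 _] := is_derive1_sqrt fu0; split; first exact: d0.
apply: (@near_continuous R R _ (fun x : R => (2 * Num.sqrt x)^-1)).
  have : \forall x \near f u, 0 < x by exact: lt_nbhsr.
  by apply: filterS => x /is_derive1_sqrt[_ <-]; rewrite derive1E.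
apply: continuousV; first by rewrite mulf_neq0// gt_eqF// sqrtr_gt0.
by apply: continuousM; [exact: cst_continuous|exact: sqrt_continuous].
Qed.

End C1.


Lemma is_derive_prod (R : realType) (V : normedModType R) n (f : 'I_n -> V -> R)
    (df : 'I_n -> R) (u v : V) : (forall i, is_derive u v (f i) (df i)) ->
  is_derive u v (fun x => \prod_i f i x)
    (\sum_r \prod_i (if i == r then df i else f i u)).
Proof.
elim: n f df => [|n IH] f df fdf.
  under eq_fun do rewrite big_ord0.
  by rewrite big_ord0; exact: is_derive_cst.
under eq_fun do rewrite big_ord_recl.
apply: (is_derive_eq (is_deriveM (fdf ord0) (IH _ _ (fun i => fdf (lift ord0 i))))).
rewrite addrC big_ord_recl big_ord_recl eqxx; congr (_ + _).
  rewrite /GRing.scale/= mulrC; congr (_ * _).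
rewrite /GRing.scale/= mulr_sumr; apply: eq_bigr => r _.
by rewrite big_ord_recl; congr (_ * _).
Qed.

Lemma is_derive_bigsum (R : realType) (V : normedModType R) (I : Type) (s : seq I)
    (f : I -> V -> R) (df : I -> R) (u v : V) :
  (forall i, is_derive u v (f i) (df i)) ->
  is_derive u v (fun x => \sum_(i <- s) f i x) (\sum_(i <- s) df i).
Proof.
move=> fdf; elim: s => [|i s IH].
  by under eq_fun do rewrite big_nil; rewrite big_nil; exact: is_derive_cst.
under eq_fun do rewrite big_cons.
by rewrite big_cons; exact: (is_deriveD (fdf i) IH).
Qed.

Lemma is_derive_detr (R : realType) (V : normedModType R) n
    (F : 'I_n -> V -> 'rV[R]_n) (dF : 'I_n -> 'rV[R]_n) (u v : V) :
  (forall r j, is_derive u v (fun x => F r x 0 j) (dF r 0 j)) ->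
  is_derive u v (fun x => detr (fun r => F r x))
    (\sum_r detr (upd (fun r => F r u) r (dF r))).
Proof.
move=> FdF; rewrite /detr /determinant exchange_big/=.
apply: is_derive_bigsum => s.
under eq_fun do under eq_bigr do rewrite mxE.
have := is_derive_prod (fun i => FdF i (perm.fun_of_perm s i)).
move=> /(is_deriveZ ((-1) ^+ perm.odd_perm s)) H; apply: (is_derive_eq H).
rewrite /GRing.scale/= mulr_sumr; apply: eq_bigr => r _; congr (_ * _).
apply: eq_bigr => i _; rewrite mxE /upd.
by case: eqVneq => [->|].
Qed.

Lemma partial_coord (R : realType) d n (F : 'rV[R]_d -> 'rV[R]_n) i j u :
  derivable F u (delta_mx 0 i) ->
  partial i F u 0 j = partial i (fun x => F x 0 j) u.
Proof. by move=> dF; rewrite /partial derive_mx// mxE. Qed.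

Lemma C1_on_coord (R : realType) d n (U : set 'rV[R]_d) (F : 'rV[R]_d -> 'rV[R]_n) j :
  open U -> C1_on U F -> C1_on U (fun u => F u 0 j).
Proof.
move=> oU CF u Uu; have [dF cF] := CF u Uu; split=> [|i].
  apply: (@differentiable_comp _ _ _ _ F (fun A : 'rV[R]_n => A 0 j)) => //.
  exact: differentiable_coord.
apply: (@near_continuous _ _ _ (fun v => partial i F v 0 j)).
  apply: (open_near oU Uu) => v Uv; rewrite partial_coord//.
  by apply: diff_derivable; have [] := CF v Uv.
apply: (@continuous_comp _ _ _ (partial i F) (fun A : 'rV[R]_n => A 0 j)).
  exact: cF.
exact: coord_continuous.
Qed.

Lemma C1_on_detr (R : realType) d n (U : set 'rV[R]_d)
    (F : 'I_n -> 'rV[R]_d -> 'rV[R]_n) : open U ->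
  (forall r j, C1_on U (fun u => F r u 0 j)) -> C1_on U (fun u => detr (fun r => F r u)).
Proof.
move=> oU CF; rewrite /detr /determinant.
apply: C1_on_sum => // s; apply: C1_onM => //; first exact: C1_on_cst.
apply: C1_on_prod => // r.
by under eq_fun do rewrite mxE; exact: CF.
Qed.

Lemma is_derive_line (R : realType) (V : normedModType R) (f : V -> R) (p e : V) (x : R) :
  derivable f (p + x *: e) e ->
  is_derive x (1 : R) (fun x : R => f (p + x *: e)) ('D_e f (p + x *: e)).
Proof.
have eq : (fun h : R => h^-1 *: (f (p + (h *: (1 : R) + x) *: e) - f (p + x *: e))) =
   (fun h : R => h^-1 *: (f (h *: e + (p + x *: e)) - f (p + x *: e))).
  by apply/funext => h; rewrite [h *: 1]mulr1 scalerDl addrCA.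
by move=> df; apply: DeriveDef; rewrite /derivable /derive /= eq.
Qed.

(** The mean value theorem is applied in direction [i] to the increment of [f] in direction [j], and
    then in direction [j]. The left side is symmetric in [i] and [j], which is what links the two
    mixed derivatives. *)
Lemma second_difference (R : realType) d (U : set 'rV[R]_d) (f : 'rV[R]_d -> R)
    (i j : 'I_d) (u : 'rV[R]_d) (h : R) : 0 < h -> C2_on U f ->
  (forall x y : R, 0 <= x <= h -> 0 <= y <= h ->
     U (u + x *: delta_mx 0 i + y *: delta_mx 0 j)) ->
  exists xy : R * R, [/\ 0 <= xy.1 <= h, 0 <= xy.2 <= h &
    f (u + h *: delta_mx 0 i + h *: delta_mx 0 j) - f (u + h *: delta_mx 0 i)
    - (f (u + h *: delta_mx 0 j) - f u) =
    partial j (partial i f) (u + xy.1 *: delta_mx 0 i + xy.2 *: delta_mx 0 j) * h * h].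
Proof.
move=> h0 [C1f C1pf] Uxy.
have hh : 0 <= h <= h by rewrite ltW/=.
have h00 : 0 <= (0 : R) <= h by rewrite lexx ltW.
pose g (x : R) : R := f (u + h *: delta_mx 0 j + x *: delta_mx 0 i) - f (u + x *: delta_mx 0 i).
have dg (x : R) : 0 <= x <= h -> is_derive x (1 : R) g
   (partial i f (u + h *: delta_mx 0 j + x *: delta_mx 0 i) - partial i f (u + x *: delta_mx 0 i)).
  move=> xh; apply: is_deriveB.
    apply: is_derive_line; apply: C1_on_derivable C1f _.
    by rewrite addrAC; exact: Uxy.
  apply: is_derive_line; apply: C1_on_derivable C1f _.
  by have := Uxy x 0 xh h00; rewrite scale0r addr0.
have [x x0h] : exists2 x, x \in `]0, h[ & g h - g 0 =
   (partial i f (u + h *: delta_mx 0 j + x *: delta_mx 0 i) -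
    partial i f (u + x *: delta_mx 0 i)) * (h - 0).
  apply: (@MVT _ g (fun x => partial i f (u + h *: delta_mx 0 j + x *: delta_mx 0 i) -
    partial i f (u + x *: delta_mx 0 i)) _ _ h0).
    by move=> x; rewrite in_itv/= => /andP[x0 xh]; apply: dg; rewrite !ltW.
  apply: derivable_within_continuous => x; rewrite in_itv/= => xh.
  by have [] := dg x xh.
have {}x0h : 0 <= x <= h by move: x0h; rewrite in_itv/= => /andP[x0 xh]; rewrite !ltW.
rewrite subr0 => gE.
pose k (y : R) : R := partial i f (u + x *: delta_mx 0 i + y *: delta_mx 0 j).
have dk (y : R) : 0 <= y <= h -> is_derive y (1 : R) k
   (partial j (partial i f) (u + x *: delta_mx 0 i + y *: delta_mx 0 j)).
  move=> yh; apply: is_derive_line; apply: C1_on_derivable (C1pf i) _.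
  exact: Uxy.
have [y y0h] : exists2 y, y \in `]0, h[ & k h - k 0 =
   partial j (partial i f) (u + x *: delta_mx 0 i + y *: delta_mx 0 j) * (h - 0).
  apply: (@MVT _ k (fun y =>
    partial j (partial i f) (u + x *: delta_mx 0 i + y *: delta_mx 0 j)) _ _ h0).
    by move=> y; rewrite in_itv/= => /andP[y0 yh]; apply: dk; rewrite !ltW.
  apply: derivable_within_continuous => y; rewrite in_itv/= => yh.
  by have [] := dk y yh.
have {}y0h : 0 <= y <= h by move: y0h; rewrite in_itv/= => /andP[y0 yh]; rewrite !ltW.
rewrite subr0 => kE; exists (x, y); split => //=.
rewrite -kE /k scale0r addr0 [u + x *: _ + h *: _]addrAC -gE /g !scale0r !addr0.
by rewrite [u + h *: delta_mx 0 j + h *: _]addrAC.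
Qed.

Lemma partialC (R : realType) d (U : set 'rV[R]_d) (f : 'rV[R]_d -> R)
    (i j : 'I_d) (u : 'rV[R]_d) : open U -> C2_on U f -> U u ->
  partial i (partial j f) u = partial j (partial i f) u.
Proof.
move=> oU C2f Uu.
have near_prop (P : 'rV[R]_d -> Prop) (a b : 'I_d) : nbhs u P ->
   exists2 e : R, 0 < e & forall h : R, 0 < h < e -> forall x y : R, 0 <= x <= h -> 0 <= y <= h ->
     P (u + x *: delta_mx 0 a + y *: delta_mx 0 b).
  move=> /nbhs_ballP[e /= e0 eP]; exists (e / 2); first by rewrite divr_gt0.
  move=> h /andP[h0 he] x y /andP[x0 xh] /andP[y0 yh]; apply: eP.
  rewrite -ball_normE/= -addrA opprD addNKr normrN.
  apply: (@le_lt_trans _ _ (x + y)); last by lra.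
  apply: (le_trans (ler_normD _ _)); rewrite !normrZ !ger0_norm//.
  by rewrite lerD// ler_piMr//; apply: mx_norm_le => // ? ?;
    rewrite mxE; case: (_ && _); rewrite ?normr1 ?normr0.
apply/eqP; rewrite -subr_eq0; apply/eqP; apply/eqP; apply: contraT => ne0.
(* Half the assumed gap: for small [h] the two mixed derivatives share a value, taken at points of
   the square of side [h], and that value is within [e] of both of their values at [u]. *)
have e0 : 0 < `|partial i (partial j f) u - partial j (partial i f) u| / 2.
  by rewrite divr_gt0// normr_gt0.
set e := _ / 2 in e0.
have [C1f C1pf] := C2f.
have := (@C1_on_partial _ _ _ _ i _ (C1pf j) Uu) =>
  /cvgrPdist_lt/(_ _ e0)/(near_prop _ j i)[e1 e10 P1].
have := (@C1_on_partial _ _ _ _ j _ (C1pf i) Uu) =>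
  /cvgrPdist_lt/(_ _ e0)/(near_prop _ i j)[e2 e20 P2].
have [e3 e30 P3] := near_prop U i j (open_nbhs_nbhs (conj oU Uu)).
have [e4 e40 P4] := near_prop U j i (open_nbhs_nbhs (conj oU Uu)).
pose h := Num.min (Num.min e1 e2) (Num.min e3 e4) / 2.
have h0 : 0 < h by rewrite divr_gt0// !lt_min e10 e20 e30 e40.
have hm : h < Num.min (Num.min e1 e2) (Num.min e3 e4).
  by rewrite /h ltr_pdivrMr// ltr_pMr ?ltr1n// !lt_min e10 e20 e30 e40.
move: hm; rewrite !lt_min => /andP[/andP[h1 h2] /andP[h3 h4]].
clearbody h.
have [[x y] /= [xh yh E1]] := second_difference h0 C2f (P3 h ltac:(by rewrite h0)).
have [[x' y'] /= [xh' yh' E2]] := second_difference h0 C2f (P4 h ltac:(by rewrite h0)).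
have {P2} := P2 h ltac:(by rewrite h0) x y xh yh.
have {P1} := P1 h ltac:(by rewrite h0) x' y' xh' yh'.
have EE : partial j (partial i f) (u + x *: 'e_i + y *: 'e_j) =
  partial i (partial j f) (u + x' *: 'e_j + y' *: 'e_i).
  apply: (mulIf (lt0r_neq0 h0)); apply: (mulIf (lt0r_neq0 h0)).
  apply: (etrans (esym E1)); apply: (etrans _ E2).
  have -> : u + h *: delta_mx 0 j + h *: delta_mx 0 i =
      u + h *: delta_mx 0 i + h *: delta_mx 0 j :> 'rV[R]_d by rewrite addrAC.
  have AC (a b c z : R) : a - b - (c - z) = a - c - (b - z) by ring.
  exact: AC.
rewrite -EE => n1 n2.
have := ler_distD (partial j (partial i f) (u + x *: 'e_i + y *: 'e_j))
  (partial i (partial j f) u) (partial j (partial i f) u).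
rewrite [X in _ <= _ + X]distrC => /le_lt_trans/(_ (ltrD n1 n2)).
by rewrite /e -splitr ltxx.
Qed.

(** * Integration by parts *)

Lemma derivable_coord (R : realType) d n (U : set 'rV[R]_d) (F : 'rV[R]_d -> 'rV[R]_n) u v :
  U u -> (forall j, C1_on U (fun u => F u 0 j)) -> derivable F u v.
Proof.
move=> Uu CF; apply/derivable_mxP => i j; rewrite (ord1 i).
by have [df _] := CF j u Uu; exact: diff_derivable.
Qed.

Lemma is_derive_detr_partial (R : realType) d n (U : set 'rV[R]_d) i u
    (F : 'I_n -> 'rV[R]_d -> 'rV[R]_n) : U u ->
  (forall r j, C1_on U (fun u => F r u 0 j)) ->
  is_derive u (delta_mx 0 i) (fun u => detr (fun r => F r u))
    (\sum_r detr (upd (fun r => F r u) r (partial i (F r) u))).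
Proof.
move=> Uu CF; apply: is_derive_detr => r j.
rewrite partial_coord; last by apply: derivable_coord (CF r).
by apply: derivableP; have [df _] := CF r j u Uu; exact: diff_derivable.
Qed.

(** Cut off to zero outside [K], the product of [w] and the determinant has a continuous derivative
    in direction [i] on the whole space: on the open set [U] it is the product itself, on the open
    complement of [K] it is zero, and the two sets cover the space. The divergence clause of
    [is_lebesgue_rV] applies, and the product rule gives the integrand. *)
Lemma integral_partial_detr (R : realType) d n
    (m : {sigma_finite_measure set (borel_rV R d) -> \bar R})
    (U K : set 'rV[R]_d) (w : 'rV[R]_d -> R)
    (F : 'I_n -> 'rV[R]_d -> 'rV[R]_n) (i : 'I_d) :
  is_lebesgue_rV m -> open U -> compact K -> K `<=` U -> C1_on U w ->
  (forall u, U u -> ~ K u -> w u = 0) ->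
  (forall r j, C1_on U (fun u => F r u 0 j)) ->
  \int[m]_(u in K) (partial i w u * detr (fun r => F r u) +
     w u * \sum_r detr (upd (fun r => F r u) r (partial i (F r) u))) = 0.
Proof.
move=> [_ _ mibp] oU cK KU Cw w0 CF.
have clK : closed K by apply: compact_closed => //; exact: norm_hausdorff.
pose g u := w u * detr (fun r => F r u).
have Cg : C1_on U g by exact: (C1_onM oU Cw (C1_on_detr oU CF)).
pose f u := if u \in K then g u else 0.
have f0 u : ~ K u -> f u = 0 by move=> /(@memNset _ K)/negPf; rewrite /f => ->.
have fg u : U u -> f u = g u.
  move=> Uu; have [Ku|nKu] := pselect (K u); first by rewrite /f mem_set.
  by rewrite f0// /g w0// mul0r.
have nfg u : U u -> {near u, g =1 f}.
  by move=> Uu; apply: (open_near oU Uu) => v /fg.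
have nf0 u : ~ K u -> {near u, cst 0 =1 f}.
  move=> Ku; have oK : open (~` K) by exact: closed_openC.
  by apply: (open_near oK Ku) => v /f0.
have pf u : U u -> partial i f u = partial i g u.
  by move=> /nfg fgu; rewrite /partial (near_eq_derive _ fgu).
have pf0 u : ~ K u -> partial i f u = 0.
  by move=> Ku; rewrite /partial -(near_eq_derive _ (nf0 u Ku)) derive_cst.
have df u : derivable f u (delta_mx 0 i).
  have [Uu|nUu] := pselect (U u).
    by apply: (near_eq_derivable (nfg u Uu)); exact: (@C1_on_derivable _ _ _ _ _ _ Cg Uu).
  have Ku : ~ K u by move=> /KU.
  by apply: (near_eq_derivable (nf0 u Ku)); exact: derivable_cst.
have cpf : continuous (partial i f).
  move=> u; have [Uu|nUu] := pselect (U u).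
    apply: (@near_continuous _ _ _ (partial i g)).
      by apply: (open_near oU Uu) => v /pf.
    exact: (@C1_on_partial _ _ _ _ _ _ Cg Uu).
  have Ku : ~ K u by move=> /KU.
  apply: (@near_continuous _ _ _ (cst 0)); last exact: cst_continuous.
  have oK : open (~` K) by exact: closed_openC.
  by apply: (open_near oK Ku) => v /pf0.
have [N [_ NK]] := compact_bounded cK.
have := mibp i f (`|N| + 1) df cpf => mibp0.
rewrite /Rintegral [X in fine X = _](_ : _ = 0%E)//.
rewrite -[RHS]mibp0; last first.
  move=> u uN; apply: f0 => Ku; apply: uN => j; rewrite mxE subr0.
  rewrite (le_trans (ler_mx_entry _ _ _))//.
  by apply: NK => //; rewrite ltr_pwDr// ler_norm.
rewrite integral_mkcond; apply: eq_integral => u _.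
rewrite patchE; case: ifPn => [|/negP uK]; last by rewrite pf0// => /(@mem_set _ K).
rewrite inE => Ku; rewrite pf; last exact: KU.
congr (_%:E); have Uu := KU _ Ku.
have dw : is_derive u ('e_i : 'rV[R]_d) w (partial i w u).
  by apply: derivableP; exact: (@C1_on_derivable _ _ _ _ _ _ Cw Uu).
have [_] := is_deriveM dw (is_derive_detr_partial i Uu CF).
by move=> E; rewrite addrC [X in _ + X]mulrC; exact: (esym E).
Qed.

(** * Bounded convergence on compact sets *)

Section bounded_convergence.
Context {R : realType} {T : topologicalType} (K : set T).
Implicit Types f g : T -> R.

(* The hypotheses of dominated convergence on a compact K, in a form that is stable
   under sums, products and determinants. *)
Definition bcvg (f_ : nat -> T -> R) f : Prop :=
  [/\ forall n, {within K, continuous (f_ n)}, {within K, continuous f},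
     forall u, K u -> f_ n u @[n --> \oo] --> f u
   & exists B : R, \forall n \near \oo, forall u, K u -> `|f_ n u| <= B].

Lemma bcvgD (f_ g_ : nat -> T -> R) f g : bcvg f_ f -> bcvg g_ g ->
  bcvg (fun n u => f_ n u + g_ n u) (fun u => f u + g u).
Proof.
move=> [cf_ cf ff [B fB]] [cg_ cg gg [C gC]]; split.
- by move=> n x; apply: (@continuousD _ R^o); [exact: cf_|exact: cg_].
- by move=> x; apply: (@continuousD _ R^o); [exact: cf|exact: cg].
- by move=> u Ku; apply: cvgD; [exact: ff|exact: gg].
- exists (B + C); near=> n => u Ku; apply: (le_trans (ler_normD _ _)).
  by apply: lerD; move: u Ku; near: n.
Unshelve. all: by end_near. Qed.

Lemma bcvgM (f_ g_ : nat -> T -> R) f g : bcvg f_ f -> bcvg g_ g ->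
  bcvg (fun n u => f_ n u * g_ n u) (fun u => f u * g u).
Proof.
move=> [cf_ cf ff [B fB]] [cg_ cg gg [C gC]]; split.
- by move=> n x; apply: continuousM; [exact: cf_|exact: cg_].
- by move=> x; apply: continuousM; [exact: cf|exact: cg].
- by move=> u Ku; apply: cvgM; [exact: ff|exact: gg].
- exists (B * C); near=> n => u Ku; rewrite normrM.
  by apply: ler_pM => //; move: u Ku; near: n.
Unshelve. all: by end_near. Qed.

Lemma bcvg_cst f : compact K -> {within K, continuous f} -> bcvg (fun=> f) f.
Proof.
move=> cK cf; split => // [u _|]; first exact: cvg_cst.
have /compact_bounded[M [_ mrt]] := continuous_compact cf cK.
exists (`|M| + 1); apply: nearW => _ u Ku.
by apply: mrt; [rewrite ltr_pwDr// ler_norm|exists u].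
Qed.

Lemma bcvg_real (a : R) : bcvg (fun _ _ => a) (fun=> a).
Proof.
split => [_ x|x|u _|]; [exact: cst_continuous|exact: cst_continuous|exact: cvg_cst|].
by exists `|a|; apply: nearW.
Qed.

Lemma bcvg_sum (I : Type) (s : seq I) (P : pred I) (f_ : I -> nat -> T -> R) (f : I -> T -> R) :
  (forall i, bcvg (f_ i) (f i)) ->
  bcvg (fun n u => \sum_(i <- s | P i) f_ i n u) (fun u => \sum_(i <- s | P i) f i u).
Proof.
move=> H; elim: s => [|i s IH].
  rewrite (_ : (fun n u => _) = (fun _ _ => 0)); last first.
    by apply/funext => n; apply/funext => u; rewrite big_nil.
  by under [X in bcvg _ X]eq_fun do rewrite big_nil; exact: bcvg_real.
rewrite (_ : (fun n u => _) = (fun n u => if P i then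
    f_ i n u + \sum_(j <- s | P j) f_ j n u else \sum_(j <- s | P j) f_ j n u)); last first.
  by apply/funext => n; apply/funext => u; rewrite big_cons.
by under [X in bcvg _ X]eq_fun do rewrite big_cons;
  case: (P i); [exact: (bcvgD (H i) IH)|exact: IH].
Qed.

Lemma bcvg_prod (I : Type) (s : seq I) (P : pred I) (f_ : I -> nat -> T -> R) (f : I -> T -> R) :
  (forall i, bcvg (f_ i) (f i)) ->
  bcvg (fun n u => \prod_(i <- s | P i) f_ i n u) (fun u => \prod_(i <- s | P i) f i u).
Proof.
move=> H; elim: s => [|i s IH].
  rewrite (_ : (fun n u => _) = (fun _ _ => 1)); last first.
    by apply/funext => n; apply/funext => u; rewrite big_nil.
  by under [X in bcvg _ X]eq_fun do rewrite big_nil; exact: bcvg_real.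
rewrite (_ : (fun n u => _) = (fun n u => if P i then
    f_ i n u * \prod_(j <- s | P j) f_ j n u else \prod_(j <- s | P j) f_ j n u)); last first.
  by apply/funext => n; apply/funext => u; rewrite big_cons.
by under [X in bcvg _ X]eq_fun do rewrite big_cons;
  case: (P i); [exact: (bcvgM (H i) IH)|exact: IH].
Qed.

Lemma bcvg_det k (F_ : nat -> T -> 'M[R]_k) (F : T -> 'M[R]_k) :
  (forall i j, bcvg (fun n u => F_ n u i j) (fun u => F u i j)) ->
  bcvg (fun n u => \det (F_ n u)) (fun u => \det (F u)).
Proof.
move=> H; apply: (@bcvg_sum _ _ _ (fun s n u => (-1) ^+ perm.odd_perm s *
  \prod_i F_ n u i (perm.fun_of_perm s i))
  (fun s u => (-1) ^+ perm.odd_perm s * \prod_i F u i (perm.fun_of_perm s i))) => s.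
apply: bcvgM; first exact: bcvg_real.
exact: bcvg_prod.
Qed.

Lemma bcvg_detr k (F_ : nat -> T -> 'I_k -> 'rV[R]_k) (F : T -> 'I_k -> 'rV[R]_k) :
  (forall i j, bcvg (fun n u => F_ n u i 0 j) (fun u => F u i 0 j)) ->
  bcvg (fun n u => detr (F_ n u)) (fun u => detr (F u)).
Proof.
move=> H; apply: bcvg_det => i j.
rewrite (_ : (fun n u => _) = (fun n u => F_ n u i 0 j)); last first.
  by apply/funext => n; apply/funext => u; rewrite mxE.
by under [X in bcvg _ X]eq_fun do rewrite mxE; exact: H.
Qed.

Lemma bcvg_sqrt (f_ : nat -> T -> R) f : bcvg f_ f ->
  bcvg (fun n u => Num.sqrt (f_ n u)) (fun u => Num.sqrt (f u)).
Proof.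
move=> [cf_ cf ff [B fB]]; split.
- move=> n x; apply: (@continuous_comp _ _ _ (f_ n : subspace K -> R) Num.sqrt).
    exact: cf_.
  exact: sqrt_continuous.
- move=> x; apply: (@continuous_comp _ _ _ (f : subspace K -> R) Num.sqrt).
    exact: cf.
  exact: sqrt_continuous.
- move=> u Ku; apply: continuous_cvg; [exact: sqrt_continuous|exact: ff].
- exists (Num.sqrt B); near=> n => u Ku.
  rewrite ger0_norm ?sqrtr_ge0// ler_wsqrtr// (le_trans (ler_norm _))//.
  by move: u Ku; near: n.
Unshelve. all: by end_near. Qed.

End bounded_convergence.

Lemma cvg_Rintegral_bcvg (R : realType) d
    (m : {sigma_finite_measure set (borel_rV R d) -> \bar R}) (K : set 'rV[R]_d)
    (f_ : nat -> 'rV[R]_d -> R) (f : 'rV[R]_d -> R) :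
  is_lebesgue_rV m -> compact K -> bcvg K f_ f ->
  \int[m]_(u in K) f_ n u @[n --> \oo] --> \int[m]_(u in K) f u.
Proof.
move=> [_ mbox _] cK [cf_ cf ff [B [N _ fB]]].
have mK : measurable (K : set (borel_rV R d)) by exact: borel_compact.
(* Dominated convergence asks for the bound at every index, whereas [bcvg] gives it from [N] on. *)
rewrite -(cvg_shiftn N) /Rintegral.
have intB : m.-integrable K (EFin \o cst B).
  by apply: within_continuous_integrable => // x; exact: cst_continuous.
have [_ _ D] := @dominated_convergence _ _ R m K mK (fun n u => (f_ (n + N)%N u)%:E)
  (EFin \o f) (EFin \o cst B)
  (fun n => (measurable_int _ (within_continuous_integrable mbox cK (cf_ (n + N)%N))))
  (measurable_int _ (within_continuous_integrable mbox cK cf))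
  ltac:(by apply: aeW => u Ku; apply: cvg_EFin; [exact: nearW|
       by have := ff u Ku; rewrite -(cvg_shiftn N)])
  intB
  ltac:(by apply: aeW => u n Ku; rewrite lee_fin; apply: fB => //=; rewrite leq_addl).
apply: fine_cvg; rewrite fineK; first exact: D.
apply: integrable_fin_num => //.
exact: within_continuous_integrable.
Qed.

Lemma C1_on_within (R : realType) d (U K : set 'rV[R]_d) (f : 'rV[R]_d -> R) :
  K `<=` U -> C1_on U f -> {within K, continuous f}.
Proof.
move=> KU Cf; apply: continuous_in_subspaceT => u; rewrite inE => /KU Uu.
exact: (C1_on_continuous Cf Uu).
Qed.

Lemma C1_on_partial_within (R : realType) d (U K : set 'rV[R]_d) i (f : 'rV[R]_d -> R) :
  K `<=` U -> C1_on U f -> {within K, continuous (partial i f)}.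
Proof.
move=> KU Cf; apply: continuous_in_subspaceT => u; rewrite inE => /KU Uu.
exact: (@C1_on_partial _ _ _ _ _ _ Cf Uu).
Qed.

Lemma eq_within_continuous (R : realType) (T : topologicalType) (K : set T) (f g : T -> R) :
  (forall u, K u -> f u = g u) -> {within K, continuous f} -> {within K, continuous g}.
Proof.
move=> fg cf; apply: subspace_eq_continuous cf => u.
by rewrite inE => /fg.
Qed.

Lemma partial_within (R : realType) d n (U K : set 'rV[R]_d) i
    (F : 'rV[R]_d -> 'rV[R]_n) j :
  K `<=` U -> (forall j, C1_on U (fun u => F u 0 j)) ->
  {within K, continuous (fun u => partial i F u 0 j)}.
Proof.
move=> KU CF; apply: (@eq_within_continuous _ _ _ (partial i (fun u => F u 0 j))).
  by move=> u /KU Uu; rewrite partial_coord//; exact: (derivable_coord Uu CF).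
exact: (C1_on_partial_within KU (CF j)).
Qed.

Lemma upd_app (I : eqType) (T S : Type) (F : I -> T -> S) l (e : T -> S) u r :
  upd F l e r u = upd (F^~ u) l (e u) r.
Proof. by rewrite /upd; case: ifP. Qed.

Lemma frame_app (T S : Type) d (n : T -> S) (b : 'I_d -> T -> S) u r :
  frame n b r u = frame (n u) (b^~ u) r.
Proof. by rewrite /frame; case: unlift. Qed.

Lemma upd_same (I : eqType) (T : Type) (F : I -> T) l v : upd F l v l = v.
Proof. by rewrite /upd eqxx. Qed.

Lemma upd_neq (I : eqType) (T : Type) (F : I -> T) l v r :
  r != l -> upd F l v r = F r.
Proof. by rewrite /upd => /negPf ->. Qed.

Lemma upd_upd (I : eqType) (T : Type) (F : I -> T) l v w :
  upd (upd F l v) l w =1 upd F l w.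
Proof. by move=> r; rewrite /upd; case: eqP. Qed.

(** The integrand left by [integral_upd_detr] is polynomial in the entries of [F_], [DF_] and [e_].
    The derivatives [DF_] form a separate family because their convergence does not follow from that
    of [F_]. No derivative of [e_] occurs, so [e_] may be the difference quotient in time. *)
Lemma bcvg_upd_detr (R : realType) n (T : topologicalType) (K : set T) (l : 'I_n)
    (w dw : T -> R) (F_ DF_ : nat -> 'I_n -> T -> 'rV[R]_n) (F DF : 'I_n -> T -> 'rV[R]_n)
    (e_ : nat -> T -> 'rV[R]_n) (e : T -> 'rV[R]_n) :
  bcvg K (fun=> w) w -> bcvg K (fun=> dw) dw ->
  (forall r j, bcvg K (fun k u => F_ k r u 0 j) (fun u => F r u 0 j)) ->
  (forall r j, bcvg K (fun k u => DF_ k r u 0 j) (fun u => DF r u 0 j)) ->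
  (forall j, bcvg K (fun k u => e_ k u 0 j) (fun u => e u 0 j)) ->
  bcvg K (fun k u => dw u * detr (upd ((F_ k)^~ u) l (e_ k u)) + w u *
      \sum_(r | r != l) detr (upd (upd ((F_ k)^~ u) l (e_ k u)) r (DF_ k r u)))
    (fun u => dw u * detr (upd (F^~ u) l (e u)) + w u *
      \sum_(r | r != l) detr (upd (upd (F^~ u) l (e u)) r (DF r u))).
Proof.
move=> bw bdw bF bDF be; apply: bcvgD.
  apply: bcvgM => //; apply: bcvg_detr => r j; rewrite /upd.
  by case: (r == l); [exact: be|exact: bF].
apply: bcvgM => //.
apply: (@bcvg_sum _ _ _ _ _ _
  (fun r k u => detr (upd (upd ((F_ k)^~ u) l (e_ k u)) r (DF_ k r u)))
  (fun r u => detr (upd (upd (F^~ u) l (e u)) r (DF r u)))) => r.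
apply: bcvg_detr => k j; rewrite /upd.
by case: (k == r); [exact: bDF|case: (k == l); [exact: be|exact: bF]].
Qed.

Lemma C1_on_bcvg (R : realType) d (U K : set 'rV[R]_d) (f : 'rV[R]_d -> R) :
  compact K -> K `<=` U -> C1_on U f -> bcvg K (fun=> f) f.
Proof. by move=> cK KU Cf; apply: (bcvg_cst cK); exact: (C1_on_within KU Cf). Qed.

Lemma C1_on_partial_bcvg (R : realType) d n (U K : set 'rV[R]_d) i
    (F : 'rV[R]_d -> 'rV[R]_n) j : compact K -> K `<=` U ->
  (forall j, C1_on U (fun u => F u 0 j)) ->
  bcvg K (fun _ u => partial i F u 0 j) (fun u => partial i F u 0 j).
Proof.
move=> cK KU CF; apply: (@bcvg_cst _ _ _ (fun u => partial i F u 0 j) cK).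
exact: (partial_within KU CF).
Qed.

Lemma Rintegral_sum_within (R : realType) d
    (m : {sigma_finite_measure set (borel_rV R d) -> \bar R}) (K : set 'rV[R]_d)
    (I : Type) (s : seq I) (f : I -> 'rV[R]_d -> R) :
  is_lebesgue_rV m -> compact K -> (forall i, {within K, continuous (f i)}) ->
  \int[m]_(u in K) (\sum_(i <- s) f i u) = \sum_(i <- s) \int[m]_(u in K) f i u.
Proof.
move=> [_ mbox _] cK cf; elim: s => [|i s IH].
  under eq_Rintegral do rewrite big_nil.
  by rewrite big_nil (Rintegral_cst _ (borel_compact cK)) mul0r.
under eq_Rintegral do rewrite big_cons.
rewrite big_cons -IH RintegralD//.
- exact: borel_compact.
- exact: within_continuous_integrable.
- apply: within_continuous_integrable => //.
  by have [] := bcvg_sum s xpredT (fun i => bcvg_cst cK (cf i)).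
Qed.

(** In the derivative of the determinant with row [l] equal to [e], the term that differentiates row
    [l] is the integrand on the left; on the right the weight and the remaining rows take the
    derivative. *)
Lemma integral_upd_detr (R : realType) d n
    (m : {sigma_finite_measure set (borel_rV R d) -> \bar R})
    (U K : set 'rV[R]_d) (w : 'rV[R]_d -> R)
    (F : 'I_n -> 'rV[R]_d -> 'rV[R]_n) (l : 'I_n) (e : 'rV[R]_d -> 'rV[R]_n) (i : 'I_d) :
  is_lebesgue_rV m -> open U -> compact K -> K `<=` U -> C1_on U w ->
  (forall u, U u -> ~ K u -> w u = 0) ->
  (forall r j, C1_on U (fun u => F r u 0 j)) ->
  (forall j, C1_on U (fun u => e u 0 j)) ->
  \int[m]_(u in K) (w u * detr (upd (F^~ u) l (partial i e u))) =
  - \int[m]_(u in K) (partial i w u * detr (upd (F^~ u) l (e u)) +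
     w u * \sum_(r | r != l) detr (upd (upd (F^~ u) l (e u)) r (partial i (F r) u))).
Proof.
move=> lm oU cK KU Cw w0 CF Ce; have [_ mbox _] := lm.
have bw : bcvg K (fun=> w) w by apply: bcvg_cst => //; exact: (C1_on_within KU Cw).
have bpw : bcvg K (fun=> partial i w) (partial i w).
  by apply: bcvg_cst => //; exact: (C1_on_partial_within KU Cw).
have bF r j := C1_on_bcvg cK KU (CF r j).
have be j := C1_on_bcvg cK KU (Ce j).
have bpF r j := C1_on_partial_bcvg i j cK KU (CF r).
have bpe j := C1_on_partial_bcvg i j cK KU Ce.
have CG r j : C1_on U (fun u => upd F l e r u 0 j).
  by rewrite /upd; case: (r == l); [exact: Ce|exact: CF].
have I0 := integral_partial_detr i lm oU cK KU Cw w0 CG.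
have b1 : bcvg K (fun _ u => w u * detr (upd (F^~ u) l (partial i e u)))
   (fun u => w u * detr (upd (F^~ u) l (partial i e u))).
  apply: bcvgM => //; apply: bcvg_detr => r j; rewrite /upd.
  by case: (r == l); [exact: bpe|exact: bF].
have b2 := bcvg_upd_detr l bw bpw bF bpF be.
apply/eqP; rewrite -addr_eq0; apply/eqP; rewrite -RintegralD; last 3 first.
- exact: borel_compact.
- by case: b1 => _ + _ _; exact: within_continuous_integrable.
- by case: b2 => _ + _ _; exact: within_continuous_integrable.
rewrite -[RHS]I0; apply: eq_Rintegral => u _.
rewrite addrCA; congr (_ + _).
  by congr (_ * _); apply: eq_detr => r; rewrite upd_app.
rewrite -[LHS]mulrDr; congr (_ * _); rewrite [RHS](bigD1 l)//=; congr (_ + _).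
  rewrite upd_same; apply: eq_detr => r; rewrite -(upd_upd _ l (e u)) /upd.
  by case: eqP.
apply: eq_bigr => r rl; rewrite (upd_neq _ _ rl); apply: eq_detr => k.
by rewrite /upd; case: (k == r) => //; case: (k == l).
Qed.

Section frame_variation.
Context {R : realType} {d : nat}.
Variables (n : 'rV[R]_d.+1) (b : 'I_d -> 'rV[R]_d.+1).
Hypotheses (n1 : dot n n = 1) (bn : forall i, dot (b i) n = 0).
Hypothesis fb : row_free (\matrix_i b i).

(** In the application [y] holds the derivatives of the weight [w], [v] is the velocity, [dn] the
    derivative of the normal and [x] the second derivatives of the immersion. The first double sum
    is then the surface gradient of the weight, the second one the divergence of the normal. *)
Lemma frame_variation (y : 'I_d -> R) (w : R) (v : 'rV[R]_d.+1)
    (dn : 'I_d -> 'rV[R]_d.+1) (x : 'I_d -> 'I_d -> 'rV[R]_d.+1) :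
  (forall i, dot (dn i) n = 0) -> (forall i k, x i k = x k i) ->
  \sum_i (y i * detr (upd (frame n b) (lift ord0 i) v) +
    w * \sum_(r | r != lift ord0 i)
     detr (upd (upd (frame n b) (lift ord0 i) v) r (frame (dn i) (x i) r))) =
  (dot (\sum_i \sum_j (invmx (gramm b) i j * y i) *: b j) v +
   w * dot v n * - \sum_i \sum_j invmx (gramm b) i j * dot (dn i) (b j))
  * detr (frame n b).
Proof.
move=> hdn hx; rewrite big_split/= -mulr_sumr (sum_detr_upd2 n1 bn fb)//.
rewrite -sum_coef_grad -sum_coef.
under eq_bigr do rewrite (detr_upd_tangent n1 bn fb) mulrA.
rewrite -mulr_suml; ring.
Qed.

End frame_variation.

(** * The normal of a patch *)

Lemma unit_sign_eq (R : realType) (s t : R) :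
  s ^+ 2 = 1 -> t ^+ 2 = 1 -> `|s - t| < 1 -> s = t.
Proof.
move=> /eqP; rewrite sqrf_eq1 => /orP[] /eqP -> /eqP;
  rewrite sqrf_eq1 => /orP[] /eqP -> //; rewrite ltr_norml => /andP[]; lra.
Qed.

Lemma dot_delta (R : realType) n (v : 'rV[R]_n) j : dot (delta_mx 0 j) v = v 0 j.
Proof.
rewrite /dot (bigD1 j)//= big1 ?addr0 => [|k kj]; first by rewrite mxE !eqxx mul1r.
by rewrite mxE (negPf kj) mul0r.
Qed.

Lemma partial_unit_orthogonal (R : realType) d n (U : set 'rV[R]_d)
    (F : 'rV[R]_d -> 'rV[R]_n) i u : open U -> U u ->
  (forall j, C1_on U (fun u => F u 0 j)) -> (forall u, U u -> dot (F u) (F u) = 1) ->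
  dot (partial i F u) (F u) = 0.
Proof.
move=> oU Uu CF F1.
have dF j : is_derive u ('e_i : 'rV[R]_d) (fun u => F u 0 j) (partial i F u 0 j).
  rewrite partial_coord; last exact: (derivable_coord Uu CF).
  by apply: derivableP; have [df _] := CF j u Uu; exact: diff_derivable.
have [_ dd] := is_derive_bigsum (index_enum 'I_n) (fun j => is_deriveM (dF j) (dF j)).
have : \sum_j (F u 0 j *: partial i F u 0 j + F u 0 j *: partial i F u 0 j) = 0.
  apply: (etrans (esym dd)); apply: (etrans _ (derive_cst (1 : R) u ('e_i : 'rV[R]_d))).
  by apply: near_eq_derive; apply: (open_near oU Uu) => v /F1.
rewrite big_split/= -mulr2n => /eqP; rewrite mulrn_eq0/= => /eqP E.
by rewrite -[RHS]E; apply: eq_bigr => j _; rewrite mulrC.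
Qed.

Lemma C1_on_dot (R : realType) d n (U : set 'rV[R]_d) (F G : 'rV[R]_d -> 'rV[R]_n) :
  open U -> (forall j, C1_on U (fun u => F u 0 j)) ->
  (forall j, C1_on U (fun u => G u 0 j)) -> C1_on U (fun u => dot (F u) (G u)).
Proof.
by move=> oU CF CG; apply: C1_on_sum => [|j]; [exact: oU|exact: (C1_onM oU (CF j) (CG j))].
Qed.

Section patch.
Context {R : realType} {d : nat}.
Variables (U : set 'rV[R]_d) (X : 'rV[R]_d -> 'rV[R]_d.+1).
Hypotheses (oU : open U) (CX : C2_on U X).
Hypothesis fX : forall u, U u -> row_free (tangents X u).

Definition tang (Y : 'rV[R]_d -> 'rV[R]_d.+1) (u : 'rV[R]_d) : 'I_d -> 'rV[R]_d.+1 :=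
  fun i => partial i Y u.

Lemma C1_on_tang i j : C1_on U (fun u => tang X u i 0 j).
Proof. by have [_ C1] := CX; exact: (C1_on_coord _ oU (C1 i)). Qed.

Lemma C1_on_pos j : C1_on U (fun u => X u 0 j).
Proof. by have [C0 _] := CX; exact: (C1_on_coord _ oU C0). Qed.

Variables (nu : 'rV[R]_d -> 'rV[R]_d.+1).
Hypothesis cnu : forall u, U u -> {for u, continuous nu}.
Hypothesis nu1 : forall u, U u -> dot (nu u) (nu u) = 1.
Hypothesis Xnu : forall u, U u -> forall i, dot (partial i X u) (nu u) = 0.

Lemma det_gramE u : U u -> \det (gram X u) = detr (frame (nu u) (tang X u)) ^+ 2.
Proof. by move=> Uu; rewrite (detr_frame_sqr (nu1 Uu) (Xnu Uu)). Qed.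

Lemma det_frame_nu_neq0 u : U u -> detr (frame (nu u) (tang X u)) != 0.
Proof. by move=> Uu; exact: (detr_frame_neq0 (nu1 Uu) (Xnu Uu) (fX Uu)). Qed.

Lemma det_gram_gt0 u : U u -> 0 < \det (gram X u).
Proof. by move=> Uu; rewrite det_gramE// exprn_even_gt0//= det_frame_nu_neq0. Qed.

Lemma area_densityE u : U u -> area_density X u = `|detr (frame (nu u) (tang X u))|.
Proof. by move=> Uu; rewrite /area_density det_gramE// sqrtr_sqr. Qed.

Lemma area_density_gt0 u : U u -> 0 < area_density X u.
Proof. by move=> Uu; rewrite sqrtr_gt0 det_gram_gt0. Qed.

Lemma C1_on_area_density : C1_on U (area_density X).
Proof.
apply: C1_on_sqrt => [||u Uu]; [exact: oU| |exact: det_gram_gt0].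
have -> : (fun u => \det (gram X u)) =
    (fun u => detr (fun i => \row_j dot (tang X u i) (tang X u j))).
  by apply/funext => u; congr (\det _); apply/matrixP => i j; rewrite !mxE.
apply: C1_on_detr => [|i j]; first exact: oU.
under eq_fun do rewrite mxE.
by apply: C1_on_dot => [|k|k]; [exact: oU|exact: C1_on_tang|exact: C1_on_tang].
Qed.

(* The given normal is only continuous; this one, a cross product, is C^1, and the
   two agree up to a locally constant sign. *)
Definition patch_normal u : 'rV[R]_d.+1 :=
  (area_density X u)^-1 *: \row_j detr (frame (delta_mx 0 j) (tang X u)).

(** Entry [j] of the cross product is, by [detr_frame_normal], entry [j] of [nu] times the frame
    determinant, whose absolute value is the area density; the quotient of the two is the sign
    [s]. *)
Lemma patch_normalE u : U u -> exists2 s : R, s ^+ 2 = 1 & 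
  [/\ nu u = s *: patch_normal u, patch_normal u = s *: nu u &
      detr (frame (nu u) (tang X u)) = s * area_density X u].
Proof.
move=> Uu; set D := detr (frame (nu u) (tang X u)).
have D0 : D != 0 by exact: det_frame_nu_neq0.
have nE : patch_normal u = (D / `|D|) *: nu u.
  apply/rowP => j; rewrite mxE area_densityE// !mxE.
  have -> : detr (frame 'e_j (tang X u)) = dot 'e_j (nu u) * D.
    exact: (detr_frame_normal (nu1 Uu) (Xnu Uu) (fX Uu)).
  by rewrite dot_delta -/D; ring.
have s1 : (D / `|D|) ^+ 2 = 1.
  by rewrite expr_div_n real_normK ?num_real// divff// sqrf_eq0.
exists (D / `|D|) => //; split => //.
  by rewrite nE scalerA -expr2 s1 scale1r.
by rewrite area_densityE// -/D divfK// normr_eq0.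
Qed.

Lemma C1_on_patch_normal j : C1_on U (fun u => patch_normal u 0 j).
Proof.
under eq_fun do rewrite mxE.
apply: C1_onM => [||]; [exact: oU| |].
  apply: C1_on_inv => [||u Uu]; [exact: oU|exact: C1_on_area_density|].
  by rewrite gt_eqF ?area_density_gt0.
under eq_fun do rewrite mxE.
apply: (@C1_on_detr _ _ _ _ (fun r u => frame (delta_mx 0 j) (tang X u) r)) => [|r k].
  exact: oU.
rewrite /frame; case: unlift => [l|]; [exact: C1_on_tang|exact: C1_on_cst].
Qed.

Lemma patch_normal_unit u : U u -> dot (patch_normal u) (patch_normal u) = 1.
Proof.
move=> Uu; have [s s1 [_ -> _]] := patch_normalE Uu.
by rewrite dotZl dotZr nu1// mulr1 -expr2.
Qed.

Lemma patch_normal_orthogonal u i : U u -> dot (partial i X u) (patch_normal u) = 0.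
Proof.
move=> Uu; have [s s1 [_ -> _]] := patch_normalE Uu.
by rewrite dotZr Xnu// mulr0.
Qed.

Lemma detr_patch_normal u : U u ->
  detr (frame (patch_normal u) (tang X u)) = area_density X u.
Proof.
move=> Uu; have [s s1 [_ nE DE]] := patch_normalE Uu.
rewrite (detr_frame_normal (nu1 Uu) (Xnu Uu) (fX Uu)) DE nE dotZl nu1// mulr1.
by rewrite mulrA -expr2 s1 mul1r.
Qed.

(** The sign is the inner product of [nu] and [patch_normal], a continuous function with values 1
    and -1, hence constant near [u]. So [nu] coincides there with a multiple of a C^1 field and
    inherits its derivatives. *)
Lemma partial_nuE u : U u -> exists2 s : R, s ^+ 2 = 1 &
  nu u = s *: patch_normal u /\ forall i, partial i nu u = s *: partial i patch_normal u.
Proof.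
move=> Uu; have [s s1 [nuE nE _]] := patch_normalE Uu; exists s => //; split => // i.
have cn : {for u, continuous patch_normal}.
  apply: (@cvg_rV _ _ _ (nbhs u)) => j.
  exact: (C1_on_continuous (C1_on_patch_normal j) Uu).
have cs : {for u, continuous (fun v => dot (nu v) (patch_normal v))}.
  have -> : (fun v => dot (nu v) (patch_normal v)) =
     \sum_k (fun v => nu v 0 k * patch_normal v 0 k) by apply/funext => v; rewrite fct_sumE.
  apply: (big_ind (fun f : _ -> R => {for u, continuous f})).
  - exact: cst_continuous.
  - by move=> f g cf cg; apply: (@continuousD _ R^o).
  - move=> k _; apply: continuousM.
      apply: (@continuous_comp _ _ _ nu (fun A : 'rV[R]_d.+1 => A 0 k)); first exact: cnu.
      exact: coord_continuous.
    exact: (C1_on_continuous (C1_on_patch_normal k) Uu).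
have su : dot (nu u) (patch_normal u) = s by rewrite nE dotZr nu1// mulr1.
have ns : \forall v \near u, nu v = s *: patch_normal v.
  near=> v.
  have Uv : U v by near: v; exact: open_nbhs_nbhs.
  have [t t1 [nuEv nEv _]] := patch_normalE Uv.
  have tv : dot (nu v) (patch_normal v) = t by rewrite nEv dotZr nu1// mulr1.
  have ts : `|s - t| < 1.
    by rewrite -su -tv; near: v; move/cvgrPdist_lt : cs; apply.
  by rewrite (unit_sign_eq s1 t1 ts).
rewrite /partial (near_eq_derive _ ns) deriveZ//.
exact: (derivable_coord Uu C1_on_patch_normal).
Unshelve. all: by end_near. Qed.

(** A change of orientation flips both factors: normal velocity times mean curvature does not depend
    on the choice of the normal. *)
Lemma surf_div_nuE u v : U u ->
  dot v (nu u) * surf_div X nu u = dot v (patch_normal u) * surf_div X patch_normal u.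
Proof.
move=> Uu; have [s s1 [-> pE]] := partial_nuE Uu.
have -> : surf_div X nu u = s * surf_div X patch_normal u.
  rewrite /surf_div mulr_sumr; apply: eq_bigr => i _; rewrite mulr_sumr.
  by apply: eq_bigr => j _; rewrite pE dotZl mulrCA.
by rewrite dotZr mulrACA -expr2 s1 mul1r.
Qed.

End patch.

(** * First variation of the area of a patch *)

Lemma within_continuous_opp (R : realType) (T : topologicalType) (K : set T) (f : T -> R) :
  {within K, continuous f} -> {within K, continuous (fun x => - f x)}.
Proof. by move=> cf u; apply: (@cvgN _ R^o); exact: cf. Qed.

Lemma within_continuous_add (R : realType) (T : topologicalType) (K : set T) (f g : T -> R) :
  {within K, continuous f} -> {within K, continuous g} ->
  {within K, continuous (fun x => f x + g x)}.
Proof. by move=> cf cg u; apply: (@cvgD _ R^o); [exact: cf|exact: cg]. Qed.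

Lemma within_continuous_mul (R : realType) (T : topologicalType) (K : set T) (f g : T -> R) :
  {within K, continuous f} -> {within K, continuous g} ->
  {within K, continuous (fun x => f x * g x)}.
Proof. by move=> cf cg u; apply: cvgM; [exact: cf|exact: cg]. Qed.

Lemma near_eq_differentiable (R : realType) (V W : normedModType R) (f g : V -> W) x :
  {near x, f =1 g} -> differentiable f x -> differentiable g x.
Proof.
move=> fg df; have fgx : f x = g x by exact: nbhs_singleton fg.
have E : g \o shift x = cst (g x) + 'd f x +o_ 0 id.
  apply/eqaddoP => e e0; rewrite -fgx.
  have := diff_locally df => /eqaddoP/(_ e e0) H.
  have fg0 : \forall y \near (0 : V), f (y + x) = g (y + x).
    by move: fg; rewrite (near_shift 0 x); apply: filterS => y /=; rewrite subr0.
  near=> y; have -> : (g \o shift x - (cst (f x) + 'd f x)) y =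
    (f \o shift x - (cst (f x) + 'd f x)) y.
    by rewrite /= [LHS]/GRing.add/= -(near fg0 y).
  by near: y.
have dE := diff_unique (diff_continuous df) E.
by apply/diff_locallyP; rewrite dE; split; [exact: diff_continuous|exact: E].
Unshelve. all: by end_near. Qed.

Lemma eq_C1_on (R : realType) d (V : normedModType R) (U : set 'rV[R]_d)
    (f g : 'rV[R]_d -> V) :
  open U -> (forall u, U u -> f u = g u) -> C1_on U f -> C1_on U g.
Proof.
move=> oU fg Cf u Uu; have nfg v : U v -> {near v, f =1 g}.
  by move=> Uv; exact: (open_near oU Uv).
have [df cf] := Cf u Uu; split=> [|i].
  exact: (near_eq_differentiable (nfg u Uu)).
apply: (@near_continuous _ _ _ (partial i f)); last exact: cf.
apply: (open_near oU Uu) => v Uv; rewrite /partial; apply: near_eq_derive.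
by apply: filterS (nfg v Uv) => y ->.
Qed.

Lemma C2_on_coord (R : realType) d n (U : set 'rV[R]_d) (X : 'rV[R]_d -> 'rV[R]_n) j :
  open U -> C2_on U X -> C2_on U (fun u => X u 0 j).
Proof.
move=> oU [C1 C2]; split=> [|i]; first exact: C1_on_coord.
apply: (@eq_C1_on _ _ _ _ (fun u => partial i X u 0 j) _ oU) => [u Uu|].
  by apply: partial_coord; apply: diff_derivable; have [] := C1 u Uu.
exact: (@C1_on_coord _ _ _ _ (partial i X) j oU (C2 i)).
Qed.

Lemma partialC_rV (R : realType) d n (U : set 'rV[R]_d) (X : 'rV[R]_d -> 'rV[R]_n)
    i k u : open U -> C2_on U X -> U u ->
  partial i (partial k X) u = partial k (partial i X) u.
Proof.
move=> oU CX Uu; apply/rowP => j; have [C1 C2] := CX.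
have E a b : partial a (partial b X) u 0 j = partial a (partial b (fun v => X v 0 j)) u.
  rewrite partial_coord; last by apply: diff_derivable; have [] := C2 b u Uu.
  rewrite /partial; apply: near_eq_derive; apply: (open_near oU Uu) => v Uv.
  by apply: partial_coord; apply: diff_derivable; have [] := C1 v Uv.
have CXj := C2_on_coord j oU CX.
apply: (etrans (E i k)); apply: (etrans _ (esym (E k i))).
exact: (@partialC R d U (fun v => X v 0 j) i k u oU CXj Uu).
Qed.

Lemma bcvg_area_density (R : realType) d (K : set 'rV[R]_d)
    (Y_ : nat -> 'rV[R]_d -> 'rV[R]_d.+1) (X : 'rV[R]_d -> 'rV[R]_d.+1) :
  (forall i j, bcvg K (fun k u => partial i (Y_ k) u 0 j) (fun u => partial i X u 0 j)) ->
  bcvg K (fun k => area_density (Y_ k)) (area_density X).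
Proof.
move=> bY; apply: (@bcvg_sqrt _ _ _ (fun k u => \det (gram (Y_ k) u)) (fun u => \det (gram X u))).
apply: bcvg_det => i j.
have -> : (fun n u => gram (Y_ n) u i j) =
    (fun n u => \sum_l partial i (Y_ n) u 0 l * partial j (Y_ n) u 0 l).
  by apply/funext => k; apply/funext => u; rewrite mxE.
have -> : (fun u => gram X u i j) = (fun u => \sum_l partial i X u 0 l * partial j X u 0 l).
  by apply/funext => u; rewrite mxE.
by apply: (bcvg_sum _ _ (fun l => bcvgM (bY i l) (bY j l))).
Qed.

Section Rintegral_within.
Context {R : realType} {d : nat}.
Variables (m : {sigma_finite_measure set (borel_rV R d) -> \bar R}) (K : set 'rV[R]_d).
Hypotheses (lm : is_lebesgue_rV m) (cK : compact K).

Lemma lebesgue_within_integrable (f : 'rV[R]_d -> R) :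
  {within K, continuous f} -> m.-integrable K (EFin \o f).
Proof. by have [_ mbox _] := lm; exact: (within_continuous_integrable mbox cK). Qed.

Lemma Rintegral_withinB (f g : 'rV[R]_d -> R) :
  {within K, continuous f} -> {within K, continuous g} ->
  \int[m]_(u in K) (f u - g u) = \int[m]_(u in K) f u - \int[m]_(u in K) g u.
Proof.
move=> cf cg.
exact: (RintegralB (borel_compact cK) (lebesgue_within_integrable cf)
  (lebesgue_within_integrable cg)).
Qed.

Lemma Rintegral_withinZ (a : R) (f : 'rV[R]_d -> R) : {within K, continuous f} ->
  \int[m]_(u in K) (a * f u) = a * \int[m]_(u in K) f u.
Proof.
by move=> cf; exact: (RintegralZl a (borel_compact cK) (lebesgue_within_integrable cf)).
Qed.

Lemma Rintegral_within_le (f g : 'rV[R]_d -> R) :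
  {within K, continuous f} -> {within K, continuous g} -> (forall u, K u -> f u <= g u) ->
  \int[m]_(u in K) f u <= \int[m]_(u in K) g u.
Proof.
move=> cf cg.
exact: (le_Rintegral (borel_compact cK) (lebesgue_within_integrable cf)
  (lebesgue_within_integrable cg)).
Qed.

End Rintegral_within.

Section chart_variation.
Context {R : realType} {d : nat}.
Variables (m : {sigma_finite_measure set (borel_rV R d) -> \bar R}).
Hypothesis lm : is_lebesgue_rV m.
Variables (U K : set 'rV[R]_d) (w : 'rV[R]_d -> R).
Hypotheses (oU : open U) (cK : compact K) (KU : K `<=` U) (Cw : C1_on U w).
Hypothesis w0 : forall u, U u -> ~ K u -> w u = 0.
Variables (X nu : 'rV[R]_d -> 'rV[R]_d.+1).
Hypotheses (CX : C2_on U X) (fX : forall u, U u -> row_free (tangents X u)).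
Hypothesis cnu : forall u, U u -> {for u, continuous nu}.
Hypothesis nu1 : forall u, U u -> dot (nu u) (nu u) = 1.
Hypothesis Xnu : forall u, U u -> forall i, dot (partial i X u) (nu u) = 0.

Let n := patch_normal X.

Let rows : 'I_d.+1 -> 'rV[R]_d -> 'rV[R]_d.+1 := frame n (fun k => partial k X).

(** For smooth [v] and a weight supported in the patch, the integral of this is minus the rate of
    change of the [w]-weighted area under the velocity [v], written without derivatives of [v];
    [- surf_div X nu] is the mean curvature. *)
Definition first_variation (v : 'rV[R]_d -> 'rV[R]_d.+1) u : R :=
  (dot (surf_grad X w u) (v u) + w u * dot (v u) (nu u) * - surf_div X nu u)
  * area_density X u.

Definition gradient_term (v : 'rV[R]_d -> 'rV[R]_d.+1) u : R :=
  dot (surf_grad X w u) (v u) * area_density X u.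

Definition curvature_term (v : 'rV[R]_d -> 'rV[R]_d.+1) u : R :=
  w u * (dot (v u) (nu u) * - surf_div X nu u) * area_density X u.

Lemma first_variation_split v u :
  first_variation v u = gradient_term v u + curvature_term v u.
Proof. by rewrite /first_variation /gradient_term /curvature_term -mulrDl mulrA. Qed.

(** [frame_variation] with zero weight isolates the gradient part. The determinant form involves
    continuous rows, so it exhibits [gradient_term v] as continuous. *)
Lemma gradient_termE (v : 'rV[R]_d -> 'rV[R]_d.+1) u : U u ->
  \sum_i partial i w u * detr (upd (rows^~ u) (lift ord0 i) (v u)) = gradient_term v u.
Proof.
move=> Uu; have nn := patch_normal_unit fX nu1 Xnu.
have := frame_variation (nn u Uu) (fun i => patch_normal_orthogonal fX nu1 Xnu i Uu) (fX Uu)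
  (fun i => partial i w u) 0 (v u) (dn := fun i => 0) (x := fun i k => 0).
have -> : detr (frame (patch_normal X u) (fun i => partial i X u)) = area_density X u.
  exact: (detr_patch_normal fX nu1 Xnu Uu).
rewrite mul0r mul0r addr0 => E; rewrite /gradient_term; apply: etrans (E _ _) => //; last first.
  by move=> i; rewrite /dot big1// => k _; rewrite mxE mul0r.
apply: eq_bigr => i _; rewrite mul0r addr0; congr (_ * _); apply: eq_detr => r.
rewrite /upd; case: eqP => // _.
by rewrite /rows frame_app.
Qed.

Lemma C1_on_rows r j : C1_on U (fun u => rows r u 0 j).
Proof.
rewrite /rows /frame; case: unlift => [k|]; first exact: C1_on_tang.
exact: (C1_on_patch_normal oU CX fX nu1 Xnu).
Qed.

(** [frame_variation] for the C^1 normal, with second derivatives of [X] symmetric by [partialC_rV];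
    [surf_div_nuE] then exchanges that normal for [nu]. *)
Lemma first_variationE (v : 'rV[R]_d -> 'rV[R]_d.+1) u : U u ->
  \sum_i (partial i w u * detr (upd (rows^~ u) (lift ord0 i) (v u)) +
    w u * \sum_(r | r != lift ord0 i)
     detr (upd (upd (rows^~ u) (lift ord0 i) (v u)) r (partial i (rows r) u))) =
  first_variation v u.
Proof.
move=> Uu; have nn := patch_normal_unit fX nu1 Xnu.
have := frame_variation (nn u Uu) (fun i => patch_normal_orthogonal fX nu1 Xnu i Uu) (fX Uu)
  (fun i => partial i w u) (w u) (v u) (dn := fun i => partial i n u)
  (x := fun i k => partial i (partial k X) u).
have -> : detr (frame (patch_normal X u) (fun i => partial i X u)) = area_density X u.
  exact: (detr_patch_normal fX nu1 Xnu Uu).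
move=> E; rewrite /first_variation -mulrA mulrN.
rewrite (surf_div_nuE oU CX fX cnu nu1 Xnu)// -mulrN mulrA -E.
- have rE : rows^~ u = frame (patch_normal X u) (fun k => partial k X u).
    by apply/funext => r; rewrite /rows frame_app.
  rewrite rE; apply: eq_bigr => i _; congr (_ + _ * _).
  apply: eq_bigr => r _; congr (detr (upd _ _ _)).
  by rewrite /rows /frame; case: unlift.
- have Cn := C1_on_patch_normal oU CX fX nu1 Xnu.
  by move=> i; exact: (@partial_unit_orthogonal _ _ _ _ (patch_normal X) i u oU Uu Cn nn).
- by move=> i k; exact: (partialC_rV _ _ oU CX Uu).
Qed.

Let bw : bcvg K (fun=> w) w. Proof. exact: C1_on_bcvg Cw. Qed.

Let bdw i : bcvg K (fun=> partial i w) (partial i w).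
Proof. by apply: (bcvg_cst cK); exact: (C1_on_partial_within KU Cw). Qed.

Let brows r j : bcvg K (fun _ u => rows r u 0 j) (fun u => rows r u 0 j).
Proof. exact: (C1_on_bcvg cK KU (C1_on_rows r j)). Qed.

Let bdrows i r j :
  bcvg K (fun _ u => partial i (rows r) u 0 j) (fun u => partial i (rows r) u 0 j).
Proof. exact: (C1_on_partial_bcvg _ _ cK KU (C1_on_rows r)). Qed.

Let bX j : bcvg K (fun _ u => X u 0 j) (fun u => X u 0 j).
Proof. exact: (C1_on_bcvg cK KU (C1_on_pos oU CX j)). Qed.

Lemma gradient_term_continuous (v : 'rV[R]_d -> 'rV[R]_d.+1) :
  (forall j, {within K, continuous (fun u => v u 0 j)}) ->
  {within K, continuous (gradient_term v)}.
Proof.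
move=> cv; have bv j := bcvg_cst cK (cv j).
have [_ c _ _] : bcvg K
    (fun _ u => \sum_i partial i w u * detr (upd (rows^~ u) (lift ord0 i) (v u)))
    (fun u => \sum_i partial i w u * detr (upd (rows^~ u) (lift ord0 i) (v u))).
  apply: (bcvg_sum _ _ (fun i => bcvgM (bdw i) _)) => i; apply: bcvg_detr => r j.
  by rewrite /upd; case: (r == _); [exact: bv|exact: brows].
by apply: eq_within_continuous c => u /KU Uu; exact: gradient_termE.
Qed.

Lemma first_variation_continuous (v : 'rV[R]_d -> 'rV[R]_d.+1) :
  (forall j, {within K, continuous (fun u => v u 0 j)}) ->
  {within K, continuous (first_variation v)}.
Proof.
move=> cv; have bv j := bcvg_cst cK (cv j).
have bi i := bcvg_upd_detr (lift ord0 i) bw (bdw i) brows (bdrows i) bv.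
have [_ c _ _] := bcvg_sum (index_enum 'I_d) xpredT bi.
by apply: eq_within_continuous c => u /KU Uu; exact: first_variationE.
Qed.

Lemma curvature_term_continuous (v : 'rV[R]_d -> 'rV[R]_d.+1) :
  (forall j, {within K, continuous (fun u => v u 0 j)}) ->
  {within K, continuous (curvature_term v)}.
Proof.
move=> cv; have c := within_continuous_add (first_variation_continuous cv)
  (within_continuous_opp (gradient_term_continuous cv)).
by apply: eq_within_continuous c => u _; rewrite first_variation_split addrAC subrr add0r.
Qed.

Lemma integral_first_variation (v : 'rV[R]_d -> 'rV[R]_d.+1) :
  (forall j, {within K, continuous (fun u => v u 0 j)}) ->
  \int[m]_(u in K) first_variation v u =
  \int[m]_(u in K) gradient_term v u + \int[m]_(u in K) curvature_term v u.
Proof.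
move=> cv; under eq_Rintegral do rewrite first_variation_split.
exact: (RintegralD (borel_compact cK)
  (lebesgue_within_integrable lm cK (gradient_term_continuous cv))
  (lebesgue_within_integrable lm cK (curvature_term_continuous cv))).
Qed.

(* The velocity X generates the dilations, under which the area has degree d. *)
Lemma integral_scaling :
  d%:R * \int[m]_(u in K) (w u * area_density X u) =
  - \int[m]_(u in K) first_variation X u.
Proof.
(* Row [i] of the tangents is [partial i X] already, so each of these [d] integrals is the weighted
   area; integrating by parts in each of them takes the derivative off [X]. *)
have I_ i := integral_upd_detr (lift ord0 i) i lm oU cK KU Cw w0 C1_on_rows (C1_on_pos oU CX).
have E i : \int[m]_(u in K) (w u * detr (upd (rows^~ u) (lift ord0 i) (partial i X u))) =
    \int[m]_(u in K) (w u * area_density X u).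
  apply: eq_Rintegral => u; rewrite inE => /KU Uu; congr (_ * _).
  rewrite -(detr_patch_normal fX nu1 Xnu Uu); apply: eq_detr => r.
  rewrite /upd; case: eqP => [->|_]; first by rewrite frameS.
  by rewrite /rows frame_app.
have -> : d%:R * \int[m]_(u in K) (w u * area_density X u) =
    \sum_(i < d) \int[m]_(u in K) (w u * area_density X u).
  by rewrite sumr_const card_ord mulr_natl.
under eq_bigr => i _ do rewrite -(E i) I_.
rewrite sumrN; congr (- _).
rewrite -(Rintegral_sum_within _ lm cK); last first.
  by move=> i; have [_ + _ _] := bcvg_upd_detr (lift ord0 i) bw (bdw i) brows (bdrows i) bX.
apply: eq_Rintegral => u; rewrite inE => /KU Uu.
exact: first_variationE.
Qed.

(* L_ k comes from the telescoped difference of determinants, integrated by parts;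
   det (n, dY) <= area density of Y gives the inequality. *)
Lemma first_variation_lower_limit (Y_ : nat -> 'rV[R]_d -> 'rV[R]_d.+1)
    (a_ : nat -> R) (v : 'rV[R]_d -> 'rV[R]_d.+1) :
  (forall u, K u -> 0 <= w u) -> (forall k, 0 < a_ k) ->
  (forall k, C2_on U (Y_ k)) ->
  (forall i j, bcvg K (fun k u => partial i (Y_ k) u 0 j) (fun u => partial i X u 0 j)) ->
  (forall i l j, bcvg K (fun k u => partial i (partial l (Y_ k)) u 0 j)
                        (fun u => partial i (partial l X) u 0 j)) ->
  (forall j, bcvg K (fun k u => (a_ k)^-1 * (X u 0 j - Y_ k u 0 j)) (fun u => v u 0 j)) ->
  (forall k u, U u -> detr (frame (patch_normal X u) (tang (Y_ k) u)) <= area_density (Y_ k) u) ->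
  exists L_ : nat -> R, L_ k @[k --> \oo] --> \int[m]_(u in K) first_variation v u /\
   forall k, L_ k <= (a_ k)^-1 * (\int[m]_(u in K) (w u * area_density (Y_ k) u) -
                                 \int[m]_(u in K) (w u * area_density X u)).
Proof.
move=> wge0 a0 CY bY1 bY2 bV hJ; have le_eq (x y : R) : x = y -> x <= y by move=> ->.
pose V k (u : 'rV[R]_d) : 'rV[R]_d.+1 := (a_ k)^-1 *: (X u - Y_ k u).
have CYp k j : C1_on U (fun u => Y_ k u 0 j) by exact: (C1_on_pos oU (CY k) j).
have CV k j : C1_on U (fun u => V k u 0 j).
  have -> : (fun u => V k u 0 j) = (fun u => (a_ k)^-1 * (X u 0 j + (-1) * Y_ k u 0 j)).
    by apply/funext => u; rewrite !mxE mulN1r.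
  have Cc (a : R) : C1_on U (fun=> a) by exact: C1_on_cst.
  exact: (C1_onM oU (Cc _) (C1_onD oU (C1_on_pos oU CX j) (C1_onM oU (Cc _) (CYp k j)))).
have bVv j : bcvg K (fun k u => V k u 0 j) (fun u => v u 0 j).
  have -> : (fun k u => V k u 0 j) = (fun k u => (a_ k)^-1 * (X u 0 j - Y_ k u 0 j)) => //.
  by apply/funext => k; apply/funext => u; rewrite !mxE.
(* The mixed frame of [detr_telescope]: tangents of [Y_ k] before [i], of [X] from [i] on. The
   tangents of [Y_ k] tend to those of [X], so every mixed frame tends to [rows], and its
   derivatives to those of [rows]. *)
pose F k (i : 'I_d) : 'I_d.+1 -> 'rV[R]_d -> 'rV[R]_d.+1 :=
  frame n (fun j => if (j < i)%N then partial j (Y_ k) else partial j X).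
have CF k i r j : C1_on U (fun u => F k i r u 0 j).
  rewrite /F /frame; case: unlift => [l|]; last exact: (C1_on_patch_normal oU CX fX nu1 Xnu).
  by case: (l < i)%N; [exact: (C1_on_tang oU (CY k))|exact: (C1_on_tang oU CX)].
have F0 k i : F k i ord0 = n by exact: frame0.
have FS k i l : F k i (lift ord0 l) = if (l < i)%N then partial l (Y_ k) else partial l X.
  exact: frameS.
have bF i r j : bcvg K (fun k u => F k i r u 0 j) (fun u => rows r u 0 j).
  rewrite /rows; case: (unliftP ord0 r) => [l|] ->.
    rewrite frameS; under [X in bcvg _ X]eq_fun do rewrite FS.
    case: (l < i)%N; first exact: bY1.
    exact: (C1_on_bcvg cK KU (C1_on_tang oU CX l j)).
  rewrite frame0; under [X in bcvg _ X]eq_fun do rewrite F0.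
  exact: (C1_on_bcvg cK KU (C1_on_patch_normal oU CX fX nu1 Xnu j)).
have bDF i r j : bcvg K (fun k u => partial i (F k i r) u 0 j) (fun u => partial i (rows r) u 0 j).
  rewrite /rows; case: (unliftP ord0 r) => [l|] ->.
    rewrite frameS; under [X in bcvg _ X]eq_fun do rewrite FS.
    case: (l < i)%N; first exact: bY2.
    exact: (C1_on_partial_bcvg _ _ cK KU (C1_on_tang oU CX l)).
  rewrite frame0; under [X in bcvg _ X]eq_fun do rewrite F0.
  exact: (C1_on_partial_bcvg _ _ cK KU (C1_on_patch_normal oU CX fX nu1 Xnu)).
pose G k u := \sum_i (partial i w u * detr (upd ((F k i)^~ u) (lift ord0 i) (V k u)) +
    w u * \sum_(r | r != lift ord0 i)
     detr (upd (upd ((F k i)^~ u) (lift ord0 i) (V k u)) r (partial i (F k i r) u))).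
pose G0 u := \sum_i (partial i w u * detr (upd (rows^~ u) (lift ord0 i) (v u)) +
    w u * \sum_(r | r != lift ord0 i)
     detr (upd (upd (rows^~ u) (lift ord0 i) (v u)) r (partial i (rows r) u))).
have bGi i := bcvg_upd_detr (lift ord0 i) bw (bdw i) (bF i) (bDF i) bVv.
have bG : bcvg K G G0 by exact: (bcvg_sum _ _ bGi).
exists (fun k => \int[m]_(u in K) G k u); split.
  have -> : \int[m]_(u in K) first_variation v u = \int[m]_(u in K) G0 u.
    by apply: eq_Rintegral => u; rewrite inE => /KU Uu; rewrite -first_variationE.
  exact: (cvg_Rintegral_bcvg lm cK bG).
move=> k.
have bD i : bcvg K (fun _ u => w u * detr (upd ((F k i)^~ u) (lift ord0 i) (partial i (V k) u)))
    (fun u => w u * detr (upd ((F k i)^~ u) (lift ord0 i) (partial i (V k) u))).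
  apply: (bcvgM bw); apply: bcvg_detr => r j; rewrite /upd.
  case: (r == _); first exact: (C1_on_partial_bcvg _ _ cK KU (CV k)).
  exact: (C1_on_bcvg cK KU (CF k i r j)).
have cD i : {within K, continuous
    (fun u => - (w u * detr (upd ((F k i)^~ u) (lift ord0 i) (partial i (V k) u))))}.
  by have [_ c _ _] := bD i; exact: (within_continuous_opp c).
(* For fixed [k] the integration by parts is undone, which restores the derivative of [V k] that the
   telescoping produces. *)
have -> : \int[m]_(u in K) G k u =
   \int[m]_(u in K) \sum_i - (w u * detr (upd ((F k i)^~ u) (lift ord0 i) (partial i (V k) u))).
  rewrite (Rintegral_sum_within _ lm cK cD) (Rintegral_sum_within _ lm cK); last first.
    by move=> i; have [+ _ _ _] := bGi i; apply.
  apply: eq_bigr => i _.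
  have := integral_upd_detr (lift ord0 i) i lm oU cK KU Cw w0 (CF k i) (CV k).
  move=> /(congr1 -%R); rewrite opprK => <-.
  under [RHS]eq_Rintegral do rewrite -mulN1r.
  by have [_ c _ _] := bD i; rewrite (Rintegral_withinZ lm cK _ c) mulN1r.
have [cJ_ cJ _ _] := bcvgM bw (bcvg_area_density bY1).
have cdiff : {within K, continuous (fun u => w u * area_density (Y_ k) u - w u * area_density X u)}.
  exact: (within_continuous_add (cJ_ k) (within_continuous_opp cJ)).
apply: (le_trans _ (le_eq _ _
  (congr1 (fun x => (a_ k)^-1 * x) (Rintegral_withinB lm cK (cJ_ k) cJ)))).
apply: (le_trans _ (le_eq _ _ (Rintegral_withinZ lm cK _ cdiff))).
apply: (Rintegral_within_le lm cK).
- by have [] := bcvg_sum (index_enum 'I_d) xpredT (fun i => bcvg_cst cK (cD i)).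
- by move=> u; apply: cvgM; [exact: cst_continuous|exact: cdiff].
move=> u Ku; have Uu := KU Ku.
rewrite -mulrBr sumrN -mulr_sumr mulrCA -mulrN ler_wpM2l ?wge0//.
rewrite ler_pdivlMl//; apply: (@le_trans _ _
   (detr (frame (n u) (tang (Y_ k) u)) - detr (frame (n u) (tang X u)))); last first.
  by rewrite (detr_patch_normal fX nu1 Xnu Uu) lerB// hJ.
rewrite detr_telescope mulrN mulr_sumr -sumrN; apply: ler_sum => i _.
have -> : partial i (V k) u = (a_ k)^-1 *: (tang X u i - tang (Y_ k) u i).
  rewrite /partial deriveZ; last first.
    by apply: derivableB; apply: diff_derivable;
      [have [C _] := CX|have [C _] := CY k]; have [] := C u Uu.
  by rewrite deriveB//; apply: diff_derivable;
    [have [C _] := CX|have [C _] := CY k]; have [] := C u Uu.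
(* Linearity in row [i] is used twice: to cancel the factor [a_ k], and to change the sign, since
   [V k] is built from [X - Y_ k] while the telescoping yields [Y_ k - X]. *)
have := detr_updD ((F k i)^~ u) (lift ord0 i) ((a_ k)^-1) 0 (tang X u i - tang (Y_ k) u i) 0.
rewrite scale0r addr0 mul0r addr0 => ->.
rewrite mulVKf ?gt_eqF//.
have := detr_updD ((F k i)^~ u) (lift ord0 i) (-1) 0 (tang X u i - tang (Y_ k) u i) 0.
rewrite scale0r addr0 mul0r addr0 mulN1r scaleN1r opprB => <-.
apply/le_eq/eq_detr => r; rewrite /upd; case: eqP => // _.
rewrite /F frame_app; congr (frame _ _ r); apply/funext => j.
by case: ifP.
Qed.

End chart_variation.

(** * Area integrals in a chart *)

Section integral_density.
Local Open Scope ereal_scope.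
Context d1 d2 (S : measurableType d1) (Y : measurableType d2) (R : realType).
Variables (m : {measure set S -> \bar R}) (mu : {measure set Y -> \bar R}).
Variables (K : set S) (D : set Y) (phi : S -> Y) (J : S -> R).
Hypotheses (mK : measurable K) (mD : measurable D).
Hypotheses (mphi : measurable_fun K phi) (mJ : measurable_fun K J).
Hypothesis J0 : forall x, K x -> (0 <= J x)%R.
Hypothesis KD : forall x, K x -> D (phi x).
Hypothesis muE : forall A, measurable A -> A `<=` D ->
  mu A = \int[m]_(x in K) (\1_A (phi x) * J x)%:E.

Import HBNNSimple.

(** For indicators this is [muE]; simple functions follow by linearity, and the rest by monotone
    convergence along one approximating sequence used on both sides. *)
Lemma ge0_integral_density (f : Y -> \bar R) :
  measurable_fun D f -> (forall y, D y -> 0 <= f y) ->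
  \int[mu]_(y in D) f y = \int[m]_(x in K) (f (phi x) * (J x)%:E).
Proof.
move=> mf f0.
pose f_ := nnsfun_approx mD mf.
have mJE : measurable_fun K (EFin \o J) by exact/measurable_EFinP.
have mcomp (g : Y -> R) : measurable_fun setT g -> measurable_fun K (fun x => g (phi x)).
  by move=> mg; apply: (measurableT_comp mg mphi).
have mfn n : measurable_fun K (fun x => (f_ n (phi x))%:E).
  by apply/measurable_EFinP; exact: mcomp.
have mind A : measurable A -> measurable_fun K (fun x => \1_A (phi x) : R).
  by move=> mA; exact: (mcomp \1_A).
transitivity (limn (fun n => \int[mu]_(x in D) (f_ n x)%:E)).
  rewrite -monotone_convergence//.
  - apply: eq_integral => y /[!inE] yD; apply/esym/cvg_lim => //.
    exact: cvg_nnsfun_approx.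
  - by move=> n; exact/measurable_EFinP/measurable_funTS/measurable_funP.
  - by move=> n y _; rewrite lee_fin.
  - by move=> y _ k n kn; rewrite lee_fin; exact/lefP/nd_nnsfun_approx.
rewrite [X in limn X](_ : _ =
    (fun n => \int[m]_(x in K) ((f_ n (phi x))%:E * (J x)%:E))).
  rewrite -monotone_convergence//; last 3 first.
    - by move=> n; exact: emeasurable_funM.
    - by move=> n x Kx; rewrite mule_ge0// lee_fin// J0.
    - move=> x Kx k n kn; rewrite lee_wpmul2r ?lee_fin ?J0//.
      exact/lefP/nd_nnsfun_approx.
  apply: eq_integral => x /[!inE] Kx; apply/cvg_lim => //.
  by apply: cvgeZr => //; apply: cvg_nnsfun_approx => //; exact: KD.
apply/funext => n.
under eq_integral do rewrite fimfunE -fsumEFin//.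
rewrite ge0_integral_fsum//; last 2 first.
- by move=> y; exact/measurable_EFinP/measurable_funTS/measurable_funM.
- by move=> y x _; rewrite nnfun_muleindic_ge0.
have -> : (fun x => (f_ n (phi x))%:E * (J x)%:E) =
   (fun x => \sum_(k \in range (f_ n)) (k * (\1_(f_ n @^-1` [set k]) (phi x) * J x))%:E).
  apply/funext => x; rewrite -EFinM [in LHS]fimfunE fsumEFin// mulrC mulr_fsumr//.
  by congr (EFin _); apply: eq_fsbigr => k _; rewrite mulrCA (mulrC (J x)).
have rfn k : range (f_ n) k -> (0 <= k)%R by move=> [y _ <-].
have term0 k x : K x -> 0 <= (k * (\1_(f_ n @^-1` [set k]) (phi x) * J x))%:E.
  (* A value outside the range may be negative, but its fibre is empty and the term is zero. *)
  move=> Kx; rewrite lee_fin; have [kr|kr] := pselect (range (f_ n) k).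
    by apply: mulr_ge0; [exact: rfn|apply: mulr_ge0; [rewrite indicE|exact: J0]].
  rewrite indicE memNset ?mul0r ?mulr0// => E; apply: kr; rewrite -E; exists (phi x) => //.
rewrite ge0_integral_fsum//; last first.
  move=> k; apply/measurable_EFinP/measurable_funM => //.
  by apply: measurable_funM => //; exact: mind.
apply: eq_fsbigr => r; rewrite inE => rr; rewrite integralZl_indic_nnsfun// integral_indic//=.
rewrite muE; last 2 first.
- exact: measurableI.
- by move=> y [].
under [RHS]eq_integral do rewrite EFinM.
rewrite ge0_integralZl//.
- congr (_ * _); apply: eq_integral => x; rewrite inE => Kx.
  by rewrite !indicE in_setI (mem_set (KD Kx)) andbT.
- apply/measurable_EFinP; apply: measurable_funM => //; exact: mind.
- by move=> x Kx; rewrite lee_fin; apply: mulr_ge0; [rewrite indicE|exact: J0].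
- by rewrite lee_fin; exact: rfn.
Qed.

Lemma integrable_density (f : Y -> R) : measurable_fun D f ->
  m.-integrable K (fun x => (f (phi x) * J x)%:E) -> mu.-integrable D (EFin \o f).
Proof.
move=> mf /integrableP[_ iK]; apply/integrableP; split; first exact/measurable_EFinP.
rewrite ge0_integral_density => [||y _]; last exact: abse_ge0.
- rewrite (_ : \int[m]_(x in K) _ = \int[m]_(x in K) `|(f (phi x) * J x)%:E|)//.
  by apply: eq_integral => x; rewrite inE => Kx /=; rewrite normrM (ger0_norm (J0 Kx)).
- by apply/measurable_EFinP; apply: measurableT_comp.
Qed.

Lemma integral_density (f : Y -> R) : measurable_fun D f ->
  \int[mu]_(y in D) (f y)%:E = \int[m]_(x in K) (f (phi x) * J x)%:E.
Proof.
move=> mf; have mfE : measurable_fun D (EFin \o f) by exact/measurable_EFinP.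
rewrite integralE [RHS]integralE; congr (_ - _).
- rewrite ge0_integral_density//; last exact: measurable_funepos.
  apply: eq_integral => x; rewrite inE => Kx.
  by rewrite !funeposE -!EFin_max -EFinM maxr_pMl ?J0// mul0r.
- rewrite ge0_integral_density//; last exact: measurable_funeneg.
  apply: eq_integral => x; rewrite inE => Kx.
  by rewrite !funenegE -!EFinN -!EFin_max -EFinM maxr_pMl ?J0// mul0r mulNr.
Qed.

End integral_density.

(** What is known to be continuous is [g \o phi]. Its closed superlevel sets in [K] are compact, and
    their images under [phi], which are the superlevel sets of [g] in the image, are compact and so
    Borel. *)
Lemma measurable_fun_image (R : realType) n k (K : set 'rV[R]_n) (phi : 'rV[R]_n -> 'rV[R]_k)
    (g : 'rV[R]_k -> R) :
  compact K -> {within K, continuous phi} -> {within K, continuous (g \o phi)} ->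
  measurable_fun (phi @` K : set (borel_rV R k)) (g : borel_rV R k -> R).
Proof.
move=> cK cphi cg _.
have mphiK : measurable (phi @` K : set (borel_rV R k)).
  by apply: borel_compact; exact: continuous_compact.
apply: (measurability _ (RGenCInfty.measurableE R)) => //.
move=> _ [_ [a ->] <-].
have -> : phi @` K `&` g @^-1` `[a, +oo[ = phi @` (K `&` (g \o phi) @^-1` `[a, +oo[).
  apply/seteqP; split => [_ [[u Ku <-] gu]|_ [u [Ku gu] <-]]; first by exists u.
  by split => //; exists u.
have cl : closed (K `&` (g \o phi) @^-1` `[a, +oo[).
  have /closed_subspaceP[V cV] : closed ((g \o phi) @^-1` `[a, +oo[ : set (subspace K)).
    by move: cg => /continuous_closedP; apply; exact: interval_closed.
  by move=> VE; rewrite setIC -VE; apply: closedI => //; exact: compact_closed.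
apply: borel_compact; apply: continuous_compact.
  by apply: continuous_subspaceW cphi => u [].
by apply: (subclosed_compact cl cK) => u [].
Qed.

Lemma local_param_continuous (R : realType) d (M : set 'rV[R]_d.+1) (U K : set 'rV[R]_d)
    (phi : 'rV[R]_d -> 'rV[R]_d.+1) :
  local_param M U phi -> K `<=` U -> {within K, continuous phi}.
Proof.
move=> [oU [C1 _] _ _ _] KU; apply: continuous_in_subspaceT => u; rewrite inE => /KU Uu.
by apply: differentiable_continuous; have [] := C1 u Uu.
Qed.

Lemma local_param_sub (R : realType) d (M : set 'rV[R]_d.+1) (U : set 'rV[R]_d)
    (phi : 'rV[R]_d -> 'rV[R]_d.+1) u :
  local_param M U phi -> U u -> M (phi u).
Proof.
move=> [oU _ _ _ h]; have [W _ UW] := h U oU (fun=> id) => Uu.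
have : (phi @` U) (phi u) by exists u.
by rewrite UW => -[].
Qed.

Section area_integral.
Context {R : realType} {d : nat}.
Variables (m : {sigma_finite_measure set (borel_rV R d) -> \bar R}).
Hypothesis lm : is_lebesgue_rV m.
Variables (M : set 'rV[R]_d.+1) (cM : compact M) (X : 'rV[R]_d.+1 -> 'rV[R]_d.+1).
Variable mu : {measure set (borel_rV R d.+1) -> \bar R}.
Hypothesis muX : area_measure M X mu.
Variables (U K : set 'rV[R]_d) (phi : 'rV[R]_d -> 'rV[R]_d.+1).
Hypotheses (lp : local_param M U phi) (cK : compact K) (KU : K `<=` U).
Hypothesis cJ : {within K, continuous (area_density (X \o phi))}.

Let mK := borel_compact cK.

Let J0 u : 0 <= area_density (X \o phi) u. Proof. exact: sqrtr_ge0. Qed.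

Let mphi : measurable_fun (K : set (borel_rV R d)) (phi : borel_rV R d -> borel_rV R d.+1).
Proof. exact: (within_continuous_measurable_rV mK (local_param_continuous lp KU)). Qed.

Let mJ : measurable_fun (K : set (borel_rV R d)) (area_density (X \o phi) : borel_rV R d -> R).
Proof. exact: (within_continuous_measurable mK cJ). Qed.

(** A point of [U] whose image lies in [A] is in [K], because [phi] is injective on [U] and [A] is
    contained in the image of [K]. The integrand of [area_measure] thus lives on [K], where it is
    Borel, and [integral_rV] becomes the integral against [m]. *)
Lemma area_measure_chart (A : set (borel_rV R d.+1)) : measurable A -> A `<=` phi @` K ->
  (mu A = \int[m]_(u in K) (\1_A (phi u) * area_density (X \o phi) u)%:E)%E.
Proof.
move=> mA AK; have [oU _ _ inj _] := lp.
have fE : (fun u : borel_rV R d => (\1_(U `&` phi @^-1` A) u * area_density (X \o phi) u)%:E) =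
     (fun u : borel_rV R d => (\1_A (phi u) * area_density (X \o phi) u)%:E) \_ K.
  apply/funext => u; rewrite /patch !indicE; case: ifPn => uK.
    have Uu : U u by apply: KU; rewrite inE in uK.
    by rewrite in_setI (mem_set Uu).
  rewrite memNset ?mul0r// => -[Uu /AK[v Kv vu]]; case/negP : uK; rewrite inE.
  by rewrite -(inj v u _ _ vu)// inE//; exact: KU.
rewrite (muX lp) => //; last by move=> p /AK[u Ku <-]; exists u => //; exact: KU.
rewrite [RHS]integral_mkcond -fE; have [intE _ _] := lm; apply: intE.
- rewrite fE; apply/(measurable_restrictT _ mK)/measurable_EFinP.
  apply: measurable_funM => //.
  by apply: (@measurableT_comp _ _ _ _ _ _ (\1_A : borel_rV R d.+1 -> R)).
- by move=> u; rewrite lee_fin; apply: mulr_ge0; [rewrite indicE|exact: J0].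
Qed.

Variable g : 'rV[R]_d.+1 -> R.
Hypotheses (cg : {within K, continuous (g \o phi)}).
Hypothesis g0 : forall p, M p -> ~ (phi @` K) p -> g p = 0.

Let mphiK : measurable (phi @` K : set (borel_rV R d.+1)).
Proof.
by apply: borel_compact; apply: continuous_compact => //; exact: (local_param_continuous lp).
Qed.

Let mg : measurable_fun (phi @` K : set (borel_rV R d.+1)) (g : borel_rV R d.+1 -> R).
Proof. exact: (measurable_fun_image cK (local_param_continuous lp KU) cg). Qed.

Let gE : (EFin \o g) \_ M = (EFin \o g) \_ (phi @` K).
Proof.
apply/funext => p; rewrite /patch; have [Mp|Mp] := pselect (M p).
  rewrite (mem_set Mp); have [Kp|Kp] := pselect ((phi @` K) p); first by rewrite (mem_set Kp).
  by rewrite (memNset Kp)/= g0.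
rewrite (memNset Mp) memNset// => -[u /KU Uu up]; apply: Mp; rewrite -up.
exact: (local_param_sub lp).
Qed.

Lemma area_integrable : mu.-integrable (M : set (borel_rV R d.+1)) (EFin \o g).
Proof.
apply/(integrable_mkcond _ (borel_compact cM)); rewrite gE.
apply/(integrable_mkcond _ mphiK).
apply: (integrable_density mK mphiK mphi mJ (fun u _ => J0 u) _ area_measure_chart mg).
  by move=> u Ku; exists u.
exact: (lebesgue_within_integrable lm cK (within_continuous_mul cg cJ)).
Qed.

Lemma area_integralE :
  (\int[mu]_(p in M) (g p)%:E = \int[m]_(u in K) (g (phi u) * area_density (X \o phi) u)%:E)%E.
Proof.
rewrite integral_mkcond (gE : (fun p => (g p)%:E) \_ M = _) -integral_mkcond.
apply: (integral_density mK mphiK mphi mJ (fun u _ => J0 u) _ area_measure_chart mg).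
by move=> u Ku; exists u.
Qed.

End area_integral.

(** * Change of chart *)

Lemma diff_partial (R : realType) d (V : normedModType R) (f : 'rV[R]_d -> V) u (k : 'rV[R]_d) :
  differentiable f u -> 'd f u k = \sum_j k 0 j *: partial j f u.
Proof.
move=> df; rewrite {1}(row_sum_delta k) linear_sum; apply: eq_bigr => j _.
by rewrite linearZ/= -deriveE.
Qed.

Lemma diff_tangents (R : realType) d (f : 'rV[R]_d -> 'rV[R]_d.+1) u (k : 'rV[R]_d) :
  differentiable f u -> 'd f u k = k *m tangents f u.
Proof.
move=> df; rewrite diff_partial// mulmx_sum_row; apply: eq_bigr => j _.
by congr (_ *: _); apply/rowP => l; rewrite !mxE.
Qed.

Lemma mulmx_norm_bound (R : realType) n k (Q : 'M[R]_(n, k)) :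
  exists2 c : R, 0 < c & forall x : 'rV[R]_n, `|x *m Q| <= c * `|x|.
Proof.
exists (1 + \sum_i \sum_j `|Q i j|).
  by rewrite ltr_pwDl// sumr_ge0// => i _; rewrite sumr_ge0.
move=> x; apply: mx_norm_le => [|i j].
  by rewrite mulr_ge0// addr_ge0// sumr_ge0// => l _; rewrite sumr_ge0.
rewrite mxE (le_trans (ler_norm_sum _ _ _))// mulrDl mul1r ler_wpDl// mulr_suml ler_sum// => l _.
rewrite normrM mulrC ler_pM//; last by rewrite (ord1 i) ler_mx_entry.
by rewrite (bigD1 j)//= lerDl sumr_ge0.
Qed.

Lemma cvg_mulmx (R : realType) n k T (F : set_system T) {FF : Filter F} (Q : 'M[R]_(n, k))
    (f : T -> 'rV[R]_n) (l : 'rV[R]_n) :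
  f @ F --> l -> (fun x => f x *m Q) @ F --> l *m Q.
Proof.
move=> fl; have [c c0 cQ] := mulmx_norm_bound Q.
apply/cvgrPdist_lt => e e0; have ec : 0 < e / c by rewrite divr_gt0.
move/cvgrPdist_lt : fl => /(_ _ ec); apply: filterS => x; rewrite ltr_pdivlMr// mulrC => xe.
by rewrite -mulmxBl (le_lt_trans (cQ _)).
Qed.

Lemma diff_remainder (R : realType) (V W : normedModType R) (g : V -> W) u :
  differentiable g u -> forall e, 0 < e ->
  \forall k \near (0 : V), `|g (u + k) - g u - 'd g u k| <= e * `|k|.
Proof.
move=> dg e e0; have := diff_locally dg => /eqaddoP/(_ e e0).
apply: filterS => k.
rewrite -[(_ - _) k]/(g (k + u) - (g u + 'd g u k)) opprD addrA (addrC k).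
by [].
Qed.

(** A curve of size [O(h)] makes the remainder [o(h)]. This is all that [transition_curve] knows
    about its curve before the derivative has been found. *)
Lemma cvg_diff_curve (R : realType) (V W : normedModType R) (g : V -> W) u
    (k : R -> V) (C : R) :
  differentiable g u -> k h @[h --> 0^'] --> (0 : V) ->
  (\forall h \near 0^', `|k h| <= C * `|h|) ->
  (h^-1 *: (g (u + k h) - g u) - 'd g u (h^-1 *: k h)) @[h --> 0^'] --> (0 : W).
Proof.
move=> dg k0 kC; apply/cvgrPdist_le => e e0.
have C0 : 0 < `|C| + 1 by rewrite ltr_pwDr.
have ec : 0 < e / (`|C| + 1) by rewrite divr_gt0.
have nk := k0 _ (diff_remainder dg ec).
near=> h; rewrite sub0r normrN.
have h0 : h != 0 by near: h; exact: nbhs_dnbhs_neq.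
rewrite linearZ/= -scalerBr normrZ normfV ler_pdivrMl ?normr_gt0//.
apply: (@le_trans _ _ (e / (`|C| + 1) * `|k h|)); first by near: h.
rewrite -mulrA [leRHS]mulrC (ler_wpM2l (ltW e0))// ler_pdivrMl// (@le_trans _ _ (C * `|h|))//.
  by near: h.
by rewrite ler_wpM2r// (le_trans (ler_norm _))// lerDl.
Unshelve. all: by end_near. Qed.

Section transition.
Context {R : realType} {d : nat}.
Variable M : set 'rV[R]_d.+1.

Definition chart_inv (U : set 'rV[R]_d) (phi : 'rV[R]_d -> 'rV[R]_d.+1) u0 p : 'rV[R]_d :=
  xget u0 [set v | U v /\ phi v = p].

Lemma chart_invK U phi u0 u : local_param M U phi -> U u -> chart_inv U phi u0 (phi u) = u.
Proof.
move=> [_ _ _ inj _] Uu; rewrite /chart_inv; case: xgetP => [v _ [Uv vu]|/(_ u)].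
  by apply: inj; rewrite ?inE.
by move=> /(_ (conj Uu erefl)).
Qed.

(** Continuity of the inverse chart along [M]: the image of a neighbourhood of [u] is relatively
    open by the last clause of [local_param]. *)
Lemma near_chart_inv U phi u0 u (O : set 'rV[R]_d) : local_param M U phi -> U u -> nbhs u O ->
  \forall p \near phi u, M p -> [/\ U (chart_inv U phi u0 p), O (chart_inv U phi u0 p) &
    phi (chart_inv U phi u0 p) = p].
Proof.
move=> lp Uu; rewrite nbhsE => -[Q [oQ Qu] QO]; have [oU _ _ inj h] := lp.
have [W oW UW] := h (Q `&` U) (openI oQ oU) (@subIsetr _ _ _).
have Wu : W (phi u).
  have : (phi @` (Q `&` U)) (phi u) by exists u.
  by rewrite UW => -[].
apply: filterS (open_nbhs_nbhs (conj oW Wu)) => p Wp Mp.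
have : (M `&` W) p by [].
rewrite -UW => -[v [Qv Uv] <-]; rewrite (chart_invK _ lp Uv); split => //.
exact: QO.
Qed.

(* Along a coordinate line phi' is phi (u + k h); since d phi is injective, the
   first-order expansion of phi forces k h / h to converge. *)
Lemma transition_curve U phi U' phi' u u' :
  local_param M U phi -> local_param M U' phi' -> U u -> U' u' -> phi u = phi' u' ->
  exists P : 'M[R]_d, P \in unitmx /\
   forall (V : normedModType R) (f : 'rV[R]_d.+1 -> V) i, differentiable (f \o phi) u ->
     is_derive u' (delta_mx 0 i) (f \o phi') (\sum_j P i j *: partial j (f \o phi) u).
Proof.
move=> lp lp' Uu Uu' pu.
have [oU [C1 _] fr _ _] := lp; have [oU' [C1' _] fr' _ _] := lp'.
have dphi : differentiable phi u by have [] := C1 u Uu.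
have dphi' : differentiable phi' u' by have [] := C1' u' Uu'.
(* [Q] is a right inverse of the tangent matrix; it recovers a parameter increment from its image
   under the differential of [phi]. *)
have /row_freeP[Q BQ] := fr u Uu.
have [c c0 cQ] := mulmx_norm_bound Q.
pose P := tangents phi' u' *m Q.
pose k i (h : R) := chart_inv U phi u (phi' (h *: delta_mx 0 i + u')) - u.
have line0 i : h *: delta_mx 0 i + u' @[h --> (0 : R)^'] --> u'.
  rewrite -[X in _ --> X]add0r; apply: cvgD; last exact: cvg_cst.
  rewrite -(scale0r (delta_mx 0 i)); apply: cvgZr_tmp.
  exact: nbhs_dnbhs.
have kP i O : nbhs u O -> \forall h \near (0:R)^', U (u + k i h) /\ O (u + k i h) /\
    phi (u + k i h) = phi' (h *: delta_mx 0 i + u').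
  move=> nO; have H := near_chart_inv u lp Uu nO.
  have nU' : \forall h \near (0:R)^', U' (h *: delta_mx 0 i + u').
    by apply: (line0 i); exact: open_nbhs_nbhs.
  have c' : phi' (h *: delta_mx 0 i + u') @[h --> (0:R)^'] --> phi u.
    rewrite pu; apply: (cvg_comp _ _ (line0 i)).
    exact: (differentiable_continuous dphi').
  apply: filterS2 nU' (c' _ H) => h U'h; rewrite /k subrKC => Hh.
  by have [] := Hh (local_param_sub lp' U'h).
have k0 i : k i h @[h --> (0:R)^'] --> (0 : 'rV[R]_d).
  apply/cvgrPdist_lt => e e0; have := kP i _ (nbhsx_ballx u e e0).
  apply: filterS => h [_ [+ _]]; rewrite -ball_normE /= opprD addrA subrr sub0r normrN.
  by rewrite ?sub0r ?normrN.
pose D i h : 'rV[R]_d.+1 := h^-1 *: (phi' (h *: delta_mx 0 i + u') - phi' u').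
have DP i : D i h @[h --> (0:R)^'] --> partial i phi' u'.
  have dd : derivable phi' u' (delta_mx 0 i) by exact: diff_derivable.
  exact: dd.
have DQ i : D i h *m Q @[h --> (0:R)^'] --> row i P.
  have -> : row i P = partial i phi' u' *m Q.
    by rewrite row_mul; congr (_ *m _); apply/rowP => j; rewrite !mxE.
  exact: (cvg_mulmx (DP i)).
have kE i : \forall h \near (0:R)^', phi (u + k i h) - phi u = h *: D i h.
  near=> h; have h0 : h != 0 by near: h; exact: nbhs_dnbhs_neq.
  rewrite scalerA divff// scale1r -pu; congr (_ - _).
  by have [|_ []] := near (kP i setT (filterT)) h.
have kC i : \forall h \near (0:R)^', `|k i h| <= (2 * (`|row i P| + 1)) * `|h|.
  (* The tolerance [1 / (2 * c)] makes the remainder, after multiplication by [Q], at most half the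
     norm of [k i h], so it is absorbed on the left. What is left is a bound [O(h)]. *)
  have nr := k0 i _ (diff_remainder dphi (divr_gt0 ltr01 (mulr_gt0 (ltr0n R 2) c0))).
  have nDQ : \forall h \near (0:R)^', `|D i h *m Q| <= `|row i P| + 1.
    have /cvgrPdist_lt/(_ _ ltr01) := DQ i; apply: filterS => h H.
    rewrite -[D i h *m Q](subKr (row i P)) (le_trans (ler_normB _ _))//.
    by rewrite lerD2l ltW.
  near=> h.
  have hE : phi (u + k i h) - phi u = h *: D i h by near: h.
  have : `|phi (u + k i h) - phi u - 'd phi u (k i h)| <= 1 / (2 * c) * `|k i h| by near: h.
  have : `|D i h *m Q| <= `|row i P| + 1 by near: h.
  rewrite hE diff_tangents// => DQh rh.
  have kQ : k i h = h *: (D i h *m Q) - (h *: D i h - k i h *m tangents phi u) *m Q.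
    rewrite scalemxAl mulmxBl -(mulmxA (k i h)) BQ mulmx1.
    by rewrite subKr.
  have : `|k i h| <= `|h| * (`|row i P| + 1) + c * (1 / (2 * c) * `|k i h|).
    rewrite {1}kQ (le_trans (ler_normB _ _))// lerD//.
      by rewrite normrZ ler_wpM2l.
    by rewrite (le_trans (cQ _))// ler_pM2l.
  have -> : c * (1 / (2 * c) * `|k i h|) = `|k i h| / 2 by field; rewrite gt_eqF.
  by move: (`|k i h|) (`|h|) (`|row i P|) => x y z; nra.
have kh i : h^-1 *: k i h @[h --> (0:R)^'] --> row i P.
  have H := @cvg_mulmx _ _ _ _ _ _ Q _ _ (cvg_diff_curve dphi (k0 i) (kC i)).
  have {}H := H (dnbhs_filter _); rewrite mul0mx in H.
  have cA := cvgB (DQ i) H; rewrite subr0 in cA.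
  have E : {near (0:R)^', (fun h => D i h *m Q -
      (h^-1 *: (phi (u + k i h) - phi u) - 'd phi u (h^-1 *: k i h)) *m Q) =1
      (fun h => h^-1 *: k i h)}.
    near=> h; have h0 : h != 0 by near: h; exact: nbhs_dnbhs_neq.
    have hE : phi (u + k i h) - phi u = h *: D i h by near: h.
    rewrite hE diff_tangents// scalerA mulVf// scale1r mulmxBl -mulmxA BQ mulmx1.
    by rewrite subKr.
  by move=> O nO; apply: (near_eq_cvg E); exact: cA.
have fder (V : normedModType R) (f : 'rV[R]_d.+1 -> V) i : differentiable (f \o phi) u ->
     is_derive u' (delta_mx 0 i) (f \o phi') ('d (f \o phi) u (row i P)).
  move=> df.
  have H : h^-1 *: ((f \o phi' \o shift u') (h *: delta_mx 0 i) - (f \o phi') u')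
      @[h --> (0:R)^'] --> 'd (f \o phi) u (row i P).
    have H1 : 'd (f \o phi) u (h^-1 *: k i h) @[h --> (0:R)^'] --> 'd (f \o phi) u (row i P).
      have cd : {for row i P, continuous 'd (f \o phi) u} by exact: diff_continuous.
      by move=> O nO; exact: (kh i _ (cd O nO)).
    have H2 := cvgD (cvg_diff_curve df (k0 i) (kC i)) H1; rewrite add0r in H2.
    have E : {near (0:R)^', (fun h => h^-1 *: ((f \o phi) (u + k i h) - (f \o phi) u) -
        'd (f \o phi) u (h^-1 *: k i h) + 'd (f \o phi) u (h^-1 *: k i h)) =1
        (fun h => h^-1 *: ((f \o phi' \o shift u') (h *: delta_mx 0 i) - (f \o phi') u'))}.
      apply: filterS (kP i setT filterT) => h [_ [_ E]].
      by rewrite subrK /= -pu E.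
    by move=> O nO; apply: (near_eq_cvg E); exact: (H2 (dnbhs_filter _) O nO).
  by apply: DeriveDef; [apply/cvg_ex; exists ('d (f \o phi) u (row i P))|exact: cvg_lim].
exists P; split.
  have -> : (P \in unitmx) = row_free P by rewrite row_free_unit.
  have E : tangents phi' u' = P *m tangents phi u.
    apply/row_matrixP => i; rewrite row_mul -diff_tangents//.
    have [_ <-] := fder _ id i dphi.
    by apply/rowP => j; rewrite !mxE.
  have := fr' u' Uu'; rewrite E /row_free => /eqP rk; rewrite eqn_leq rank_leq_row/=.
  by rewrite -{1}rk mxrankM_maxl.
move=> V f i df; have := fder V f i df; rewrite diff_partial//.
by under eq_bigr do rewrite mxE.
Unshelve. all: by end_near. Qed.

End transition.

Lemma gramE (R : realType) d (X : 'rV[R]_d -> 'rV[R]_d.+1) u :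
  gram X u = tangents X u *m (tangents X u)^T.
Proof. exact: (gramm_mulmx (fun i => partial i X u)). Qed.

Lemma gram_unit (R : realType) d (X : 'rV[R]_d -> 'rV[R]_d.+1) u :
  row_free (tangents X u) -> gram X u \in unitmx.
Proof. exact: (@gramm_unit _ _ _ (fun i => partial i X u)). Qed.

Lemma surf_gradE (R : realType) d (X : 'rV[R]_d -> 'rV[R]_d.+1) (f : 'rV[R]_d -> R) u :
  surf_grad X f u = (\row_i partial i f u) *m invmx (gram X u) *m tangents X u.
Proof.
rewrite mulmx_sum_row /surf_grad exchange_big; apply: eq_bigr => j _.
rewrite -scaler_suml; congr (_ *: _); last by apply/rowP => k; rewrite !mxE.
by rewrite !mxE; apply: eq_bigr => i _; rewrite mxE mulrC.
Qed.

(** Under the transition matrix [P] the coordinate gradient [y] becomes [y *m P^T], the Gram matrix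
    [g] becomes [P *m g *m P^T], and the tangent matrix is multiplied by [P] on the left; in the
    formula of [surf_gradE] every [P] cancels. *)
Lemma surf_grad_transition (R : realType) d (M : set 'rV[R]_d.+1) U phi U' phi' u u'
    (X : 'rV[R]_d.+1 -> 'rV[R]_d.+1) (f : 'rV[R]_d.+1 -> R) :
  local_param M U phi -> local_param M U' phi' -> U u -> U' u' -> phi u = phi' u' ->
  differentiable (X \o phi) u -> differentiable (f \o phi) u ->
  row_free (tangents (X \o phi) u) ->
  surf_grad (X \o phi') (f \o phi') u' = surf_grad (X \o phi) (f \o phi) u.
Proof.
move=> lp lp' Uu Uu' pu dX df fr; have [P [uP PE]] := transition_curve lp lp' Uu Uu' pu.
have tE : tangents (X \o phi') u' = P *m tangents (X \o phi) u.
  apply/row_matrixP => i; rewrite row_mul mulmx_sum_row.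
  have [_ E] := PE _ X i dX; apply/rowP => j.
  rewrite !mxE [partial _ _ _]E !summxE; apply: eq_bigr => k _.
  by rewrite !mxE.
have fE : \row_i partial i (f \o phi') u' = (\row_i partial i (f \o phi) u) *m P^T.
  apply/rowP => i; rewrite !mxE; have [_ E] := PE _ f i df.
  rewrite [LHS]E; apply: eq_bigr => k _.
  by rewrite !mxE mulrC.
have uG := gram_unit fr.
rewrite !surf_gradE fE tE !gramE tE trmx_mul -gramE.
have -> : P *m tangents (X \o phi) u *m ((tangents (X \o phi) u)^T *m P^T) =
   P *m gram (X \o phi) u *m P^T by rewrite gramE !mulmxA.
set y := \row_i _; set g := gram _ u.
have -> : y *m P^T = y *m invmx g *m invmx P *m (P *m g *m P^T).
  by rewrite !mulmxA mulmxKV// mulmxKV.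
rewrite mulmxK; last by rewrite !unitmx_mul unitmx_tr uP uG.
by rewrite mulmxA mulmxKV.
Qed.

(** * Partition of unity *)

(* A C^1 substitute for the positive part. *)
Definition sqpos (R : realType) (y : R) : R := Num.max 0 y ^+ 2.

Lemma continuous_max0 (R : realType) : continuous (fun y : R => Num.max 0 y).
Proof.
move=> y; apply: (@continuous_max R R (cst 0) id); first exact: cst_continuous.
by move=> ?.
Qed.

Lemma is_derive_sqpos (R : realType) (y : R) : is_derive y 1 (@sqpos R) (2 * Num.max 0 y).
Proof.
have [y0|y0|->] := ltgtP y 0.
- rewrite mulr0.
  apply: (near_eq_is_derive _ (is_derive_cst (0 : R) y (1 : R))).
  have : \forall x \near y, x < 0 by exact: lt_nbhsl.
  by apply: filterS => x x0; rewrite /sqpos max_l ?ltW// expr0n.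
- have -> : 2 * y = y *: (1:R) + y *: (1:R) by rewrite /GRing.scale/= !mulr1; ring.
  apply: (near_eq_is_derive _ (is_deriveM (is_derive_id y (1:R)) (is_derive_id y (1:R)))).
  have : \forall x \near y, 0 < x by exact: lt_nbhsr.
  by apply: filterS => x x0; rewrite /sqpos max_r ?ltW// expr2.
- rewrite mulr0.
  have H : h^-1 *: ((@sqpos R \o shift 0) (h *: 1) - sqpos 0) @[h --> (0:R)^'] --> (0:R).
    have E : {near (0:R)^', (fun h => Num.max 0 h) =1
        (fun h => h^-1 *: ((@sqpos R \o shift 0) (h *: 1) - sqpos 0))}.
      near=> h; have h0 : h != 0 by near: h; exact: nbhs_dnbhs_neq.
      rewrite /sqpos /= addr0 maxxx expr0n subr0 [h *: 1]mulr1 /GRing.scale/=.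
      by have [h1|h1] := ltP 0 h; rewrite ?expr0n ?mulr0// expr2 mulKf.
    move=> O nO; apply: (near_eq_cvg E).
    have c0 : Num.max 0 h @[h --> (0:R)] --> Num.max 0 (0:R) by exact: continuous_max0.
    by rewrite maxxx in c0; exact: (nbhs_dnbhs (c0 O nO)).
  by apply: DeriveDef; [apply/cvg_ex; exists 0|exact: cvg_lim].
Unshelve. all: by end_near. Qed.

(** The Euclidean distance makes the argument of [sqpos] a polynomial. The support is still
    controlled by [ball p r], a ball of the sup norm, which contains the Euclidean one. *)
Definition bump (R : realType) n (p : 'rV[R]_n) (r : R) (x : 'rV[R]_n) : R :=
  sqpos (r ^+ 2 - \sum_l (x 0 l - p 0 l) ^+ 2).

Lemma bump_ge0 (R : realType) n (p : 'rV[R]_n) r x : 0 <= bump p r x.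
Proof. by rewrite /bump /sqpos sqr_ge0. Qed.

Lemma bump_eq0 (R : realType) n (p : 'rV[R]_n) r x : 0 < r -> ~ ball p r x -> bump p r x = 0.
Proof.
move=> r0 px; rewrite /bump /sqpos max_l ?expr0n// subr_le0 leNgt; apply/negP => H.
apply: px; rewrite -ball_normE /=; apply: mx_norm_lt => // i j; rewrite (ord1 i) !mxE distrC.
rewrite -(ltr_pXn2r (ltn0Sn 1)) ?nnegrE ?normr_ge0 ?(ltW r0)// real_normK ?num_real//.
apply: le_lt_trans H.
by rewrite (bigD1 j)//= lerDl sumr_ge0// => l _; exact: sqr_ge0.
Qed.

Lemma bump_center (R : realType) n (p : 'rV[R]_n) r : 0 < r -> 0 < bump p r p.
Proof.
move=> r0; rewrite /bump big1 ?subr0 => [|l _]; last by rewrite subrr expr0n.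
by rewrite /sqpos max_r ?ltW ?exprn_gt0.
Qed.

Lemma bump_continuous (R : realType) n (p : 'rV[R]_n) r : continuous (bump p r).
Proof.
move=> x; apply: (@continuous_comp _ _ _
  (fun x : 'rV[R]_n => r ^+ 2 - \sum_l (x 0 l - p 0 l) ^+ 2) (@sqpos R)).
  apply: (@continuousB _ R^o); first exact: cst_continuous.
  have -> : (fun x : 'rV[R]_n => \sum_l (x 0 l - p 0 l) ^+ 2) =
    \sum_l (fun x : 'rV[R]_n => (x 0 l - p 0 l) ^+ 2) by apply/funext => v; rewrite fct_sumE.
  apply: (big_ind (fun f : _ -> R => {for x, continuous f})).
  - exact: cst_continuous.
  - by move=> f g cf cg; apply: (@continuousD _ R^o).
  - move=> l _; apply: (@continuous_comp _ _ _
      (fun x : 'rV[R]_n => x 0 l - p 0 l) (fun y => y ^+ 2)).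
      by apply: (@continuousB _ R^o); [exact: coord_continuous|exact: cst_continuous].
    exact: exprn_continuous.
have [d _] := is_derive_sqpos (r ^+ 2 - \sum_l (x 0 l - p 0 l) ^+ 2).
by apply: differentiable_continuous; exact/derivable1_diffP.
Qed.

Lemma C1_on_bump (R : realType) d n (U : set 'rV[R]_d) (F : 'rV[R]_d -> 'rV[R]_n) p r :
  open U -> (forall j, C1_on U (fun u => F u 0 j)) -> C1_on U (bump p r \o F).
Proof.
move=> oU CF; apply: (@C1_on_comp _ _ _ oU (@sqpos R)
  (fun u => r ^+ 2 - \sum_l (F u 0 l - p 0 l) ^+ 2)).
  have Cc (a : R) : C1_on U (fun=> a) by exact: C1_on_cst.
  have Cs l : C1_on U (fun u => (F u 0 l - p 0 l) ^+ 2).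
    have Cl := C1_onD oU (CF l) (Cc (- p 0 l)).
    by under eq_fun do rewrite expr2; exact: (C1_onM oU Cl Cl).
  have -> : (fun u => r ^+ 2 - \sum_l (F u 0 l - p 0 l) ^+ 2) =
     (fun u => r ^+ 2 + (-1) * \sum_l (F u 0 l - p 0 l) ^+ 2).
    by apply/funext => u; rewrite mulN1r.
  exact: (C1_onD oU (Cc _) (C1_onM oU (Cc _) (C1_on_sum oU _ _ Cs))).
move=> u _; have [dd _] := is_derive_sqpos (r ^+ 2 - \sum_l (F u 0 l - p 0 l) ^+ 2).
split; first exact: dd.
have -> : derive1 (@sqpos R) = (fun y => 2 * Num.max 0 y).
  by apply/funext => y; rewrite derive1E; have [_ ->] := is_derive_sqpos y.
apply: continuousM; first exact: cst_continuous.
exact: continuous_max0.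
Qed.

Lemma ball_closed_box (R : realType) d (u : 'rV[R]_d) r : ball u r `<=` closed_box u r.
Proof.
move=> v; rewrite -ball_normE /= distrC => uv i.
by have := ler_mx_entry (v - u) 0 i; rewrite !mxE => /le_trans -> //; exact: ltW.
Qed.

Lemma nbhs_closed_box (R : realType) d (u : 'rV[R]_d) (A : set 'rV[R]_d) : nbhs u A ->
  exists2 r, 0 < r & closed_box u r `<=` A.
Proof.
move=> /nbhs_ballP[e /= e0 eA]; exists (e / 2); first by rewrite divr_gt0.
move=> v uv; apply: eA; rewrite -ball_normE /= distrC; apply: mx_norm_lt => // i j.
rewrite (ord1 i) !mxE (le_lt_trans (uv j))// ltr_pdivrMr// mulr2n mulrDr mulr1.
by rewrite ltrDl.
Qed.

(** [K] is a box around the parameter of [p]. The chart maps an open ball inside it onto a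
    relatively open part of [M], and [r] is so small that the ball around [p] meets [M] inside that
    part. *)
Lemma chart_bump (R : realType) d (M : set 'rV[R]_d.+1) p U phi :
  local_param M U phi -> (phi @` U) p ->
  exists (K : set 'rV[R]_d) (r : R), [/\ compact K, K `<=` U, 0 < r &
    forall x, M x -> ~ (phi @` K) x -> bump p r x = 0].
Proof.
move=> lp [u Uu up]; have [oU _ _ inj h] := lp.
have [e e0 eU] := nbhs_closed_box (open_nbhs_nbhs (conj oU Uu)).
have ob : open (ball u e) by exact: ball_open.
have [W oW UW] := h _ ob (subset_trans (@ball_closed_box _ _ u e) eU).
have Wp : W p.
  have : (phi @` ball u e) p by exists u => //; exact: ballxx.
  by rewrite UW => -[].
have /nbhs_ballP[r /= r0 rW] := open_nbhs_nbhs (conj oW Wp).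
exists (closed_box u e), r; split => //; first exact: closed_box_compact.
move=> x Mx Kx; apply: bump_eq0 => // px; apply: Kx.
have : (M `&` W) x by split => //; exact: rW.
by rewrite -UW => -[v /ball_closed_box uv <-]; exists v.
Qed.

(** By compactness finitely many bumps have a positive sum on [M], by which they are divided. They
    are functions on the ambient space, hence C^1 in every parametrization and not just in the chart
    they were made for. *)
Lemma manifold_partition (R : realType) d (M : set 'rV[R]_d.+1) : compact M ->
  (forall p, M p -> exists U phi, local_param M U phi /\ (phi @` U) p) ->
  exists (I : finType) (U K : I -> set 'rV[R]_d) (phi : I -> 'rV[R]_d -> 'rV[R]_d.+1)
    (chi : I -> 'rV[R]_d.+1 -> R),
  [/\ forall k, [/\ local_param M (U k) (phi k), compact (K k) & K k `<=` U k],
      forall k p, 0 <= chi k p,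
      forall k p, M p -> ~ (phi k @` K k) p -> chi k p = 0,
      forall k V psi, local_param M V psi -> C1_on V (chi k \o psi)
    & forall p, M p -> \sum_k chi k p = 1].
Proof.
move=> cM charts.
have : forall p, exists q : set 'rV[R]_d * set 'rV[R]_d * ('rV[R]_d -> 'rV[R]_d.+1) * R,
    M p -> [/\ local_param M q.1.1.1 q.1.2, compact q.1.1.2, q.1.1.2 `<=` q.1.1.1, 0 < q.2 &
      forall x, M x -> ~ (q.1.2 @` q.1.1.2) x -> bump p q.2 x = 0].
  move=> p; have [Mp|Mp] := pselect (M p); last by exists (set0, set0, fun=> 0, 0).
  have [U [phi [lp Up]]] := charts p Mp.
  have [K [r [cK KU r0 H]]] := chart_bump lp Up.
  by exists (U, K, phi, r) => _; split.
move=> /choice[q qP].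
pose f p := [set x | 0 < bump p (q p).2 x].
have := cM; rewrite compact_cover => /(_ _ M f)[p Mp||D DM MD].
- apply: (@open_comp _ _ (bump p (q p).2) [set y | 0 < y]).
    by move=> x _; exact: bump_continuous.
  exact: open_gt.
- move=> x Mx; exists x => //; have [_ _ _ r0 _] := qP x Mx; exact: bump_center.
pose J : finType := seq_sub (finmap.enum_fset D).
pose b (k : J) x := bump (val k) (q (val k)).2 x.
have Mk (k : J) : M (val k) by exact: (set_mem (DM _ (valP k))).
have b0 (k : J) x : 0 <= b k x by exact: bump_ge0.
have B0 x : M x -> 0 < \sum_k b k x.
  move=> /MD[p pD fx]; rewrite (bigD1 (SeqSub pD : J))//=; apply: ltr_pwDl; first exact: fx.
  by apply: sumr_ge0 => k _; exact: b0.
exists J, (fun k => (q (val k)).1.1.1), (fun k => (q (val k)).1.1.2), (fun k => (q (val k)).1.2),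
  (fun k x => b k x * (\sum_j b j x)^-1); split.
- by move=> k; have [] := qP _ (Mk k).
- by move=> k x; apply: mulr_ge0; [exact: b0|rewrite invr_ge0; apply: sumr_ge0 => j _; exact: b0].
- by move=> k x Mx Kx; have [_ _ _ _ H] := qP _ (Mk k); rewrite /b H// mul0r.
- move=> k V psi lp; have [oV [C1 _] _ _ _] := lp.
  have Cpsi j : C1_on V (fun u => psi u 0 j) by exact: C1_on_coord.
  have Cb j : C1_on V (fun u => b j (psi u)) by exact: C1_on_bump.
  apply: (C1_onM oV (Cb k)); apply: (C1_on_inv oV (C1_on_sum oV _ _ Cb)) => u Vu.
  by rewrite gt_eqF// B0//; exact: (local_param_sub lp).
- by move=> p Mp; rewrite -mulr_suml divff// gt_eqF// B0.
Qed.

(** * The hypersurface at a fixed time *)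

(** By [detr_frame_normal] the determinant is the inner product of [n] with the normal of [Y] times
    the determinant of the frame of [Y]; the inner product of two unit vectors is at most 1 in
    absolute value. *)
Lemma detr_frame_le_area_density (R : realType) d (Y : 'rV[R]_d -> 'rV[R]_d.+1)
    (U : set 'rV[R]_d) (nu : 'rV[R]_d -> 'rV[R]_d.+1) (n : 'rV[R]_d.+1) u :
  (forall u, U u -> row_free (tangents Y u)) ->
  (forall u, U u -> dot (nu u) (nu u) = 1) ->
  (forall u, U u -> forall i, dot (partial i Y u) (nu u) = 0) ->
  U u -> dot n n = 1 -> detr (frame n (tang Y u)) <= area_density Y u.
Proof.
move=> fY nu1 Ynu Uu n1; rewrite (area_densityE nu1 Ynu Uu).
rewrite (detr_frame_normal (nu1 u Uu) (Ynu u Uu) (fY u Uu)) (le_trans (ler_norm _))// normrM.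
by rewrite ler_piMl//; exact: (dot_unit_le1 n1 (nu1 u Uu)).
Qed.

Lemma partial_min (R : realType) d (f : 'rV[R]_d -> R) i u :
  differentiable f u -> (forall x, 0 <= f x) -> f u = 0 -> partial i f u = 0.
Proof.
move=> df f0 fu; have dv : derivable f u (delta_mx 0 i) by exact: diff_derivable.
have H : h^-1 *: (f (h *: delta_mx 0 i + u) - f u) @[h --> (0:R)^'] --> partial i f u by exact: dv.
apply/eqP; rewrite eq_le; apply/andP; split.
- apply: (cvgr_to_le (cvg_dnbhs_at_left H)); near=> h.
  have h0 : h < 0 by near: h; exact: nbhs_left_lt.
  by rewrite fu subr0 [_ *: _]mulrC nmulr_lle0 ?invr_lt0.
- apply: (cvgr_to_ge (cvg_dnbhs_at_right H)); near=> h.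
  have h0 : 0 < h by near: h; exact: nbhs_right_gt.
  by rewrite fu subr0 [_ *: _]mulrC mulr_ge0// invr_ge0 ltW.
Unshelve. all: by end_near. Qed.

Lemma local_param_comp_continuous (R : realType) d (M : set 'rV[R]_d.+1) U phi n
    (f : 'rV[R]_d.+1 -> 'rV[R]_n) : local_param M U phi -> {within M, continuous f} ->
  forall u, U u -> {for u, continuous (f \o phi)}.
Proof.
move=> lp cf u Uu O nO; have [oU [C _] _ _ _] := lp.
have H : within M (nbhs (phi u)) (f @^-1` O).
  by rewrite (nbhs_subspace_in (local_param_sub lp Uu)); exact: cf.
have cphi : {for u, continuous phi}.
  by apply: differentiable_continuous; have [] := C u Uu.
have := cphi _ H; apply: filterS2 (open_nbhs_nbhs (conj oU Uu)) => x Ux Mx.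
by apply: Mx; exact: (local_param_sub lp).
Qed.

(** On an arbitrary compact set a vanishing integral makes a nonnegative continuous [f] zero almost
    everywhere, so the conclusion about [g] concerns its integral and not its values. *)
Lemma Rintegral_eq0_trans (R : realType) d
    (m : {sigma_finite_measure set (borel_rV R d) -> \bar R}) (K : set 'rV[R]_d)
    (f g : 'rV[R]_d -> R) :
  is_lebesgue_rV m -> compact K -> {within K, continuous f} -> {within K, continuous g} ->
  (forall u, K u -> 0 <= f u) -> \int[m]_(u in K) f u = 0 ->
  (forall u, K u -> f u = 0 -> g u = 0) -> \int[m]_(u in K) g u = 0.
Proof.
move=> lm cK cf cg f0 If fg; have mK := borel_compact cK.
have mf := within_continuous_measurable mK cf.
have mg := within_continuous_measurable mK cg.
have ae0 : ae_eq m K (EFin \o f) (cst 0%E).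
  apply/(ae_eq_integral_abs m mK); first exact/measurable_EFinP.
  have -> : (\int[m]_(u in K) `|(EFin \o f) u| = \int[m]_(u in K) (f u)%:E)%E.
    by apply: eq_integral => u /set_mem Ku /=; rewrite ger0_norm ?f0.
  rewrite -[LHS]fineK; last first.
    apply: integrable_fin_num; first exact: mK.
    exact: (lebesgue_within_integrable lm cK cf).
  by rewrite -[fine _]/(\int[m]_(u in K) f u) If.
rewrite /Rintegral (ae_eq_integral (cst 0%E))//; first by rewrite integral0.
- exact/measurable_EFinP.
- by apply: filterS ae0 => u H Ku; have [fu] := H Ku; rewrite /= fg.
Qed.

Section slice.
Context {R : realType} {d : nat}.
Variables (m : {sigma_finite_measure set (borel_rV R d) -> \bar R}).
Hypothesis lm : is_lebesgue_rV m.
Variables (M : set 'rV[R]_d.+1) (cM : compact M).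
Variables (I : finType) (U K : I -> set 'rV[R]_d) (phi : I -> 'rV[R]_d -> 'rV[R]_d.+1).
Variable (chi : I -> 'rV[R]_d.+1 -> R).
Hypothesis charts : forall k, [/\ local_param M (U k) (phi k), compact (K k) & K k `<=` U k].
Hypothesis chi_ge0 : forall k p, 0 <= chi k p.
Hypothesis chi0 : forall k p, M p -> ~ (phi k @` K k) p -> chi k p = 0.
Hypothesis Cchi : forall k V psi, local_param M V psi -> C1_on V (chi k \o psi).
Hypothesis chi1 : forall p, M p -> \sum_k chi k p = 1.

Let lp k : local_param M (U k) (phi k). Proof. by have [] := charts k. Qed.

Let oU k : open (U k). Proof. by have [] := lp k. Qed.

Let cK k : compact (K k). Proof. by have [] := charts k. Qed.

Let KU k : K k `<=` U k. Proof. by have [] := charts k. Qed.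

Let w k : 'rV[R]_d -> R := chi k \o phi k.

Let Cw k : C1_on (U k) (w k). Proof. exact: Cchi. Qed.

(** [chi0] speaks of the image of [K k]; injectivity of the chart carries it to the parameter
    domain. *)
Lemma chart_weight0 k u : U k u -> ~ K k u -> w k u = 0.
Proof.
move=> Uu Ku; apply: chi0; first exact: (local_param_sub (lp k)).
move=> -[v Kv vu]; apply: Ku; have [_ _ _ inj _] := lp k.
by rewrite -(inj v u (mem_set (KU Kv)) (mem_set Uu) vu).
Qed.

Variables (X nu : 'rV[R]_d.+1 -> 'rV[R]_d.+1).
Hypothesis CX : C2_mfd M X.
Hypothesis fX : forall V psi, local_param M V psi ->
  forall u, V u -> row_free (tangents (X \o psi) u).
Hypothesis cnu : {within M, continuous nu}.
Hypothesis nuX : unit_normal M X nu.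
Variable mu : {measure set (borel_rV R d.+1) -> \bar R}.
Hypothesis muX : area_measure M X mu.

Let nu1 V psi : local_param M V psi -> forall u, V u -> dot (nu (psi u)) (nu (psi u)) = 1.
Proof. by move=> lpp u Vu; have [] := nuX lpp Vu. Qed.

Let Xnu V psi : local_param M V psi ->
  forall u, V u -> forall i, dot (partial i (X \o psi) u) (nu (psi u)) = 0.
Proof. by move=> lpp u Vu; have [] := nuX lpp Vu. Qed.

Lemma slice_area_density V psi : local_param M V psi -> C1_on V (area_density (X \o psi)).
Proof.
move=> lpp; have [oV _ _ _ _] := lpp.
exact: (C1_on_area_density oV (CX lpp) (fX lpp) (nu1 lpp) (Xnu lpp)).
Qed.

Let cJ k : {within K k, continuous (area_density (X \o phi k))}.
Proof. exact: (C1_on_within (@KU k) (slice_area_density (lp k))). Qed.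

Let cw k : {within K k, continuous (w k)}.
Proof. exact: (C1_on_within (@KU k) (@Cw k)). Qed.

Definition slice_area : R :=
  \sum_k \int[m]_(u in K k) (w k u * area_density (X \o phi k) u).

(** The weights cut [M] into pieces that each lie in one chart, where [area_measure] describes [mu]
    by a density. *)
Lemma integral_slice_area : (\int[mu]_(p in M) 1 = slice_area%:E)%E.
Proof.
transitivity (\int[mu]_(p in M) (\sum_k (chi k p)%:E))%E.
  by apply: eq_integral => p /set_mem Mp; rewrite sumEFin chi1.
rewrite (integral_sum (borel_compact cM)); last first.
  by move=> k; exact: (area_integrable lm cM muX (lp k) (@cK k) (@KU k) (@cJ k) (@cw k) (@chi0 k)).
rewrite /slice_area -sumEFin; apply: eq_bigr => k _.
rewrite (area_integralE lm muX (lp k) (@cK k) (@KU k) (@cJ k) (@cw k) (@chi0 k)).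
rewrite /Rintegral fineK//; apply: integrable_fin_num; first exact: borel_compact.
exact: (lebesgue_within_integrable lm (@cK k) (within_continuous_mul (@cw k) (@cJ k))).
Qed.

Section gradient_sum.
Variable v : 'rV[R]_d.+1 -> 'rV[R]_d.+1.
Hypothesis cv : forall k j, {within K k, continuous (fun u => v (phi k u) 0 j)}.

Let E k u := dot (surf_grad (X \o phi k) (w k) u) (v (phi k u)).

(** The chart integrand as a function on [M], zero off the image of [K k]: on [M] the terms of
    different charts can be added pointwise. *)
Let D k p := if p \in phi k @` K k then E k (chart_inv (U k) (phi k) 0 p) else 0.

Let Dphi k u : K k u -> D k (phi k u) = E k u.
Proof.
move=> Ku; rewrite /D mem_set; last by exists u.
by rewrite (chart_invK _ (lp k))//; exact: KU.
Qed.

Let D0 k p : M p -> ~ (phi k @` K k) p -> D k p = 0.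
Proof. by move=> _ Kp; rewrite /D memNset. Qed.

Let cg k : {within K k, continuous (gradient_term (w k) (X \o phi k) (v \o phi k))}.
Proof.
exact: (gradient_term_continuous (@oU k) (@cK k) (@KU k) (@Cw k) (CX (lp k)) (fX (lp k))
  (nu1 (lp k)) (Xnu (lp k)) (@cv k)).
Qed.

(** [gradient_term] is continuous and the area density does not vanish; dividing by it leaves
    [E k]. *)
Let cE k : {within K k, continuous (E k)}.
Proof.
have [oV [C f]] := conj (@oU k) (conj (CX (lp k)) (fX (lp k))).
have Jgt u : U k u -> 0 < area_density (X \o phi k) u.
  exact: (area_density_gt0 f (nu1 (lp k)) (Xnu (lp k))).
have cJV : {within K k, continuous (fun u => (area_density (X \o phi k) u)^-1)}.
  apply: (C1_on_within (@KU k)); apply: (C1_on_inv oV (slice_area_density (lp k))).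
  by move=> u /Jgt J0; rewrite gt_eqF.
apply: (eq_within_continuous _ (within_continuous_mul (@cg k) cJV)) => u Ku.
by rewrite /gradient_term mulfK// gt_eqF// Jgt//; exact: KU.
Qed.

Let cD k : {within K k, continuous (D k \o phi k)}.
Proof. by apply: (eq_within_continuous _ (@cE k)) => u /Dphi. Qed.

(* A weight that vanishes at p has a minimum there, hence no gradient; so all the
   gradients can be taken in one chart, where the weights sum to 1. *)
Let sum_D p : M p -> \sum_k D k p = 0.
Proof.
move=> Mp; have [k0 ck0] : exists k0, chi k0 p != 0.
  apply: contrapT => H; have := chi1 Mp; rewrite big1 => [/eqP|k _].
    by rewrite eq_sym oner_eq0.
  by apply: contrapT => /eqP ck; apply: H; exists k.
have [u0 Ku0 u0p] : (phi k0 @` K k0) p.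
  by apply: contrapT => /(chi0 Mp) c0; move: ck0; rewrite c0 eqxx.
have Uu0 := KU Ku0.
have dX0 : differentiable (X \o phi k0) u0 by have [C _] := CX (lp k0); have [] := C u0 Uu0.
have dchi k : differentiable (chi k \o phi k0) u0 by have [] := Cchi k (lp k0) Uu0.
have DE k : D k p = dot (surf_grad (X \o phi k0) (chi k \o phi k0) u0) (v p).
  have [[u Ku up]|Kp] := pselect ((phi k @` K k) p).
    have -> : D k p = dot (surf_grad (X \o phi k) (w k) u) (v p) 
      by rewrite -up (Dphi Ku).
    have Uu := KU Ku.
    exact: (congr1 (fun x => dot x (v p)) (surf_grad_transition (lp k0) (lp k) Uu0 Uu
      (etrans u0p (esym up)) dX0 (dchi k) (fX (lp k0) Uu0))).
  rewrite D0// surf_gradE; have -> : \row_i partial i (chi k \o phi k0) u0 = 0.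
    apply/rowP => i; rewrite !mxE; apply: partial_min => [|x|]; first exact: dchi.
      exact: chi_ge0.
    by rewrite /= u0p chi0.
  by rewrite !mul0mx /dot big1// => j _; rewrite mxE mul0r.
have E0 : \sum_k (\row_i partial i (chi k \o phi k0) u0) = 0 :> 'rV[R]_d.
  apply/rowP => i; rewrite summxE mxE.
  under eq_bigr do rewrite mxE.
  have dk k : is_derive u0 (delta_mx 0 i) (chi k \o phi k0) (partial i (chi k \o phi k0) u0).
    by apply: derivableP; apply: diff_derivable; exact: dchi.
  have [_ <-] := is_derive_bigsum (index_enum I) dk.
  apply: (etrans _ (derive_cst (1 : R) u0 (delta_mx 0 i : 'rV[R]_d))).
  apply: near_eq_derive; apply: (open_near (@oU k0) Uu0) => x Ux.
  by rewrite chi1//; exact: (local_param_sub (lp k0)).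
under eq_bigr do rewrite DE.
rewrite -dot_suml; under eq_bigr do rewrite surf_gradE.
by rewrite -!mulmx_suml E0 !mul0mx /dot big1// => j _; rewrite mxE mul0r.
Qed.

Lemma sum_integral_gradient_term :
  \sum_k \int[m]_(u in K k) gradient_term (w k) (X \o phi k) (v \o phi k) u = 0.
Proof.
have iD k := area_integrable lm cM muX (lp k) (@cK k) (@KU k) (@cJ k) (@cD k) (@D0 k).
have ED k := area_integralE lm muX (lp k) (@cK k) (@KU k) (@cJ k) (@cD k) (@D0 k).
have RE k : (\int[mu]_(p in M) (D k p)%:E =
    (\int[m]_(u in K k) gradient_term (w k) (X \o phi k) (v \o phi k) u)%:E)%E.
  rewrite ED /Rintegral fineK; last first.
    apply: integrable_fin_num; first exact: borel_compact.
    exact: (lebesgue_within_integrable lm (@cK k) (@cg k)).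
  by apply: eq_integral => u /set_mem Ku; rewrite Dphi.
apply: EFin_inj; rewrite -sumEFin; under eq_bigr do rewrite -RE.
apply: (etrans (esym (integral_sum (borel_compact cM) iD (index_enum I) xpredT))).
rewrite -[RHS](integral0 mu M); apply: eq_integral => p /set_mem Mp.
by rewrite sumEFin sum_D.
Qed.

End gradient_sum.

Let cnuk k : forall u, U k u -> {for u, continuous (nu \o phi k)}.
Proof. exact: (local_param_comp_continuous (lp k) cnu). Qed.

Let cXk k j : {within K k, continuous (fun u => X (phi k u) 0 j)}.
Proof. exact: (C1_on_within (@KU k) (C1_on_pos (@oU k) (CX (lp k)) j)). Qed.

Lemma slice_curvature_continuous k (v : 'rV[R]_d -> 'rV[R]_d.+1) :
  (forall j, {within K k, continuous (fun u => v u 0 j)}) ->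
  {within K k, continuous (curvature_term (w k) (X \o phi k) (nu \o phi k) v)}.
Proof.
exact: (curvature_term_continuous (@oU k) (@cK k) (@KU k) (@Cw k) (CX (lp k)) (fX (lp k))
  (@cnuk k) (nu1 (lp k)) (Xnu (lp k))).
Qed.

Lemma sum_integral_first_variation (v : 'rV[R]_d.+1 -> 'rV[R]_d.+1) :
  (forall k j, {within K k, continuous (fun u => v (phi k u) 0 j)}) ->
  \sum_k \int[m]_(u in K k) first_variation (w k) (X \o phi k) (nu \o phi k) (v \o phi k) u =
  \sum_k \int[m]_(u in K k) curvature_term (w k) (X \o phi k) (nu \o phi k) (v \o phi k) u.
Proof.
move=> cv; apply: etrans (etrans
  (congr1 (fun x => x + _) (sum_integral_gradient_term cv)) (add0r _)).
apply: etrans (big_split _ _ _ _ _); apply: eq_bigr => k _.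
exact: (integral_first_variation lm (@oU k) (@cK k) (@KU k) (@Cw k) (CX (lp k)) (fX (lp k))
  (@cnuk k) (nu1 (lp k)) (Xnu (lp k)) (@cv k)).
Qed.

Lemma slice_scaling : d%:R * slice_area =
  - \sum_k \int[m]_(u in K k) curvature_term (w k) (X \o phi k) (nu \o phi k) (X \o phi k) u.
Proof.
rewrite -sum_integral_first_variation// -sumrN mulr_sumr; apply: eq_bigr => k _.
exact: (integral_scaling lm (@oU k) (@cK k) (@KU k) (@Cw k) (@chart_weight0 k) (CX (lp k))
  (fX (lp k)) (@cnuk k) (nu1 (lp k)) (Xnu (lp k))).
Qed.

Let wJ_ge0 k u : 0 <= w k u * area_density (X \o phi k) u.
Proof. by apply: mulr_ge0; [exact: chi_ge0|exact: sqrtr_ge0]. Qed.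

Lemma slice_area_gt0 : M !=set0 -> 0 < slice_area.
Proof.
move=> [p Mp]; have [k ck0] : exists k, chi k p != 0.
  apply: contrapT => H; have := chi1 Mp; rewrite big1 => [/eqP|k _].
    by rewrite eq_sym oner_eq0.
  by apply: contrapT => /eqP ck; apply: H; exists k.
have [u Ku up] : (phi k @` K k) p.
  by apply: contrapT => /(chi0 Mp) c0; move: ck0; rewrite c0 eqxx.
have Ik j : 0 <= \int[m]_(u in K j) (w j u * area_density (X \o phi j) u).
  by apply: Rintegral_ge0 => x _; exact: wJ_ge0.
rewrite /slice_area (bigD1 k)//= ltr_pwDl ?sumr_ge0// lt_neqAle Ik andbT eq_sym.
apply/negP => /eqP I0.
have Uu := KU Ku.
have Jgt x : U k x -> 0 < area_density (X \o phi k) x.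
  by move=> Ux; exact: (area_density_gt0 (fX (lp k)) (nu1 (lp k)) (Xnu (lp k)) Ux).
have nw : \forall x \near u, U k x /\ w k x != 0.
  have : nbhs u (w k @^-1` [set y | y != 0]).
    apply: (C1_on_continuous (@Cw k) Uu).
    by apply: open_nbhs_nbhs; split; [exact: open_neq|rewrite /w /= up].
  exact: filterS2 (open_nbhs_nbhs (conj (@oU k) Uu)).
have [r r0 rU] := nbhs_closed_box nw.
have boxK : closed_box u r `<=` K k.
  by move=> x /rU[Ux wx]; apply: contrapT => /(chart_weight0 Ux) w0; rewrite w0 eqxx in wx.
have mb := @measurable_closed_box _ _ u r.
have cb := @closed_box_compact _ _ u r.
have cwJ := within_continuous_mul (@cw k) (@cJ k).
have cwJb := continuous_subspaceW boxK cwJ.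
have I1 : \int[m]_(x in closed_box u r) (w k x * area_density (X \o phi k) x) = 0.
  apply/eqP; rewrite eq_le; apply/andP; split; last by apply: Rintegral_ge0 => x _; exact: wJ_ge0.
  rewrite -I0 /Rintegral fine_le//.
  - by apply: integrable_fin_num => //; exact: (lebesgue_within_integrable lm cb).
  - apply: integrable_fin_num; first exact: borel_compact.
    exact: (lebesgue_within_integrable lm (@cK k)).
  - apply: ge0_subset_integral => //; first exact: borel_compact.
    + apply/measurable_EFinP; exact: (within_continuous_measurable (borel_compact (@cK k))).
    + by move=> x _; rewrite lee_fin.
have c1 : {within closed_box u r, continuous (fun=> 1 : R)} by move=> x; exact: cst_continuous.
(* On the box the integrand never vanishes, so the second function may be the constant 1: a zero
   integral would give the box zero volume. *)
have := Rintegral_eq0_trans lm cb cwJb c1 (fun x _ => wJ_ge0 k x) I1.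
have [_ mbox _] := lm; rewrite (Rintegral_cst _ mb) mul1r => H.
have mE : fine (m (closed_box u r)) = (r *+ 2) ^+ d by rewrite mbox// ltW.
have : (r *+ 2) ^+ d = 0.
  apply: (etrans (esym mE)); apply: H => x /rU[Ux wx] /eqP; rewrite mulf_eq0 (negPf wx)/= gt_eqF//.
  exact: Jgt.
by apply/eqP; rewrite gt_eqF// exprn_gt0// pmulrn_lgt0.
Qed.

(** The factor [c] may vary from point to point without a common lower bound; what counts is where
    the integrand vanishes. A zero total would make weight times mean curvature zero almost
    everywhere in each chart, hence also the curvature terms of the position field, and
    [slice_scaling] would equate [d] times a positive area with zero. *)
Lemma curvature_flow_gt0 (v : 'rV[R]_d.+1 -> 'rV[R]_d.+1) :
  (0 < d)%N -> M !=set0 ->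
  (forall k j, {within K k, continuous (fun u => v (phi k u) 0 j)}) ->
  (forall k u, U k u -> exists2 c, 0 < c &
    dot (v (phi k u)) (nu (phi k u)) = c * - surf_div (X \o phi k) (nu \o phi k) u) ->
  0 < \sum_k \int[m]_(u in K k) curvature_term (w k) (X \o phi k) (nu \o phi k) (v \o phi k) u.
Proof.
move=> d0 M0 cv vH.
have cge0 k u : K k u -> 0 <= curvature_term (w k) (X \o phi k) (nu \o phi k) (v \o phi k) u.
  move=> /KU /vH[c c0 E]; apply: mulr_ge0; last exact: sqrtr_ge0.
  apply: mulr_ge0; first exact: chi_ge0.
  by rewrite [dot _ _]E -mulrA; apply: mulr_ge0; [exact: ltW|rewrite -expr2; exact: sqr_ge0].
have Ige0 k : 0 <= \int[m]_(u in K k)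
    curvature_term (w k) (X \o phi k) (nu \o phi k) (v \o phi k) u.
  by apply: Rintegral_ge0 => u; exact: cge0.
rewrite lt_neqAle sumr_ge0// andbT eq_sym; apply/negP => /eqP S0.
have I0 k : \int[m]_(u in K k) curvature_term (w k) (X \o phi k) (nu \o phi k) (v \o phi k) u = 0.
  exact: (psumr_eq0P (fun k _ => Ige0 k) S0 (i := k) isT).
have := slice_scaling; rewrite big1 ?oppr0 => [/eqP|k _].
  by rewrite mulf_eq0 pnatr_eq0 gtn_eqF//= gt_eqF// slice_area_gt0.
apply: (Rintegral_eq0_trans lm (@cK k) (slice_curvature_continuous (@cv k))
  (slice_curvature_continuous (@cXk k)) (cge0 k) (I0 k)) => u Ku.
have [c c0 E] := vH k u (KU Ku).
have J0 : area_density (X \o phi k) u != 0.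
  by rewrite gt_eqF// (area_density_gt0 (fX (lp k)) (nu1 (lp k)) (Xnu (lp k)) (KU Ku)).
move=> /eqP; rewrite /curvature_term [X in _ * (X * _)]E !mulf_eq0 (negPf J0) (gt_eqF c0) !orbF/=.
by rewrite orbb => /orP[/eqP ->|/eqP ->]; rewrite ?mul0r// mulr0 mulr0 mul0r.
Qed.

End slice.

(** * Evolution of the area *)

Lemma uniform_cvg_near (R : realType) (S : Type) (T : choiceType) (V : normedModType R) (K : set T)
    (F : set_system S) (f_ : S -> T -> V) (f : T -> V) : Filter F ->
  {uniform K, f_ s @[s --> F] --> f} ->
  forall e : R, 0 < e -> \forall s \near F, forall u, K u -> `|f u - f_ s u| < e.
Proof.
move=> FF H e e0.
have : nbhs (f : {uniform` K -> V}) [set h | forall u, K u -> `|f u - h u| < e].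
  apply/uniform_nbhs; exists [set xy | ball xy.1 e xy.2]; split.
    exact: entourage_ball (PosNum e0).
  by move=> h Kh u Ku; have := Kh u Ku; rewrite /= -ball_normE.
by move/H.
Qed.

Lemma uniform_bcvg (R : realType) (T : topologicalType) (K : set T) (f_ : nat -> T -> R) f :
  compact K -> (forall n, {within K, continuous (f_ n)}) -> {within K, continuous f} ->
  (forall e, 0 < e -> \forall n \near \oo, forall u, K u -> `|f u - f_ n u| < e) ->
  bcvg K f_ f.
Proof.
move=> cK cf_ cf H; split => // [u Ku|].
  by apply/cvgrPdist_lt => e e0; apply: filterS (H e e0) => n; apply.
have /compact_bounded[N [_ mrt]] := continuous_compact cf cK.
exists (`|N| + 1 + 1); apply: filterS (H 1 ltr01) => n Hn u Ku.
rewrite -[f_ n u](subKr (f u)) (le_trans (ler_normB _ _))// lerD ?(ltW (Hn u Ku))//.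
by apply: mrt; [rewrite ltr_pwDr// ler_norm|exists u].
Qed.

Lemma uniform_bcvg_coord (R : realType) (T : topologicalType) (S : Type) n (K : set T)
    (F : set_system S) (f_ : S -> T -> 'rV[R]_n) (f : T -> 'rV[R]_n) (s_ : nat -> S) j :
  Filter F -> compact K ->
  (forall k, {within K, continuous (fun u => f_ (s_ k) u 0 j)}) ->
  {within K, continuous (fun u => f u 0 j)} ->
  {uniform K, f_ s @[s --> F] --> f} -> s_ @ \oo --> F ->
  bcvg K (fun k u => f_ (s_ k) u 0 j) (fun u => f u 0 j).
Proof.
move=> FF cK cf_ cf H sF; apply: uniform_bcvg => // e e0.
have H2 : \forall k \near \oo, forall u, K u -> `|f u - f_ (s_ k) u| < e.
  exact: (sF _ (uniform_cvg_near FF H e0)).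
apply: filterS H2 => k Hk u Ku.
by have := ler_mx_entry (f u - f_ (s_ k) u) 0 j; rewrite !mxE => /le_lt_trans; apply; exact: Hk.
Qed.

Lemma cvg_seq_within (R : realType) (D : set R) (s_ : nat -> R) (t : R) :
  (forall n, D (s_ n)) -> s_ n @[n --> \oo] --> t -> s_ n @[n --> \oo] --> within D (nbhs t).
Proof.
move=> Ds st P nP; have H : \forall n \near \oo, D (s_ n) -> P (s_ n) by exact: st nP.
by apply: filterS H => n; apply.
Qed.

Lemma cvg_seq_within_dnbhs (R : realType) (D : set R) (s_ : nat -> R) (t : R) :
  (forall n, D (s_ n)) -> (forall n, s_ n != t) -> s_ n @[n --> \oo] --> t ->
  s_ n @[n --> \oo] --> within D t^'.
Proof.
move=> Ds nt st P nP.
have H : \forall n \near \oo, s_ n != t -> D (s_ n) -> P (s_ n) by exact: st nP.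
by apply: filterS H => n; apply.
Qed.

Section flow.
Context {R : realType} {d : nat}.
Variables (m : {sigma_finite_measure set (borel_rV R d) -> \bar R}).
Hypothesis lm : is_lebesgue_rV m.
Variables (T : R) (M : set 'rV[R]_d.+1) (theta nu : R -> 'rV[R]_d.+1 -> 'rV[R]_d.+1).
Hypothesis htheta : evolving_immersed T M theta.
Hypothesis hnu : normal_field T M theta nu.
Variables (I : finType) (U K : I -> set 'rV[R]_d) (phi : I -> 'rV[R]_d -> 'rV[R]_d.+1).
Variable (chi : I -> 'rV[R]_d.+1 -> R).
Hypothesis charts : forall k, [/\ local_param M (U k) (phi k), compact (K k) & K k `<=` U k].
Hypothesis chi_ge0 : forall k p, 0 <= chi k p.
Hypothesis chi0 : forall k p, M p -> ~ (phi k @` K k) p -> chi k p = 0.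
Hypothesis Cchi : forall k V psi, local_param M V psi -> C1_on V (chi k \o psi).
Hypothesis chi1 : forall p, M p -> \sum_k chi k p = 1.

Let lp k : local_param M (U k) (phi k). Proof. by have [] := charts k. Qed.

Let oU k : open (U k). Proof. by have [] := lp k. Qed.

Let cK k : compact (K k). Proof. by have [] := charts k. Qed.

Let KU k : K k `<=` U k. Proof. by have [] := charts k. Qed.

Let w k : 'rV[R]_d -> R := chi k \o phi k.

Let Cw k : C1_on (U k) (w k). Proof. exact: Cchi. Qed.

Lemma flow_C2 t : t \in `[0, T] -> C2_mfd M (theta t).
Proof. by move=> tT; have [_ _ H _] := htheta; have [] := H t tT. Qed.

Lemma flow_immersion t : t \in `[0, T] -> forall V psi, local_param M V psi ->
  forall u, V u -> row_free (tangents (theta t \o psi) u).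
Proof. by move=> tT; have [_ _ _] := htheta; apply. Qed.

Lemma flow_compact : compact M.
Proof. by have [[]] := htheta. Qed.

Lemma flow_normal_continuous t : t \in `[0, T] -> {within M, continuous (nu t)}.
Proof.
move=> tT; have [/subspace_continuousP cnu _] := hnu.
apply/subspace_continuousP => p Mp O nO.
have [[A B] /= [nA nB] AB] := cnu (t, p) (conj tT Mp) O nO.
apply: filterS nB => q Bq Mq; apply: (AB (t, q)) => /=; last by split.
by split => //=; exact: nbhs_singleton.
Qed.

Let C2k t k : t \in `[0, T] -> C2_on (U k) (theta t \o phi k).
Proof. by move=> tT; exact: flow_C2 (lp k). Qed.

Let tang_continuous t k i j : t \in `[0, T] ->
  {within K k, continuous (fun u => partial i (theta t \o phi k) u 0 j)}.
Proof. by move=> tT; exact: (C1_on_within (@KU k) (C1_on_tang (@oU k) (C2k k tT) i j)). Qed.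

Let tang2_continuous t k i l j : t \in `[0, T] ->
  {within K k, continuous (fun u => partial i (partial l (theta t \o phi k)) u 0 j)}.
Proof. move=> tT;
  exact: (@partial_within _ _ _ (U k) (K k) i (partial l (theta t \o phi k)) j (@KU k)
    (C1_on_tang (@oU k) (C2k k tT) l)). Qed.

Definition flow_area t := slice_area m K phi chi (theta t).

Section sequence.
Variables (s_ : nat -> R) (t : R).
Hypothesis sT : forall n, s_ n \in `[0, T].
Hypothesis tT : t \in `[0, T].
Hypothesis st : s_ n @[n --> \oo] --> t.

Let sW : s_ n @[n --> \oo] --> within `[0, T] (nbhs t).
Proof. exact: cvg_seq_within. Qed.

Let uniform_tang k i : {uniform K k, partial i (theta s \o phi k)
  @[s --> within `[0, T] (nbhs t)] --> partial i (theta t \o phi k)}.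
Proof.
have [_ _ H _] := htheta; have [_ H2] := H t tT.
by have [_ + _] := H2 _ _ _ (lp k) (@cK k) (@KU k); apply.
Qed.

Let uniform_tang2 k i l : {uniform K k, partial i (partial l (theta s \o phi k))
  @[s --> within `[0, T] (nbhs t)] --> partial i (partial l (theta t \o phi k))}.
Proof.
have [_ _ H _] := htheta; have [_ H2] := H t tT.
by have [_ _ +] := H2 _ _ _ (lp k) (@cK k) (@KU k); apply.
Qed.

Lemma bcvg_flow_tang k i j :
  bcvg (K k) (fun n u => partial i (theta (s_ n) \o phi k) u 0 j)
     (fun u => partial i (theta t \o phi k) u 0 j).
Proof.
exact: (@uniform_bcvg_coord _ _ _ _ _ (within `[0, T] (nbhs t))
  (fun s => partial i (theta s \o phi k)) (partial i (theta t \o phi k)) s_ j (within_filter _ _)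
  (@cK k) (fun n => @tang_continuous _ k i j (sT n)) (@tang_continuous _ k i j tT)
  (@uniform_tang k i) sW).
Qed.

Lemma bcvg_flow_tang2 k i l j :
  bcvg (K k) (fun n u => partial i (partial l (theta (s_ n) \o phi k)) u 0 j)
     (fun u => partial i (partial l (theta t \o phi k)) u 0 j).
Proof.
exact: (@uniform_bcvg_coord _ _ _ _ _ (within `[0, T] (nbhs t))
  (fun s => partial i (partial l (theta s \o phi k))) (partial i (partial l (theta t \o phi k)))
  s_ j (within_filter _ _) (@cK k) (fun n => @tang2_continuous _ k i l j (sT n))
  (@tang2_continuous _ k i l j tT) (@uniform_tang2 k i l) sW).
Qed.

Lemma cvg_flow_area : flow_area (s_ n) @[n --> \oo] --> flow_area t.
Proof.
rewrite /flow_area /slice_area; apply: cvg_big => [|k _]; first exact: add_continuous.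
have bJ := bcvg_area_density (bcvg_flow_tang k).
exact: (cvg_Rintegral_bcvg lm (@cK k) (bcvgM (C1_on_bcvg (@cK k) (@KU k) (@Cw k)) bJ)).
Qed.

End sequence.

Let velocity_continuous t k j : t \in `[0, T] ->
  {within K k, continuous (fun u => dtime T theta t (phi k u) 0 j)}.
Proof.
move=> tT; have [_ [_ _ H] _ _] := htheta; have [cv _] := H t tT.
apply: continuous_in_subspaceT => u /set_mem/KU Uu.
apply: (@continuous_comp _ _ _ (dtime T theta t \o phi k) (fun A : 'rV[R]_d.+1 => A 0 j)).
  exact: (local_param_comp_continuous (lp k) cv Uu).
exact: coord_continuous.
Qed.

Lemma bcvg_flow_velocity (s_ : nat -> R) (t : R) k j :
  (forall n, s_ n \in `[0, T]) -> t \in `[0, T] -> (forall n, s_ n != t) ->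
  s_ n @[n --> \oo] --> t ->
  bcvg (K k) (fun n u => (t - s_ n)^-1 * (theta t (phi k u) 0 j - theta (s_ n) (phi k u) 0 j))
    (fun u => dtime T theta t (phi k u) 0 j).
Proof.
move=> sT tT nt st; have [_ [_ H _] _ _] := htheta.
have pc r i : r \in `[0, T] -> {within K k, continuous (fun u => theta r (phi k u) 0 i)}.
  by move=> rT; exact: (C1_on_within (@KU k) (C1_on_pos (@oU k) (C2k k rT) i)).
apply: uniform_bcvg => [|n||e e0]; first exact: cK.
- apply: within_continuous_mul; first by move=> x; exact: cst_continuous.
  exact: (within_continuous_add (pc _ _ tT) (within_continuous_opp (pc _ _ (sT n)))).
- exact: velocity_continuous.
have H2 : \forall n \near \oo, forall p, M p ->
    `|dtime T theta t p - (s_ n - t)^-1 *: (theta (s_ n) p - theta t p)| < e.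
  exact: (cvg_seq_within_dnbhs sT nt st (uniform_cvg_near (within_filter _ _) (H t tT) e0)).
apply: filterS H2 => n Hn u /KU Uu.
apply: le_lt_trans (Hn _ (local_param_sub (lp k) Uu)).
apply: le_trans (ler_mx_entry _ 0 j); rewrite !mxE -(opprB t) invrN mulNr -mulrN opprB.
by [].
Qed.

Hypothesis d0 : (0 < d)%N.
Variable mu : R -> {measure set (borel_rV R d.+1) -> \bar R}.
Hypothesis hmu : forall t, t \in `[0, T] -> area_measure M (theta t) (mu t).
Hypothesis velocity : forall t, t \in `[0, T] -> forall k u, U k u -> exists2 c, 0 < c &
  dot (dtime T theta t (phi k u)) (nu t (phi k u)) =
  c * - surf_div (theta t \o phi k) (nu t \o phi k) u.

(** If there were no such [r], the quotients along a sequence increasing to [t] would all be at most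
    zero, against the positive limit of their lower bounds. *)
Lemma flow_area_left (s t : R) : s \in `[0, T] -> t \in `[0, T] -> s < t ->
  exists r, [/\ s < r, r < t & flow_area t < flow_area r].
Proof.
move=> sT tT st; apply: contrapT => nex.
have Ale r : s < r -> r < t -> flow_area r <= flow_area t.
  by move=> sr rt; rewrite leNgt; apply/negP => H; apply: nex; exists r.
(* The factor 1/2 keeps even [s_ 0] strictly to the right of [s], so the whole sequence lies in the
   open interval. *)
pose a_ n := (t - s) / 2 * n.+1%:R^-1 : R.
have a0 n : 0 < a_ n by rewrite !mulr_gt0 ?invr_gt0 ?subr_gt0.
pose s_ n := t - a_ n.
have s_t n : s_ n < t by rewrite ltrBlDr ltrDl.
have ss_ n : s < s_ n.
  rewrite ltrBrDr -ltrBrDl /a_ -mulrA gtr_pMr ?subr_gt0// -invfM invf_lt1 ?mulr_gt0//.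
  by rewrite (@lt_le_trans _ _ 2)// ?ltr1n// ler_peMr// ler1n.
have s_T n : s_ n \in `[0, T].
  move: sT tT; rewrite !in_itv /= => /andP[s0 _] /andP[_ tT'].
  by rewrite (le_trans s0 (ltW (ss_ n))) (le_trans (ltW (s_t n)) tT').
have s_cvg : s_ n @[n --> \oo] --> t.
  rewrite -[X in _ --> X]subr0; apply: cvgB; first exact: cvg_cst.
  rewrite -(mulr0 ((t - s) / 2)); apply: cvgM; first exact: cvg_cst.
  exact: cvg_harmonic.
have [[M0 _ _ _ _] _ _ _] := htheta; have [_ nuX] := hnu.
have nu1 r V psi : r \in `[0, T] -> local_param M V psi -> forall u, V u ->
    dot (nu r (psi u)) (nu r (psi u)) = 1.
  by move=> rT lpp u Vu; have [] := nuX r rT _ _ lpp u Vu.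
have Xnu r V psi : r \in `[0, T] -> local_param M V psi -> forall u, V u ->
    forall i, dot (partial i (theta r \o psi) u) (nu r (psi u)) = 0.
  by move=> rT lpp u Vu; have [] := nuX r rT _ _ lpp u Vu.
have cnuk k : forall u, U k u -> {for u, continuous (nu t \o phi k)}.
  exact: (local_param_comp_continuous (lp k) (flow_normal_continuous tT)).
have /boolp.choice[L LP] : forall k, exists L : nat -> R,
    L n @[n --> \oo] --> \int[m]_(u in K k) first_variation (w k) (theta t \o phi k)
      (nu t \o phi k) (dtime T theta t \o phi k) u /\
    forall n, L n <= (a_ n)^-1 *
      (\int[m]_(u in K k) (w k u * area_density (theta (s_ n) \o phi k) u) -
       \int[m]_(u in K k) (w k u * area_density (theta t \o phi k) u)).
  move=> k.
  apply: (first_variation_lower_limit lm (@oU k) (@cK k) (@KU k) (@Cw k)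
    (@chart_weight0 _ _ _ _ _ _ _ _ charts chi0 k) (C2k k tT) (flow_immersion tT (lp k))
    (@cnuk k) (nu1 t _ _ tT (lp k)) (Xnu t _ _ tT (lp k))) => //.
  - by move=> u _; exact: chi_ge0.
  - by move=> n; exact: C2k.
  - by move=> i j; exact: bcvg_flow_tang.
  - by move=> i l j; exact: bcvg_flow_tang2.
  - move=> j; have := bcvg_flow_velocity k j s_T tT (fun n => negbT (lt_eqF (s_t n))) s_cvg.
    have -> // : (fun n u => (t - s_ n)^-1 * (theta t (phi k u) 0 j - theta (s_ n) (phi k u) 0 j)) =
      (fun n u => (a_ n)^-1 * (theta t (phi k u) 0 j - theta (s_ n) (phi k u) 0 j)).
    by apply/funext => n; apply/funext => u; rewrite subKr.
  - move=> n u Uu; have n1 := patch_normal_unit (flow_immersion tT (lp k))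
      (nu1 t _ _ tT (lp k)) (Xnu t _ _ tT (lp k)) Uu.
    exact: (detr_frame_le_area_density (flow_immersion (s_T n) (lp k))
      (nu1 _ _ _ (s_T n) (lp k)) (Xnu _ _ _ (s_T n) (lp k)) Uu n1).
have cL : \sum_k L k n @[n --> \oo] --> \sum_k \int[m]_(u in K k)
    first_variation (w k) (theta t \o phi k) (nu t \o phi k) (dtime T theta t \o phi k) u.
  by apply: cvg_big => [|k _]; [exact: add_continuous|have [] := LP k].
have cv k j := @velocity_continuous t k j tT.
(* Summed over the charts, the gradients of the weights drop out of the limit and the curvature
   terms remain. *)
rewrite (sum_integral_first_variation lm flow_compact charts chi_ge0 chi0 Cchi chi1
  (flow_C2 tT) (flow_immersion tT) (flow_normal_continuous tT) (nuX t tT) (hmu tT) cv) in cL.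
have := curvature_flow_gt0 lm flow_compact charts chi_ge0 chi0 Cchi chi1
  (flow_C2 tT) (flow_immersion tT) (flow_normal_continuous tT) (nuX t tT) (hmu tT) d0 M0 cv
  (velocity tT).
apply/negP; rewrite -leNgt; apply: (cvgr_to_le cL); apply: nearW => n.
apply: (@le_trans _ _ ((a_ n)^-1 * (flow_area (s_ n) - flow_area t))).
  rewrite /flow_area /slice_area -sumrB mulr_sumr; apply: ler_sum => k _.
  by have [] := LP k.
by rewrite pmulr_rle0 ?invr_gt0// subr_le0 Ale.
Qed.

End flow.

(* The maximum of [f] over [s, t] can only be attained at [s]. *)
Lemma decreasing_of_left_greater (R : realType) (a b : R) (f : R -> R) :
  (forall (u_ : nat -> R) (t : R), (forall n, u_ n \in `[a, b]) -> t \in `[a, b] ->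
    u_ n @[n --> \oo] --> t -> f (u_ n) @[n --> \oo] --> f t) ->
  (forall s t, s \in `[a, b] -> t \in `[a, b] -> s < t ->
    exists r, [/\ s < r, r < t & f t < f r]) ->
  forall s t, s \in `[a, b] -> t \in `[a, b] -> s < t -> f t < f s.
Proof.
move=> fc fl s t sab tab st.
have sub r : r \in `[s, t] -> r \in `[a, b].
  move: sab tab; rewrite !in_itv /= => /andP[as_ _] /andP[_ tb] /andP[sr rt].
  by rewrite (le_trans as_ sr) (le_trans rt tb).
have cf : {within `[s, t], continuous f}.
  (* Composition with this retraction onto [[s, t]] extends [f] to the whole line, where sequential
     continuity gives continuity. *)
  pose clamp x := Num.max s (Num.min t x).
  have clampE x : x \in `[s, t] -> clamp x = x.
    by rewrite in_itv /= => /andP[sx xt]; rewrite /clamp min_r// max_r.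
  have clamp_in x : clamp x \in `[s, t].
    rewrite in_itv /= /clamp le_max lexx/= ge_max ge_min lexx/= (ltW st)//.
  have cc : continuous clamp.
    move=> x; apply: (@continuous_max R R (cst s) (fun x => Num.min t x)).
      exact: cst_continuous.
    by apply: (@continuous_min R R (cst t) id); [exact: cst_continuous|move=> ?].
  have cfc : continuous (f \o clamp).
    move=> x; apply/(@cvg_nbhsP _ R^o) => u_ ux; apply: fc => [n||]; [exact: sub|exact: sub|].
    exact: (cvg_comp _ _ ux (cc x)).
  apply: (eq_within_continuous (f := f \o clamp)) => [x /=|]; first by move/clampE => ->.
  by apply: continuous_subspaceT.
have [r rst rmax] := EVT_max (ltW st) cf.
have [sr rt] : s <= r /\ r <= t by move: rst; rewrite in_itv /= => /andP[].
have no_left q : q \in `[s, t] -> s < q -> f q < f r.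
  move=> qst sq; have [x [sx xq fx]] := fl s q sab (sub _ qst) sq.
  apply: (lt_le_trans fx); apply: rmax; rewrite in_itv /= (ltW sx)/=.
  by move: qst; rewrite in_itv /= => /andP[_ qt]; rewrite (le_trans (ltW xq)).
have rs : r = s.
  apply/eqP; rewrite eq_le sr andbT leNgt; apply/negP => /(no_left r rst).
  by rewrite ltxx.
by rewrite -rs; apply: no_left => //; rewrite in_itv /= lexx (ltW st).
Qed.

Theorem theorem3p3 (R : realType) (d : nat) (hd : (1 <= d)%N)
    (G : R -> R) (hG : C3_fun G) (hg : forall x, 0 < gfun G x)
    (T : R) (hT : 0 < T)
    (M : set 'rV[R]_d.+1)
    (theta : R -> 'rV[R]_d.+1 -> 'rV[R]_d.+1)
    (htheta : evolving_immersed T M theta)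
    (nu : R -> 'rV[R]_d.+1 -> 'rV[R]_d.+1)
    (hnu : normal_field T M theta nu)
    (c : R -> 'rV[R]_d.+1 -> R)
    (hc1 : C1_C0 T M c)
    (hc2 : C0_C2 T M c)
    (hsol : solves T M theta nu c G)
    (mu : R -> {measure set (borel_rV R d.+1) -> \bar R})
    (hmu : forall t : R, t \in `[0, T] -> area_measure M (theta t) (mu t)) :
  forall s t : R, s \in `[0, T] -> t \in `[0, T] -> s < t ->
    (\int[mu t]_(p in M) 1 < \int[mu s]_(p in M) 1)%E.

Proof.
have [hM _ _ _] := htheta; have [_ _ cM charts _] := hM.
have [m lm] := lebesgue_rV_ex R d.
have [I [U [K [phi [chi [chartsP chi_ge0 chi0 Cchi chi1]]]]]] := manifold_partition cM charts.
have areaE r : r \in `[0, T] -> (\int[mu r]_(p in M) 1 = (flow_area m theta K phi chi r)%:E)%E.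
  move=> rT; have [_ nuX] := hnu.
  exact: (integral_slice_area lm cM chartsP chi0 Cchi chi1 (flow_C2 htheta rT)
    (flow_immersion htheta rT) (nuX r rT) (hmu r rT)).
(* This is the first equation of the system: the mean curvature is [- surf_div], and the factor
   [gfun G] at the current concentration is positive by [hg]. *)
have velocity r : r \in `[0, T] -> forall k u, U k u -> exists2 c, 0 < c &
    dot (dtime T theta r (phi k u)) (nu r (phi k u)) =
    c * - surf_div (theta r \o phi k) (nu r \o phi k) u.
  move=> rT k u Uu; have [lp _ _] := chartsP k.
  by have [H _] := hsol _ _ lp r u rT Uu; exists (gfun G (c r (phi k u))).
move=> s t sT tT st; rewrite !areaE// lte_fin.
apply: (@decreasing_of_left_greater _ 0 T (flow_area m theta K phi chi)) => //.
- by move=> u_ x; exact: (cvg_flow_area lm htheta chartsP Cchi).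
- by move=> x y; exact: (flow_area_left lm htheta hnu chartsP chi_ge0 chi0 Cchi chi1 hd hmu
    velocity).
Qed.
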